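(* Let $\mathfrak g=\mathfrak{sl}_2$, $\hat I=\{0,1\}$, $V=V(\Lambda_1)\otimes V(\Lambda_1)$, and $\Phi\in\hat P^+$. Then $[V:V(\Phi)]\neq0$ only if $\Phi=2\Lambda_{1-j}-s\delta$ for some $j\in\hat I$ and some integer $s\ge0$, and, in that case, $$[V:V(\Phi)]=\sum_{l=0}^{\lfloor L\rfloor}\rho_{2l+j}(s-2l^2-2jl)\qquad\text{where}\qquad L=\frac{-j+\sqrt{2s+j}}{2}.$$
   Context: **Affine $\mathfrak{sl}_2$.** Let $h=h_1$ be the standard coroot of $\mathfrak g=\mathfrak{sl}_2$, with simple root $\alpha_1$ and fundamental weight $\omega_1$. $\hat{\mathfrak g}=\mathfrak g\otimes\mathbb C[t,t^{-1}]\oplus\mathbb Cc\oplus\mathbb Cd$ with $c$ central, $[x\otimes t^a,y\otimes t^b]=[x,y]\otimes t^{a+b}+a\delta_{a,-b}(x,y)c$, $[d,x\otimes t^a]=a\,x\otimes t^a$, where $(\,,)$ is the invariant form normalized so that roots have squared length 2. $\hat{\mathfrak h}=\mathbb Ch\oplus\mathbb Cc\oplus\mathbb Cd$, $h_0=c-h_1$. The weights $\omega_1,\Lambda_0,\delta\in\hat{\mathfrak h}^*$ satisfy $\omega_1(h)=1,\omega_1(c)=\omega_1(d)=0$; $\Lambda_0(c)=1,\Lambda_0(h)=\Lambda_0(d)=0$; $\delta(d)=1,\delta(h)=\delta(c)=0$; and $\Lambda_1=\Lambda_0+\omega_1$. The simple roots are $\alpha_1=2\omega_1$ and $\alpha_0=\delta-\alpha_1$.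 $\hat P^+=\{\lambda\in\hat{\mathfrak h}^*:\lambda(h_0),\lambda(h_1)\in\mathbb Z_{\ge0}\}$. For $\Lambda\in\hat P^+$, $V(\Lambda)$ is the irreducible integrable $\hat{\mathfrak g}$-module of highest weight $\Lambda$; if $V\cong\bigoplus_{\Phi\in\hat P^+}V(\Phi)^{\oplus m_\Phi}$ with $m_\Phi\in\mathbb Z_{\ge0}$ (as tensor products of two such irreducibles do), then $[V:V(\Phi)]:=m_\Phi$. **Partitions.** For integers $m>0$ and $k\ge0$, $\rho_k(m)$ is the number of partitions of $m$ with all parts at most $k$; $\rho_k(0)=1$ and $\rho_k(m)=0$ if $m<0$. $\lfloor a\rfloor$ is the integer part of $a\ge 0$. *)

(* Defs.v *)
From HB Require Import structures.
From mathcomp Require Import all_boot all_order all_algebra.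
From mathcomp Require Import complex.
From mathcomp Require Import boolp classical_sets functions cardinality fsbigop.
From mathcomp Require Import reals.

Set Implicit Arguments.
Unset Strict Implicit.
Unset Printing Implicit Defensive.

Import Order.TTheory GRing.Theory Num.Theory.
Local Open Scope classical_set_scope.
Local Open Scope ring_scope.

Section Sl2.
Variable R : realType.
Local Notation C := (complex R).

Definition sl2_pred : pred 'M[C]_2 := fun x => \tr x == 0.

Lemma sl2_submod_closed : submod_closed sl2_pred.
Proof.
split=> [|a x y /eqP hx /eqP hy]; first by rewrite unfold_in linear0.
by apply/eqP; rewrite linearP /= hx hy mulr0 addr0.
Qed.
HB.instance Definition _ :=
  GRing.isSubmodClosed.Build C 'M[C]_2 sl2_pred sl2_submod_closed.

Record sl2 := Sl2 { sl2_mx :> 'M[C]_2; _ : sl2_mx \in sl2_pred }.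
HB.instance Definition _ := [isSub for sl2_mx].
HB.instance Definition _ := [Choice of sl2 by <:].
HB.instance Definition _ := [SubChoice_isSubLmodule of sl2 by <:].

Lemma sl2_bracket_subproof (x y : sl2) :
  (sl2_mx x *m sl2_mx y - sl2_mx y *m sl2_mx x) \in sl2_pred.
Proof. by rewrite unfold_in linearB /= mxtrace_mulC subrr. Qed.
Definition sl2_bracket (x y : sl2) : sl2 := Sl2 (sl2_bracket_subproof x y).

(* The trace form gives (h, h) = 2, i.e. roots of squared length 2. *)
Definition sl2_form (x y : sl2) : C := \tr (sl2_mx x *m sl2_mx y).

Lemma sl2_e_subproof : delta_mx 0 1 \in sl2_pred.
Proof. by rewrite unfold_in /mxtrace big_ord_recl big_ord1 !mxE /= addr0. Qed.
Definition sl2_e : sl2 := Sl2 sl2_e_subproof.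

Lemma sl2_f_subproof : delta_mx 1 0 \in sl2_pred.
Proof. by rewrite unfold_in /mxtrace big_ord_recl big_ord1 !mxE /= addr0. Qed.
Definition sl2_f : sl2 := Sl2 sl2_f_subproof.

Definition sl2_h : sl2 := sl2_bracket sl2_e sl2_f.

End Sl2.

(* sl2 (x) C[t, t^-1]: x stands for the sum of the (x n) (x) t^n. *)
Section Loop.
Variable R : realType.
Local Notation C := (complex R).

Definition fsupp (x : int -> sl2 R) : set int := [set n | x n != 0].

Definition loop_pred : pred (int -> sl2 R) := fun x => `[< finite_set (fsupp x) >].

Lemma loop_submod_closed : submod_closed loop_pred.
Proof.
split=> [|a x y /asboolP hx /asboolP hy]; apply/asboolP.
  apply: (sub_finite_set (B := set0)) => // n.
  by rewrite /fsupp /= eqxx.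
apply: (sub_finite_set (B := fsupp x `|` fsupp y)); last by rewrite finite_setU.
move=> n hn; case: (eqVneq (x n) 0) => [xn|]; last by left.
right; move: hn; rewrite /fsupp /=; apply: contraNN => /eqP yn.
by rewrite fctE (_ : (a *: x) n = a *: x n) // xn yn scaler0 addr0.
Qed.
HB.instance Definition _ :=
  GRing.isSubmodClosed.Build C (int -> sl2 R) loop_pred loop_submod_closed.

Record loop := Loop { loop_coef :> int -> sl2 R; _ : loop_coef \in loop_pred }.
HB.instance Definition _ := [isSub for loop_coef].
HB.instance Definition _ := [Choice of loop by <:].
HB.instance Definition _ := [SubChoice_isSubLmodule of loop by <:].

Lemma loop_finite (x : loop) : finite_set (fsupp x).
Proof. by case: x => x hx; apply/asboolP. Qed.

Lemma cur_subproof (x : sl2 R) (a : int) :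
  (fun n => if n == a then x else 0) \in loop_pred.
Proof.
apply/asboolP; apply: (sub_finite_set (B := [set a])); last exact: finite_set1.
by move=> n; rewrite /fsupp /=; case: (n =P a) => // _; rewrite eqxx.
Qed.
(* x (x) t^a *)
Definition cur (x : sl2 R) (a : int) : loop := Loop (cur_subproof x a).

Definition loop_bracket_fun (x y : loop) (n : int) : sl2 R :=
  \sum_(k \in [set: int]) sl2_bracket (x k) (y (n - k)).

Lemma sl2_bracket0l (y : sl2 R) : sl2_bracket 0 y = 0.
Proof. by apply: val_inj; rewrite /= mul0mx mulmx0 subrr. Qed.

Lemma sl2_bracket0r (y : sl2 R) : sl2_bracket y 0 = 0.
Proof. by apply: val_inj; rewrite /= mulmx0 mul0mx subrr. Qed.

Lemma loop_bracket_subproof (x y : loop) : loop_bracket_fun x y \in loop_pred.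
Proof.
apply/asboolP.
pose S := [set p.1 + p.2 | p in fsupp x `*` fsupp y].
apply: (sub_finite_set (B := S)); last first.
  by apply: finite_image; apply: finite_setX; exact: loop_finite.
move=> n; rewrite /fsupp /= => /negP hn; apply: contrapT => nS; apply: hn.
apply/eqP; rewrite /loop_bracket_fun; apply: fsbig1 => k _.
case: (eqVneq (x k) 0) => [->|xk]; first exact: sl2_bracket0l.
case: (eqVneq (y (n - k)) 0) => [->|yk]; first exact: sl2_bracket0r.
by case: nS; exists (k, n - k) => //=; rewrite addrC subrK.
Qed.
Definition loop_bracket (x y : loop) : loop := Loop (loop_bracket_subproof x y).

Lemma loop_degree_subproof (x : loop) : (fun n => n%:~R *: x n) \in loop_pred.
Proof.
apply/asboolP; apply: sub_finite_set (loop_finite x) => n.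
by rewrite /fsupp /=; apply: contra => /eqP ->; rewrite scaler0.
Qed.
(* The derivation t d/dt. *)
Definition loop_degree (x : loop) : loop := Loop (loop_degree_subproof x).

Definition loop_cocycle (x y : loop) : C :=
  \sum_(k \in [set: int]) k%:~R * sl2_form (x k) (y (- k)).

(* (x, a, b) stands for x + a c + b d. *)
Definition ghat : Type := (loop * C^o * C^o)%type.
HB.instance Definition _ := GRing.Lmodule.on ghat.

Definition cur_hat (x : sl2 R) (a : int) : ghat := (cur x a, 0, 0).
Definition c_hat : ghat := (0, 1, 0).
Definition d_hat : ghat := (0, 0, 1).

Definition bracket (u v : ghat) : ghat :=
  (loop_bracket u.1.1 v.1.1 + u.2 *: loop_degree v.1.1 - v.2 *: loop_degree u.1.1,
   loop_cocycle u.1.1 v.1.1, 0).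

Lemma bracket_cur x y a b :
  bracket (cur_hat x a) (cur_hat y b) =
  cur_hat (sl2_bracket x y) (a + b)
  + (a%:~R * (a == - b)%:R * sl2_form x y) *: c_hat.
Proof.
rewrite /bracket /= !scale0r subr0 addr0 /cur_hat /c_hat.
have -> : loop_bracket (cur x a) (cur y b) = cur (sl2_bracket x y) (a + b).
  apply: val_inj; apply/funext => n /=; rewrite /loop_bracket_fun.
  rewrite -(fsbig_widen [set a] setT) //=; last first.
    by move=> k /= [_ /eqP/negbTE ->]; rewrite sl2_bracket0l.
  rewrite fsbig_set1 eqxx subr_eq [b + a]addrC.
  by case: ifP => // _; rewrite sl2_bracket0r.
have -> : loop_cocycle (cur x a) (cur y b) =
          a%:~R * (a == - b)%:R * sl2_form x y.
  rewrite /loop_cocycle -(fsbig_widen [set a] setT) //=; last first.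
    by move=> k /= [_ /eqP/negbTE ->]; rewrite /sl2_form mul0mx linear0 mulr0.
  rewrite fsbig_set1 eqxx eqr_oppLR.
  case: ifP => _; rewrite ?mulr1 // /sl2_form mulmx0 linear0 !mulr0 mul0r //.
set z : C := _ * sl2_form _ _; set X := cur _ _.
have z1 : z *: (1 : C^o) = z by exact: mulr1.
by apply/eqP; rewrite !xpair_eqE /= z1 !scaler0 !addr0 add0r !eqxx.
Qed.

Lemma loop_bracket0l x : loop_bracket 0 x = 0.
Proof.
apply: val_inj; apply/funext => n; apply: fsbig1 => k _.
exact: sl2_bracket0l.
Qed.

Lemma loop_bracket0r x : loop_bracket x 0 = 0.
Proof.
apply: val_inj; apply/funext => n; apply: fsbig1 => k _.
exact: sl2_bracket0r.
Qed.

Lemma loop_cocycle0l x : loop_cocycle 0 x = 0.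
Proof. by apply: fsbig1 => k _; rewrite /sl2_form mul0mx linear0 mulr0. Qed.

Lemma loop_cocycle0r x : loop_cocycle x 0 = 0.
Proof. by apply: fsbig1 => k _; rewrite /sl2_form mulmx0 linear0 mulr0. Qed.

Lemma bracket_d x a : bracket d_hat (cur_hat x a) = a%:~R *: cur_hat x a.
Proof.
rewrite /bracket /= loop_bracket0l loop_cocycle0l scale1r scale0r subr0 add0r.
have -> : loop_degree (cur x a) = a%:~R *: cur x a.
  apply: val_inj; apply/funext => n /=.
  rewrite (_ : (a%:~R *: _) n = a%:~R *: (if n == a then x else 0)) //.
  by case: eqP => [->//|_]; rewrite !scaler0.
by apply/eqP; rewrite !xpair_eqE /= !scaler0 !eqxx.
Qed.

Lemma bracket_c u : bracket c_hat u = 0 /\ bracket u c_hat = 0.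
Proof.
have deg0 : loop_degree 0 = 0.
  by apply: val_inj; apply/funext => n; exact: scaler0.
rewrite /bracket /= loop_bracket0l loop_bracket0r loop_cocycle0l loop_cocycle0r.
by rewrite deg0 scaler0 !scale0r subr0 addr0.
Qed.

End Loop.

Section Modules.
Variable R : realType.
Local Notation C := (complex R).
Local Notation e := (sl2_e R).
Local Notation f := (sl2_f R).

Record ghat_module := GhatModule {
  module_sort :> lmodType C;
  ghat_act : ghat R -> module_sort -> module_sort;
  ghat_act_linearl : forall v, linear (ghat_act^~ v);
  ghat_act_linearr : forall x, linear (ghat_act x);
  ghat_act_bracket : forall x y v,
    ghat_act (bracket x y) v = ghat_act x (ghat_act y v) - ghat_act y (ghat_act x v)
}.

(* An element a h + b c + e d of the Cartan subalgebra is the triple (a, b, e),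
   and a weight L is the triple (L h, L c, L d). *)
Definition hhat : Type := (C^o * C^o * C^o)%type.
HB.instance Definition _ := GRing.Lmodule.on hhat.
Definition hhat_ghat (H : hhat) : ghat R :=
  (H.1.1 *: cur (sl2_h R) 0, H.1.2, H.2).

Definition weight : Type := (C^o * C^o * C^o)%type.
HB.instance Definition _ := GRing.Lmodule.on weight.
Definition weight_eval (L : weight) (H : hhat) : C :=
  L.1.1 * H.1.1 + L.1.2 * H.1.2 + L.2 * H.2.

Definition c_coroot : hhat := (0, 1, 0).
Definition h1 : hhat := (1, 0, 0).
Definition h0 : hhat := c_coroot - h1.

Definition omega1 : weight := (1, 0, 0).
Definition Lambda0 : weight := (0, 1, 0).
Definition delta : weight := (0, 0, 1).
Definition Lambda1 : weight := Lambda0 + omega1.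
Definition Lambda (i : 'I_2) : weight := if i == 0 then Lambda0 else Lambda1.

(* The set P^+; note that L d is an arbitrary complex number. *)
Definition dominant (L : weight) : Prop :=
  (exists n : nat, weight_eval L h0 = n%:R) /\
  (exists n : nat, weight_eval L h1 = n%:R).

Definition chev_e (i : 'I_2) : ghat R :=
  if i == 0 then cur_hat f 1 else cur_hat e 0.
Definition chev_f (i : 'I_2) : ghat R :=
  if i == 0 then cur_hat e (-1) else cur_hat f 0.

(* The positive part C e + sl2 (x) t C[t]. *)
Definition nplus (x : ghat R) : Prop :=
  [/\ forall n : int, n < 0 -> x.1.1 n = 0,
      exists a : C, x.1.1 0 = a *: e,
      x.1.2 = 0 & x.2 = 0].

Definition weight_vector (M : ghat_module) (L : weight) (v : M) : Prop :=
  forall H : hhat, ghat_act (hhat_ghat H) v = weight_eval L H *: v.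

Definition highest_weight_vector (M : ghat_module) (L : weight) (v : M) : Prop :=
  [/\ v <> 0, weight_vector L v & forall x, nplus x -> ghat_act x v = 0].

Definition is_submodule (M : ghat_module) (U : set M) : Prop :=
  [/\ U 0, forall (a : C) u v, U u -> U v -> U (a *: u + v)
    & forall x u, U u -> U (ghat_act x u)].

Definition is_irreducible (M : ghat_module) : Prop :=
  (exists v : M, v <> 0) /\
  (forall U : set M, is_submodule U -> U = [set 0] \/ U = setT).

Definition is_integrable (M : ghat_module) : Prop :=
  (forall v : M, exists s : seq M, v = \sum_(w <- s) w /\
     forall w, w \in s -> exists L, weight_vector L w) /\
  (forall (i : 'I_2) (v : M), exists n : nat,
     iter n (ghat_act (chev_e i)) v = 0 /\ iter n (ghat_act (chev_f i)) v = 0).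

(* M is a model of V(L). *)
Definition is_V (L : weight) (M : ghat_module) : Prop :=
  [/\ is_irreducible M, is_integrable M & exists v : M, highest_weight_vector L v].

Definition is_bilinear (U V W : lmodType C) (b : U -> V -> W) : Prop :=
  (forall v, linear (b^~ v)) /\ (forall u, linear (b u)).

(* tau exhibits T as the tensor product of M and N. *)
Definition is_tensor (M N T : ghat_module) (tau : M -> N -> T) : Prop :=
  [/\ is_bilinear tau,
      forall (W : lmodType C) (b : M -> N -> W), is_bilinear b ->
        (exists g : {linear T -> W}, forall u v, g (tau u v) = b u v) /\
        (forall g g' : {linear T -> W},
           (forall u v, g (tau u v) = g' (tau u v)) -> g =1 g')
    & forall x u v, ghat_act x (tau u v) = tau (ghat_act x u) v + tau u (ghat_act x v)].

Definition module_hom (M N : ghat_module) (g : M -> N) : Prop :=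
  linear g /\ forall x v, g (ghat_act x v) = ghat_act x (g v).

(* The map from the direct sum of the N k to T with components iota k is
   bijective. *)
Definition is_direct_sum (K : eqType) (N : K -> ghat_module) (T : ghat_module)
    (iota : forall k, N k -> T) : Prop :=
  (forall t : T, exists (s : seq K) (x : forall k, N k),
     t = \sum_(k <- s) iota k (x k)) /\
  (forall (s : seq K) (x : forall k, N k), uniq s ->
     \sum_(k <- s) iota k (x k) = 0 -> forall k, k \in s -> x k = 0).

(* T is isomorphic to the direct sum, over Phi in P^+, of m Phi copies of
   V Phi; then [T : V Phi] = m Phi. *)
Definition decomposition (V : weight -> ghat_module) (T : ghat_module)
    (m : weight -> nat) : Prop :=
  (forall Phi, ~ dominant Phi -> m Phi = 0%N) /\
  exists iota : forall k : {Phi : weight & 'I_(m Phi)}, V (tag k) -> T,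
    (forall k, module_hom (iota k)) /\ is_direct_sum iota.

End Modules.

Arguments Lambda {R} i.
Arguments Lambda1 {R}.
Arguments delta {R}.

(* A partition of n is a weakly decreasing sequence of positive integers of sum
   n; it has at most n parts. *)
Definition rho (k : nat) (m : int) : nat :=
  match m with
  | Posz n => #|[pred p : n.-bseq 'I_k.+1 |
       [&& sorted geq (map val p), all (fun i => 0 < i)%N (map val p)
         & sumn (map val p) == n]]|
  | Negz _ => 0
  end.

(* The real number L bounding the sum; L >= 0 when j <= 1. *)
Definition sum_bound (R : realType) (j s : nat) : R :=
  (- j%:R + Num.sqrt (2 * s%:R + j%:R)) / 2.

(* Main.v *)
(* V(Lambda1) (x) V(Lambda1) is realized on four real fermions: on the Fock space of
   psi^0, ..., psi^3 with modes in Z + 1/2, left and right multiplication by quaternions give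
   two commuting copies of affine sl2 of level 1, and the part of odd parity is irreducible
   under both. It is isomorphic to the tensor square because both are generated by a vector of
   top principal degree that lies in every nonzero stable subspace, so that the submodule
   generated by the pair of these vectors is the graph of an isomorphism.
   For the diagonal copy, of level 2, the energies of psi^1, psi^2, psi^3 on a highest weight
   vector are determined by the weight through the Sugawara (bosonization) identity for a pair
   of fermions; hence either only psi^0 is excited, or in addition one unit of
   'i psi^2 + psi^3 of energy 1/2. Multiplicities thus count finite sets A of naturals
   with a given sum of 2k + 1 over k in A. Sorting by the size m = 2l + j of A and removing
   the staircase 0, 1, ..., m - 1 turns these into partitions with at most m parts,
   equivalently with parts at most m. *)
From HB Require Import structures.
From Stdlib Require PeanoNat.
Require Import Defs.
From mathcomp Require Import all_boot all_order all_algebra.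
From mathcomp Require Import zify ring.
From mathcomp Require Import complex.
From mathcomp Require Import boolp classical_sets functions cardinality fsbigop.
From mathcomp Require Import reals.

Set Implicit Arguments.
Unset Strict Implicit.
Unset Printing Implicit Defensive.

Import Order.TTheory GRing.Theory Num.Theory.
Local Open Scope ring_scope.

(** * Generalized eigenspaces *)

Section Spectra.
Variable K : fieldType.
Implicit Types V W : lmodType K.

(** Quaternions enter because four fermions carry so(4), which is the sum of two copies of sl2
    acting by left and right multiplication. For the diagonal copy, left and minus right
    multiplication add up to a commutator, which kills the quaternion 1: so psi^0 decouples from the
    diagonal currents and its states label the multiplicities. Each imaginary direction splits the
    four fermions into two pairs, and the mixed terms of the squared currents cancel between the two
    copies, so every direction by itself measures the whole energy. No character formula is used.
    Spectral statements are phrased by annihilating polynomials, and eigenvectors are found only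
    modulo a stable subspace; this is enough for irreducibility. The principal grading is chosen
    because its degree zero part is the Cartan subalgebra alone, so that the top space of an
    irreducible module is a line. On Fock space the operators are infinite sums, and an identity
    between them is reduced to commutators with the fermion modes and one vacuum expectation. *)

Definition mklin V W (f : V -> W) (lf : linear f) : {linear V -> W} :=
  HB.pack f (GRing.isLinear.Build K V W *:%R f lf).

Lemma lin_add V W (f g : V -> W) : linear f -> linear g -> linear (fun v => f v + g v).
Proof. by move=> lf lg c u v; rewrite lf lg scalerDr addrACA. Qed.

Lemma lin_scale V W (d : K) (f : V -> W) : linear f -> linear (fun v => d *: f v).
Proof. by move=> lf c u v; rewrite lf scalerDr !scalerA mulrC. Qed.

Lemma lin_sum V W (I : Type) (r : seq I) (f : I -> V -> W) :
  (forall i, linear (f i)) -> linear (fun v => \sum_(i <- r) f i v).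
Proof.
by move=> lf c u v; rewrite scaler_sumr -big_split; apply: eq_bigr => i _; rewrite lf.
Qed.

Lemma lin_comp V W (X : lmodType K) (f : {linear W -> X}) (g : V -> W) :
  linear g -> linear (fun v => f (g v)).
Proof. by move=> lg c u v; rewrite lg linearP. Qed.

Definition subspace V (U : V -> Prop) :=
  U 0 /\ forall (c : K) u v, U u -> U v -> U (c *: u + v).

Lemma subspaceD V (U : V -> Prop) u v : subspace U -> U u -> U v -> U (u + v).
Proof. by move=> [_ h] hu hv; rewrite -[u]scale1r; apply: h. Qed.

Lemma subspaceZ V (U : V -> Prop) c u : subspace U -> U u -> U (c *: u).
Proof. by move=> [h0 h] hu; rewrite -[_ *: u]addr0; apply: h. Qed.

Lemma subspaceN V (U : V -> Prop) u : subspace U -> U u -> U (- u).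
Proof. by move=> sU hu; rewrite -scaleN1r; apply: subspaceZ. Qed.

Lemma subspaceB V (U : V -> Prop) u v : subspace U -> U u -> U v -> U (u - v).
Proof. by move=> sU hu hv; apply: subspaceD => //; apply: subspaceN. Qed.

Lemma subspace_sum V (U : V -> Prop) (I : Type) (r : seq I) (P : pred I) F :
  subspace U -> (forall i, P i -> U (F i)) -> U (\sum_(i <- r | P i) F i).
Proof.
move=> sU h; elim/big_rec: _ => [|i x Pi Ux]; first by case: sU.
by apply: subspaceD => //; apply: h.
Qed.

Lemma subspace0 V : subspace (fun v : V => v = 0).
Proof. by split=> // c u v -> ->; rewrite scaler0 addr0. Qed.

Lemma subspace_preim V W (f : {linear V -> W}) (U : W -> Prop) :
  subspace U -> subspace (fun v => U (f v)).
Proof.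
move=> [U0 UL]; split=> [|c u v hu hv]; first by rewrite linear0.
by rewrite linearP; apply: UL.
Qed.

Lemma subspace_all V (I : Type) (U : I -> V -> Prop) :
  (forall i, subspace (U i)) -> subspace (fun v => forall i, U i v).
Proof.
move=> sU; split=> [i|c u v hu hv i]; first by case: (sU i).
by case: (sU i) => _; apply.
Qed.

Lemma subspace_and V (U W : V -> Prop) :
  subspace U -> subspace W -> subspace (fun v => U v /\ W v).
Proof.
move=> [U0 UL] [W0 WL]; split=> // c u v [? ?] [? ?].
by split; [apply: UL | apply: WL].
Qed.

Section Poly.
Variable V : lmodType K.
Implicit Types (A : {linear V -> V}) (P Q : K -> Prop) (s t : seq K) (v : V).

(** The split polynomial with roots [s], evaluated at [A] and applied to [v]. *)
Definition pker A s v := foldr (fun c u => A u - c *: u) v s.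

Lemma pker_lin A s : linear (pker A s).
Proof.
move=> c u v; elim: s => //= d s ->.
by rewrite linearP scalerDr !scalerA mulrC scalerBr scalerA; rewrite addrACA opprD.
Qed.

Lemma pkerZ A s c u : pker A s (c *: u) = c *: pker A s u.
Proof. exact: (linearZ_LR (mklin (pker_lin A s))). Qed.

Lemma pker0 A s : pker A s 0 = 0.
Proof. exact: (linear0 (mklin (pker_lin A s))). Qed.

Lemma pkerD A s u v : pker A s (u + v) = pker A s u + pker A s v.
Proof. exact: (linearD (mklin (pker_lin A s))). Qed.

Lemma pkerB A s u v : pker A s (u - v) = pker A s u - pker A s v.
Proof. exact: (linearB (mklin (pker_lin A s))). Qed.

Lemma pker_comm A s v : A (pker A s v) = pker A s (A v).
Proof. by elim: s => //= c s <-; rewrite linearB linearZ. Qed.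

Lemma pkerC A s t v : pker A s (pker A t v) = pker A t (pker A s v).
Proof.
by elim: s => //= c s IH; rewrite {}IH pkerB pkerZ -pker_comm.
Qed.

Lemma pker_cat A s t v : pker A (s ++ t) v = pker A s (pker A t v).
Proof. exact: foldr_cat. Qed.

Lemma pker_eigen A s c v : A v = c *: v ->
  pker A s v = (\prod_(d <- s) (c - d)) *: v.
Proof.
move=> Av; elim: s => [|d s IH] /=; first by rewrite big_nil scale1r.
by rewrite IH linearZ /= Av big_cons !scalerA -scalerBl; congr (_ *: _); ring.
Qed.

(** [v] lies in the sum of the generalized eigenspaces of [A] with eigenvalues in [P]. An
    annihilating polynomial expresses this without decomposing [v], and maps that shift eigenvalues
    carry it along. *)
Definition spec P A v := exists2 s, (forall c, c \in s -> P c) & pker A s v = 0.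

Lemma spec_subspace P A : subspace (spec P A).
Proof.
split; first by exists [::].
move=> c u v [s hs su] [t ht tv]; exists (s ++ t) => [d|].
  by rewrite mem_cat => /orP[/hs|/ht].
by rewrite pker_cat pkerD pkerZ tv addr0 pkerZ pkerC su pker0 scaler0.
Qed.

Lemma spec_eigen P A v c : P c -> A v = c *: v -> spec P A v.
Proof.
move=> Pc Av; exists [:: c] => [d|/=]; first by rewrite inE => /eqP->.
by rewrite Av subrr.
Qed.

Lemma spec_disjoint P Q A v :
  (forall c, P c -> Q c -> False) -> spec P A v -> spec Q A v -> v = 0.
Proof.
move=> PQ [s hs sv] [t]; elim: t => //= c t IH ht.
move=> /eqP; rewrite subr_eq0 => /eqP tv.
have: pker A s (pker A t v) = 0 by rewrite pkerC sv pker0.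
rewrite (pker_eigen _ tv) => /eqP; rewrite scaler_eq0 prodf_seq_eq0 => /orP[|/eqP].
  case/hasP => d ds /=; rewrite subr_eq0 => /eqP cd.
  by case: (PQ c); [rewrite cd; apply: hs | apply: ht; rewrite inE eqxx].
by apply: IH => d dt; apply: ht; rewrite inE dt orbT.
Qed.

(* The first vector of the chain [x], [(A - c1) x], ... not in [W] is an eigenvector modulo [W]. *)
Lemma spec_mod P A (U W : V -> Prop) x :
  subspace U -> subspace W ->
  (forall v, U v -> U (A v)) ->
  spec P A x -> U x -> ~ W x ->
  exists c y s, [/\ P c, U y, ~ W y, W (A y - c *: y) & y = pker A s x].
Proof.
move=> sU sW UA [s hs sx] Ux nWx.
have Us : forall t, U (pker A t x).
  elim=> //= c t Ut; apply: subspaceB => //; [exact: UA|exact: subspaceZ].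
have: W (pker A s x) by rewrite sx; case: sW.
elim: s {sx} hs => [|c s IH] hs /=; first by [].
have [Ws _|nWs Wc] := EM (W (pker A s x)).
  by apply: IH => // d ds; apply: hs; rewrite inE ds orbT.
by exists c, (pker A s x), s; split=> //; apply: hs; rewrite inE eqxx.
Qed.

End Poly.

Lemma spec_map (V W : lmodType K) (f : {linear V -> W}) (A : {linear V -> V})
    (B : {linear W -> W}) (P Q : K -> Prop) (k : K) v :
  (forall v, B (f v) = f (A v) + k *: f v) -> (forall c, P c -> Q (c + k)) ->
  spec P A v -> spec Q B (f v).
Proof.
move=> Bf PQ [s hs sv]; exists (map (+%R^~ k) s) => [c /mapP[d /hs ds ->]|].
  exact: PQ.
suff -> : pker B (map (+%R^~ k) s) (f v) = f (pker A s v) by rewrite sv linear0.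
elim: s {hs sv} => //= c s ->; rewrite Bf linearB [f (c *: _)]linearZ_LR /=.
by rewrite scalerDl opprD addrACA subrr addr0.
Qed.

End Spectra.

(** * Commuting copies of affine sl2 *)

Inductive sl2b := Eb | Fb | Hb.

(* [x, y] = br_c x y * br_t x y in the standard basis of sl2. *)
Definition br_c (x y : sl2b) : int :=
  match x, y with
  | Eb, Fb => 1 | Fb, Eb => -1
  | Hb, Eb => 2 | Eb, Hb => -2
  | Hb, Fb => -2 | Fb, Hb => 2
  | _, _ => 0
  end.

Definition br_t (x y : sl2b) : sl2b :=
  match x, y with
  | Hb, t | t, Hb => t
  | _, _ => Hb
  end.

Definition br_f (x y : sl2b) : int :=
  match x, y with
  | Eb, Fb | Fb, Eb => 1
  | Hb, Hb => 2
  | _, _ => 0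
  end.

Definition degb (x : sl2b) : int := match x with Eb => 1 | Fb => -1 | Hb => 0 end.

(* The element x (x) t^n of the copy of affine sl2 indexed by s. *)
Definition op (S : eqType) : Type := (S * sl2b * int)%type.

(* The principal grading, in which the Chevalley generators e_0 and e_1 have degree 1. *)
Definition deg (S : eqType) (x : op S) : int := 2 * x.2 + degb x.1.2.

Section Reps.
Variable K : numFieldType.

(* Several commuting copies of the derived affine algebra, all of level l, with
   the principal grading operator. *)
Record rep (S : eqType) (V : lmodType K) (l : K) := Rep {
  ra :> op S -> {linear V -> V};
  rD : {linear V -> V};
  ra_br : forall s t m s' t' n v,
    ra (s, t, m) (ra (s', t', n) v) = ra (s', t', n) (ra (s, t, m) v)
    + (if s == s' then (br_c t t')%:~R *: ra (s, br_t t t', m + n) v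
         + (l * (m%:~R * (m + n == 0)%:R * (br_f t t')%:~R)) *: v
       else 0);
  rD_br : forall x v, rD (ra x v) = ra x (rD v) + (deg x)%:~R *: ra x v }.

Definition below (l c : K) := exists n : nat, c = l - n%:R.

(** * Degree bounds and generation by lowering operators *)

Section OneRep.
Variables (S : eqType) (V : lmodType K) (l : K) (a : rep S V l).
Implicit Types (U W Z : V -> Prop) (u v z : V) (x : op S).
Local Notation D := (rD a).

Inductive gen Z : V -> Prop :=
| gen_base z : Z z -> gen Z z
| gen_lin (c : K) u v : gen Z u -> gen Z v -> gen Z (c *: u + v)
| gen_neg x u : deg x < 0 -> gen Z u -> gen Z (a x u).

Lemma gen_subspace Z : Z 0 -> subspace (gen Z).
Proof. by move=> Z0; split; [apply: gen_base | move=> c u v; apply: gen_lin]. Qed.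

Lemma ra_br_mem U x y u : subspace U -> U u ->
  (forall x', U (a x' u)) -> U (a y (a x u)) -> U (a x (a y u)).
Proof.
case: x y => [[s t] m] [[s' t'] n] sU Uu Uxu Uyxu; rewrite ra_br.
apply: subspaceD => //; case: ifP => _; last by case: sU.
by apply: subspaceD => //; apply: subspaceZ.
Qed.

(** A substitute for the PBW theorem: an arbitrary [x] is moved past each lowering operator, and the
    commutator is again an operator applied to a shorter word, which the induction hypothesis covers
    because it holds for all [x]. *)
Lemma gen_stable Z : Z 0 ->
  (forall x z, 0 <= deg x -> Z z -> gen Z (a x z)) ->
  forall x u, gen Z u -> gen Z (a x u).
Proof.
move=> Z0 hZ x u hu; have sZ := gen_subspace Z0.
elim: hu x => [z Zz|c v w _ IHv _ IHw|y v ny gv IH] x.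
- by case: (leP 0 (deg x)) => hx; [apply: hZ|apply: gen_neg => //; apply: gen_base].
- by rewrite linearP; apply: gen_lin.
- by apply: ra_br_mem => //; apply: gen_neg.
Qed.

Lemma gen_D Z : Z 0 -> (forall z, Z z -> gen Z (D z)) ->
  forall u, gen Z u -> gen Z (D u).
Proof.
move=> Z0 hZ u; have sZ := gen_subspace Z0; elim=> [//|c v w _ IHv _ IHw|x v nx gv IH].
  by rewrite linearP; apply: gen_lin.
by rewrite rD_br; apply: subspaceD => //; [|apply: subspaceZ => //]; apply: gen_neg.
Qed.

Lemma below_shift c k : (k <= 0)%R -> forall d, below c d -> below c (d + (k : int)%:~R).
Proof.
move=> hk d [n ->]; exists (n + `|k|)%N; rewrite natrD.
by rewrite [in LHS](_ : k = - `|k|%:Z) ?mulrNz; [rewrite -pmulrn; ring | lia].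
Qed.

Lemma spec_op P (Q : K -> Prop) x v : (forall c, P c -> Q (c + (deg x)%:~R)) ->
  spec P D v -> spec Q D (a x v).
Proof. by apply: spec_map => w; apply: rD_br. Qed.

Lemma gen_spec Z c : (forall z, Z z -> spec (below c) D z) ->
  forall u, gen Z u -> spec (below c) D u.
Proof.
move=> hZ u; elim=> [//|d v w _ IHv _ IHw|x v nx _ IH].
  by case: (spec_subspace (below c) D) => _; apply.
by apply: spec_op IH; apply: below_shift; apply: ltW.
Qed.

Definition line v0 v := exists c, v = c *: v0.

Lemma line0 v0 : line v0 0. Proof. by exists 0; rewrite scale0r. Qed.

(** Each lowering operator decreases the degree by at least 1, so only the part of [u] on the line
    of [v0] escapes the lower generalized eigenspaces. *)
Lemma gen_top v0 c : D v0 = c *: v0 ->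
  forall u, gen (line v0) u -> exists d, spec (below (c - 1)) D (u - d *: v0).
Proof.
move=> Dv0 u; have sB := spec_subspace (below (c - 1)) D.
elim=> [_ [d ->]|d v w _ [dv IHv] _ [dw IHw]|x v nx gv _].
- by exists d; rewrite subrr; case: sB.
- exists (d * dv + dw); rewrite scalerDl opprD addrACA -scalerA -scalerBr.
  by case: sB => _; apply.
exists 0; rewrite scale0r subr0.
have : spec (below c) D v.
  apply: gen_spec gv => _ [d ->]; apply: subspaceZ; first exact: spec_subspace.
  by apply: spec_eigen Dv0; exists 0%N; rewrite subr0.
apply: spec_op => d [n ->].
have [k hk] : exists k : nat, deg x = - (k.+1)%:Z by exists (`|deg x|.-1)%N; lia.
by exists (n + k)%N; rewrite hk mulrNz natrD -pmulrn -natr1; ring.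
Qed.

(** A bound on the number of raising steps that [v] survives; it is the induction measure in the
    searches for highest weight vectors. *)
Fixpoint kil N v := match N with
  | 0 => v = 0
  | N.+1 => forall x, 0 < deg x -> kil N (a x v) end.

Lemma kil0 N : kil N 0.
Proof. by elim: N => //= N IH x _; rewrite linear0. Qed.

Lemma kil_le M N v : (M <= N)%N -> kil M v -> kil N v.
Proof.
elim: M N v => [|M IH] N v; first by move=> _ /= ->; apply: kil0.
by case: N => // N hMN hv x hx; apply: IH => //; apply: hv.
Qed.

(* Positive operators raise the principal degree, which is bounded on [V]. *)
Lemma spec_kil (c : K) u : (forall v, spec (below c) D v) -> exists N, kil N u.
Proof.
move=> hV.
pose up (j : int) d := exists2 i : int, d = c + i%:~R & j <= i.
have kilP N v j : spec (up j) D v -> 0 < j + N%:Z -> kil N v.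
  elim: N v j => [|N IH] v j hv hj /=.
    apply: (spec_disjoint _ hv (hV v)) => d [i -> ji] [n /addrI/eqP].
    by rewrite pmulrn -mulrNz eqr_int; lia.
  move=> x hx; apply: (IH _ (j + 1)); last by lia.
  apply: spec_op hv => d [i -> ji]; exists (i + deg x); last by lia.
  by rewrite intrD addrA.
have [s hs su] := hV u.
have [N hN] : exists N : nat, forall d, d \in s -> up (- N%:Z) d.
  elim: s hs {su} => [|d s IH] hs; first by exists 0%N.
  have [e es|N hN] := IH; first by apply: hs; rewrite inE es orbT.
  have [|n dn] := hs d; first by rewrite inE eqxx.
  exists (n + N)%N => e; rewrite inE => /orP[/eqP ->|/hN[i ei iN]].
    by exists (- n%:Z); [rewrite mulrNz | lia].
  by exists i => //; lia.
by exists N.+1; apply: (kilP _ _ (- N%:Z)); [exists s | lia].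
Qed.

(** Positive operators are applied as long as the result stays outside [W]; [kil] bounds the number
    of steps. *)
Lemma exists_hw_mod (c : K) U W u : (forall v, spec (below c) D v) ->
  (forall x v, 0 < deg x -> U v -> U (a x v)) -> subspace W ->
  U u -> ~ W u ->
  exists v, [/\ U v, ~ W v & forall x, 0 < deg x -> W (a x v)].
Proof.
move=> hV hU sW; have [N] := spec_kil u hV.
elim: N u => [|N IH] u hk Uu nWu; first by case: nWu; rewrite hk; case: sW.
have [hx|] := pselect (forall x, 0 < deg x -> W (a x u)); first by exists u.
move=> /existsNP[x /not_implyP[hx nW]].
by apply: (IH (a x u)) => //; [apply: hk | apply: hU].
Qed.

End OneRep.

(** * Irreducible highest weight representations *)

Section Irreducible.
Variables (S : eqType) (V : lmodType K) (l : K) (a : rep S V l) (v0 : V) (c : K).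
Local Notation D := (rD a).
Hypothesis irr : forall U : V -> Prop, subspace U -> (forall x u, U u -> U (a x u)) ->
  (forall u, U u -> U (D u)) -> (forall u, U u -> u = 0) \/ (forall u, U u).
Hypothesis v0_neq0 : v0 <> 0.
Hypothesis v0_D : D v0 = c *: v0.
Hypothesis v0_pos : forall x, 0 < deg x -> a x v0 = 0.
Hypothesis v0_h : forall s, line v0 (a (s, Hb, 0) v0).

(** By parity, 2 n + [degb t] vanishes only for n = 0 and t = [Hb]: in the homogeneous grading a
    whole copy of sl2 would have degree zero. *)
Lemma deg0 (x : op S) : deg x = 0 -> exists s, x = (s, Hb, 0).
Proof.
by case: x => [[s []] n]; rewrite /deg /= => h; try lia; exists s; congr (_, _); lia.
Qed.

Lemma irr_gen v : gen a (line v0) v.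
Proof.
have Z0 := line0 v0; have sl : subspace (line v0).
  by split=> // d _ _ [e ->] [f ->]; exists (d * e + f); rewrite scalerA scalerDl.
have [| |h|//] := irr (gen_subspace a Z0).
- apply: gen_stable => // x _ hx [d ->]; rewrite linearZ; apply: gen_base.
  apply: subspaceZ => //; have [dx|dx] := eqVneq (deg x) 0.
    by have [s ->] := deg0 dx; apply: v0_h.
  by rewrite v0_pos // lt_neqAle eq_sym dx.
- apply: gen_D => // _ [d ->]; rewrite linearZ; apply: gen_base.
  by apply: subspaceZ => //; exists c.
by case: v0_neq0; apply: h; apply: gen_base; exists 1; rewrite scale1r.
Qed.

Lemma irr_spec v : spec (below c) D v.
Proof.
apply: (gen_spec _ (irr_gen v)) => _ [d ->]; apply: subspaceZ; first exact: spec_subspace.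
by apply: spec_eigen v0_D; exists 0%N; rewrite subr0.
Qed.

Lemma irr_top v : exists d, spec (below (c - 1)) D (v - d *: v0).
Proof. exact: gen_top v0_D _ (irr_gen v). Qed.

Lemma top_low u : D u = c *: u -> spec (below (c - 1)) D u -> u = 0.
Proof.
move=> hu; apply: (spec_disjoint (P := eq c)); last exact: spec_eigen hu.
move=> _ <- [n /eqP]; rewrite -subr_eq0 (_ : _ - _ = n.+1%:R) ?pnatr_eq0 //.
by rewrite -natr1; ring.
Qed.

(** Once the top component is subtracted, the vector lies below the top degree and is still killed
    by positive operators. All such vectors generate a stable subspace below the top degree; it
    misses [v0], so it is zero by irreducibility. *)
Lemma irr_hw u : (forall x, 0 < deg x -> a x u = 0) -> line v0 u.
Proof.
move=> hu; have [d hd] := irr_top u; exists d; apply/eqP; rewrite -subr_eq0; apply/eqP.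
pose Z z := spec (below (c - 1)) D z /\ forall x, 0 < deg x -> a x z = 0.
have sZ : subspace Z.
  apply: subspace_and; first exact: spec_subspace.
  split=> [x _|e y z hy hz x hx]; first by rewrite linear0.
  by rewrite linearP hy // hz // scaler0 addr0.
have Z0 : Z 0 by case: sZ.
have [| |h|h] := irr (gen_subspace a Z0).
- apply: gen_stable => // x z hx [zs zp]; apply: gen_base.
  have [dx|dx] := eqVneq (deg x) 0; last by rewrite zp // lt_neqAle eq_sym dx.
  split; first by apply: spec_op zs; rewrite dx => e; rewrite addr0.
  move=> y hy; move: dx hx => /deg0[s ->] _; case: y hy => [[s' t] n] hy.
  rewrite ra_br zp // linear0 add0r addr0; case: ifP => // _.
  rewrite (_ : l * _ = 0); last first.
    by case: eqP => [->|_] /=; ring.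
  by rewrite scale0r addr0; case: t hy => hy /=; rewrite ?scale0r // zp ?scaler0.
- apply: gen_D => // z [zs zp]; apply: gen_base; split.
    by apply: (spec_map (f := D) (k := 0) _ _ zs) => [w|e]; rewrite ?scale0r addr0.
  move=> x hx; have := rD_br a x z; rewrite zp // linear0 scaler0 addr0 => <-.
  by [].
- apply: h; apply: gen_base; split=> // x hx.
  by rewrite linearB hu // linearZ_LR /= v0_pos // scaler0 subr0.
case: v0_neq0; apply: top_low => //.
by apply: (gen_spec _ (h v0)) => z [].
Qed.

(** The same operators act on the whole family, so all members are raised together until each is a
    multiple of [v0]. This takes the place of a density theorem when one factor of a tensor is moved
    with the other fixed. *)
Lemma irr_raise (I : finType) (U : (I -> V) -> Prop) (u : I -> V) :
  (forall x w, 0 < deg x -> U w -> U (fun i => a x (w i))) ->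
  U u -> ~ (forall i, u i = 0) ->
  exists d : I -> K, U (fun i => d i *: v0) /\ ~ (forall i, d i = 0).
Proof.
have [N] : exists N, forall i, kil a N (u i).
  have /choice[f hf] : forall i, exists N, kil a N (u i).
    by move=> i; apply: spec_kil irr_spec.
  exists (\max_i f i) => i; apply: kil_le (hf i); exact: leq_bigmax.
elim: N u => [|N IH] u hk hU Uu nu; first by case: nu => i; exact: hk.
have [hx|] := pselect (forall x, 0 < deg x -> forall i, a x (u i) = 0).
  have /choice[d hd] : forall i, line v0 (u i) by move=> i; apply: irr_hw => x /hx.
  exists d; rewrite (_ : (fun _ => _) = u); last by apply/funext => i; rewrite hd.
  by split=> // d0; apply: nu => i; rewrite hd d0 scale0r.
move=> /existsNP[x /not_implyP[hx nx]].
by apply: (IH (fun i => a x (u i))) => // [i|]; [apply: hk | apply: hU].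
Qed.

End Irreducible.
End Reps.

(** * Fermionic Fock space *)

Section Bits.
Local Open Scope nat_scope.

Definition bit (i n : nat) : bool := PeanoNat.Nat.testbit n i.
Definition flip (i n : nat) : nat := PeanoNat.Nat.lxor n (PeanoNat.Nat.pow 2 i).

Lemma bit_inj m n : (forall i, bit i m = bit i n) -> m = n.
Proof. exact: PeanoNat.Nat.bits_inj. Qed.

Lemma bit0 i : bit i 0 = false.
Proof. exact: PeanoNat.Nat.bits_0. Qed.

Lemma bit_flip i j n : bit j (flip i n) = bit j n (+) (i == j).
Proof.
rewrite /bit PeanoNat.Nat.lxor_spec PeanoNat.Nat.pow2_bits_eqb.
have -> : PeanoNat.Nat.eqb i j = (i == j).
  by apply/idP/eqP => [/PeanoNat.Nat.eqb_eq|->] //; apply/PeanoNat.Nat.eqb_eq.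
by case: PeanoNat.Nat.testbit; case: (i == j).
Qed.

Lemma bit_lt i n : bit i n -> i < n.
Proof.
rewrite ltnNge; apply: contraL => hn; case: n => [|n] in hn *; first by rewrite bit0.
rewrite /bit PeanoNat.Nat.bits_above_log2 //.
have := PeanoNat.Nat.log2_lt_lin n.+1; lia.
Qed.

Lemma flipK i : involutive (flip i).
Proof. by move=> n; apply: bit_inj => j; rewrite !bit_flip -addbA addbb addbF. Qed.

Lemma flipC i j n : flip i (flip j n) = flip j (flip i n).
Proof. by apply: bit_inj => k; rewrite !bit_flip -!addbA [(j == k) (+) _]addbC. Qed.

Definition bsum (f : nat -> nat) n := \sum_(i < n | bit i n) f i.

Lemma bsum_widen f n N : n <= N -> bsum f n = \sum_(i < N | bit i n) f i.
Proof.
move=> nN; rewrite /bsum (big_ord_widen_cond N (bit^~ n) f) //.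
by apply: eq_bigl => i; apply: andb_idr => /bit_lt.
Qed.

Lemma bsum_flip f i n : ~~ bit i n -> bsum f (flip i n) = bsum f n + f i.
Proof.
move=> hi; pose N := maxn (flip i n) n.
rewrite !(@bsum_widen _ _ N) ?leq_max ?leqnn ?orbT //.
have iN : i < N by rewrite leq_max bit_lt // bit_flip eqxx addbT.
rewrite (bigD1 (Ordinal iN)) /= ?bit_flip ?eqxx ?addbT // addnC; congr (_ + _).
apply: eq_bigl => j; rewrite bit_flip -val_eqE /= [i == _]eq_sym.
by case: eqP => [->|_]; rewrite ?andbF ?(negbTE hi) // addbF andbT.
Qed.

Lemma bsum0 f : bsum f 0 = 0. Proof. by rewrite /bsum big_ord0. Qed.

Lemma bsum_eq0 f n : (bsum f n == 0) = [forall i : 'I_n, bit i n ==> (f i == 0)].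
Proof. exact: sum_nat_eq0. Qed.

Lemma bsum_ge f i n : bit i n -> f i <= bsum f n.
Proof.
by move=> hi; rewrite /bsum (bigD1 (Ordinal (bit_lt hi))) //= leq_addr.
Qed.

Lemma bit_ind (P : nat -> Prop) : P 0 ->
  (forall i n, ~~ bit i n -> P n -> P (flip i n)) -> forall n, P n.
Proof.
move=> P0 PS n; have [k] := ubnP (bsum (fun => 1) n); elim: k n => // k IH n.
have [/existsP[i /= hi]|/existsPn h] := boolP [exists i : 'I_n, bit i n].
  have hi' : ~~ bit i (flip i n) by rewrite bit_flip eqxx hi.
  rewrite -{1}(flipK i n) bsum_flip // => hk; rewrite -(flipK i n).
  by apply: PS => //; apply: IH; lia.
suff -> : n = 0 by [].
apply: bit_inj => i; rewrite bit0; apply/negP => hi.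
by have := h (Ordinal (bit_lt hi)); rewrite hi.
Qed.

End Bits.

(** * Creation and annihilation operators *)

Section Fermions.
Variable K : numFieldType.

(* Fock space: 'X^n is the state whose occupied modes are the binary digits of n. *)
Notation F := {poly K}.
Implicit Types (y z : F).

(** The Jordan-Wigner sign: the parity of the occupied modes below [i]. It makes different modes
    anticommute. *)
Definition sg i n : K := (-1) ^+ (\sum_(j < i) bit j n).

Lemma sgM i n : sg i n * sg i n = 1.
Proof. by rewrite /sg -expr2 sqrr_sign. Qed.

Lemma sg_flip i j n : sg i (flip j n) = (-1) ^+ (j < i)%N * sg i n.
Proof.
rewrite /sg; case: ltnP => hj.
  rewrite (bigD1 (Ordinal hj)) //= [in RHS](bigD1 (Ordinal hj)) //= !exprD mulrA.
  congr (_ * _); first by rewrite bit_flip eqxx; case: bit => /=; ring.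
  congr (_ ^+ _); apply: eq_bigr => k; rewrite -val_eqE bit_flip /= eq_sym => /negbTE ->.
  by rewrite addbF.
rewrite mul1r; congr (_ ^+ _); apply: eq_bigr => k _; rewrite bit_flip.
by rewrite (gtn_eqF (leq_trans (ltn_ord k) hj)) addbF.
Qed.

(** The test on [bit i n] concerns the resulting state, so [b = true] creates mode [i] and
    [b = false] annihilates it. The degree bound leaves room for every flipped monomial of [y]. *)
Definition osc_fun i (b : bool) y : F :=
  \poly_(n < (\max_(m < size y) flip i m).+1)
    ((if bit i n == b then sg i n else 0) * y`_(flip i n)).

Lemma coef_osc_fun i b y n :
  (osc_fun i b y)`_n = (if bit i n == b then sg i n else 0) * y`_(flip i n).
Proof.
rewrite coef_poly; case: ltnP => // hn.
rewrite [y`__]nth_default ?mulr0 // leqNgt; apply/negP => hm.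
have := @leq_bigmax _ (fun m : 'I_(size y) => flip i m) (Ordinal hm).
by rewrite /= flipK leqNgt hn.
Qed.

Lemma osc_lin i b : linear (osc_fun i b).
Proof.
move=> c u v; apply/polyP => n.
by rewrite coefD coefZ !coef_osc_fun coefD coefZ; ring.
Qed.

Definition osc i b : {linear F -> F} := mklin (osc_lin i b).

Lemma coef_osc i b y n :
  (osc i b y)`_n = (if bit i n == b then sg i n else 0) * y`_(flip i n).
Proof. exact: coef_osc_fun. Qed.

Lemma oscC i b j c y :
  osc i b (osc j c y) + osc j c (osc i b y) = ((i == j) && (b != c))%:R *: y.
Proof.
apply/polyP => n; rewrite coefD coefZ !coef_osc !bit_flip !sg_flip.
rewrite [j == i]eq_sym; have [<-|ij] := eqVneq i j.
  rewrite flipK ltnn expr0 mul1r addbT /=; have := sgM i n.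
  case: bit b c => [] [] [] /= h; rewrite ?mul0r ?mulr0 ?mulrA ?h; ring.
rewrite addbF addbF (flipC i j) andFb mul0r.
have -> : (j < i)%N = ~~ (i < j)%N by rewrite -leqNgt ltn_neqAle eq_sym ij.
by case: (bit i n == b) (bit j n == c) (i < j)%N => [] [] [] /=; ring.
Qed.

Lemma osc_X i n : ~~ bit i n -> osc i true 'X^n = sg i n *: 'X^(flip i n).
Proof.
move=> hi; apply/polyP => m; rewrite coef_osc coefZ !coefXn.
have -> : (flip i m == n) = (m == flip i n) by rewrite -(inj_eq (can_inj (flipK i))) flipK.
case: (m =P flip i n) => [->|_]; last by rewrite !mulr0.
by rewrite bit_flip eqxx (negbTE hi) /= sg_flip ltnn mul1r.
Qed.

(* The mode r + 1/2 of the fermion of type a: it annihilates the mode 4r+a if r >= 0, and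
   creates the mode 4k+a if r = - k - 1. *)
Definition psi (a : 'I_4) (r : int) : {linear F -> F} :=
  match r with Posz k => osc (4 * k + a) false | Negz k => osc (4 * k + a) true end.

Lemma mode_eq (a b : 'I_4) k l : (4 * k + a == 4 * l + b)%N = (a == b) && (k == l).
Proof.
have := ltn_ord a; have := ltn_ord b; rewrite -val_eqE /=; lia.
Qed.

(** The modes are r + 1/2 and s + 1/2, and these are opposite exactly when r + s + 1 = 0. *)
Lemma psiC a r b s y :
  psi a r (psi b s y) + psi b s (psi a r y) = ((a == b) && (r + s + 1 == 0))%:R *: y.
Proof.
rewrite /psi; case: r s => [r|r] [s|s]; rewrite oscC mode_eq /=; congr (_%:R *: _);
  case: (a == b) => //=; rewrite ?andbF ?andbT //; lia.
Qed.

Lemma psi_anti a r b s y : (a == b) && (r + s + 1 == 0) = false ->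
  psi a r (psi b s y) = - psi b s (psi a r y).
Proof. by move=> h; apply/eqP; rewrite -addr_eq0 psiC h scale0r. Qed.

Lemma psi_vac a r : 0 <= r -> psi a r 1 = 0.
Proof.
case: r => // r _; apply/polyP => n; rewrite coef_osc coef1 coef0.
case: (flip _ n =P 0%N) => [h|_]; last by rewrite mulr0.
have -> : bit (4 * r + a) n by rewrite -(flipK (4 * r + a) n) h bit_flip eqxx bit0.
by rewrite mul0r.
Qed.

Lemma psi_covac a r y : r < 0 -> (psi a r y)`_0 = 0.
Proof. by case: r => // r _; rewrite coef_osc bit0 mul0r. Qed.

(** The crude bound [bit_lt] is enough: a state that occupies mode [i] has an index above [i]. This
    makes the infinite sums finite on every state. *)
Lemma psi_big a (k : nat) y : (size y <= k)%N -> psi a k y = 0.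
Proof.
move=> hk; apply/polyP => n; rewrite coef_osc coef0.
case: eqP => [hb|_]; last by rewrite mul0r.
rewrite nth_default ?mulr0 //; apply: leq_trans hk _.
have : bit (4 * k + a) (flip (4 * k + a) n) by rewrite bit_flip eqxx hb.
by move/bit_lt; lia.
Qed.

Lemma fock_ind (P : F -> Prop) : subspace P -> P 1 ->
  (forall a k y, P y -> P (psi a (Negz k) y)) -> forall y, P y.
Proof.
move=> sP P1 PS y; rewrite -[y]coefK poly_def.
apply: subspace_sum => // i _; apply: subspaceZ => //.
elim/bit_ind: (i : nat) => [|j n hj Pn]; first by rewrite expr0.
rewrite -[_ ^+ _]scale1r -(sgM j n) -scalerA -osc_X //; apply: subspaceZ => //.
have := PS (inord (j %% 4)) (j %/ 4)%N _ Pn; rewrite /= inordK ?ltn_mod //.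
by rewrite mulnC -divn_eq.
Qed.

Lemma vac_mult y : (forall a (k : nat), psi a k y = 0) -> y = y`_0 *: 1.
Proof.
move=> h; apply/polyP => n; rewrite coefZ coef1; case: (eqVneq n 0%N) => [->|n0].
  by rewrite mulr1.
rewrite mulr0; have [i hi] : exists i, bit i n.
  apply: contrapT => /forallNP hn; case/eqP: n0; apply: bit_inj => i.
  by rewrite bit0; apply/negP/hn.
have := h (inord (i %% 4)) (i %/ 4)%N; rewrite /= inordK ?ltn_mod // mulnC -divn_eq.
move/polyP/(_ (flip i n)); rewrite coef_osc flipK bit_flip eqxx hi coef0 /=.
by move/eqP; rewrite mulf_eq0 => /orP[/eqP s0|/eqP //]; have := sgM i (flip i n); rewrite s0 mul0r => /eqP; rewrite eq_sym oner_eq0.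
Qed.

(* Twice the energy of the modes of type a; mode 4k+a has energy k+1/2. *)
Definition E2 (a : 'I_4) := bsum (fun i => if i %% 4 == a :> nat then (i %/ 4).*2.+1 else 0)%N.

Definition L_fun a y : F := \poly_(n < size y) ((E2 a n)%:R / 2 * y`_n).

Lemma coef_L_fun a y n : (L_fun a y)`_n = (E2 a n)%:R / 2 * y`_n.
Proof.
by rewrite coef_poly; case: ltnP => // h; rewrite nth_default ?mulr0.
Qed.

Lemma L_lin a : linear (L_fun a).
Proof.
move=> c u v; apply/polyP => n.
by rewrite coefD coefZ !coef_L_fun coefD coefZ; ring.
Qed.

Definition L a : {linear F -> F} := mklin (L_lin a).

Lemma coef_L a y n : (L a y)`_n = (E2 a n)%:R / 2 * y`_n.
Proof. exact: coef_L_fun. Qed.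

Lemma E2_flip a (b : 'I_4) k n : ~~ bit (4 * k + b) n ->
  E2 a (flip (4 * k + b) n) = (E2 a n + (if b == a then k.*2.+1 else 0))%N.
Proof.
move=> hi; rewrite /E2 bsum_flip //; congr (_ + _)%N.
have hb := ltn_ord b.
have -> : ((4 * k + b) %% 4 = b)%N by rewrite mulnC modnMDl modn_small.
by rewrite mulnC divnMDl // divn_small // addn0.
Qed.

Lemma E2_0 a : E2 a 0 = 0%N. Proof. exact: bsum0. Qed.

Lemma L_psi a b r y :
  L a (psi b r y) = psi b r (L a y) - ((a == b)%:R * (r%:~R + 1 / 2)) *: psi b r y.
Proof.
have hodd k : (k.*2.+1)%:R = 2 * k%:R + 1 :> K by rewrite -natr1 -muln2 natrM mulrC.
apply/polyP => n; rewrite coefB coefZ coef_L /psi [a == b]eq_sym.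
case: r => k; rewrite !coef_osc coef_L; case: eqP => hb; try by rewrite !mul0r; ring.
  rewrite (E2_flip a (k := k) (b := b)) ?hb // natrD; case: eqP => _.
    by rewrite hodd -pmulrn /=; field.
  by rewrite /=; field.
have {1}-> : E2 a n = (E2 a (flip (4 * k + b) n) + (if b == a then k.*2.+1 else 0))%N.
  by rewrite -E2_flip ?flipK // bit_flip eqxx hb.
rewrite natrD NegzE mulrNz -pmulrn; case: eqP => _.
  by rewrite hodd -natr1 /=; field.
by rewrite /=; field.
Qed.

End Fermions.

(* Infinite sums of operators, which are finite on every state, are handled as finite sums
   that eventually stabilize. *)
Definition ev (P : nat -> Prop) := exists N0, forall N, (N0 <= N)%N -> P N.

Lemma ev_and P Q : ev P -> ev Q -> ev (fun N => P N /\ Q N).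
Proof.
move=> [M hM] [N hN]; exists (maxn M N) => k; rewrite geq_max => /andP[? ?].
by split; [apply: hM | apply: hN].
Qed.

Lemma ev_imp P Q : (forall N, P N -> Q N) -> ev P -> ev Q.
Proof. by move=> PQ [N hN]; exists N => k /hN/PQ. Qed.

Lemma ev_ge M : ev (leq M). Proof. by exists M. Qed.

Section IntervalSums.
Variable V : zmodType.
Implicit Types f g : int -> V.

Definition isum (lo : int) (len : nat) f := \sum_(0 <= i < len) f (lo + i%:Z).

Lemma isum_cat lo p q f : isum lo (p + q) f = isum lo p f + isum (lo + p%:Z) q f.
Proof.
rewrite /isum (big_cat_nat (n := p)) ?leq_addr //=; congr (_ + _).
rewrite -{1}[p]add0n big_addn addKn; apply: eq_bigr => i _; congr (f _); lia.
Qed.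

Lemma isum0 lo len f : (forall i, (i < len)%N -> f (lo + i%:Z) = 0) -> isum lo len f = 0.
Proof. by move=> h; rewrite /isum big_nat; apply: big1 => i /andP[_]; apply: h. Qed.

Lemma isum_cover (lo lo' : int) len len' f : lo <= lo' ->
  lo' + len'%:Z <= lo + len%:Z ->
  (forall m, m < lo' -> f m = 0) -> (forall m, lo' + len'%:Z <= m -> f m = 0) ->
  isum lo len f = isum lo' len' f.
Proof.
move=> h1 h2 h3 h4; pose p := absz (lo' - lo)%R; pose q := absz (lo + len%:Z - (lo' + len'%:Z))%R.
have -> : len = (p + (len' + q))%N by rewrite /p /q; lia.
rewrite !isum_cat (isum0 (len := p)) => [|i hi]; last by apply: h3; lia.
rewrite add0r (isum0 (len := q)) => [|i hi]; last by apply: h4; lia.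
by rewrite addr0 (_ : lo + p%:Z = lo'); last by rewrite /p; lia.
Qed.

Lemma isum_split lo len f g : isum lo len (fun m => f m + g m) = isum lo len f + isum lo len g.
Proof. exact: big_split. Qed.

Lemma eq_isum lo len f g : f =1 g -> isum lo len f = isum lo len g.
Proof. by move=> fg; apply: eq_bigr. Qed.

Lemma isumN lo len f : isum lo len (fun m => - f m) = - isum lo len f.
Proof. exact: sumrN. Qed.
End IntervalSums.

Lemma isum_lin (R : pzRingType) (V W : lmodType R) (h : {linear V -> W}) lo len (f : int -> V) :
  isum lo len (fun m => h (f m)) = h (isum lo len f).
Proof. by rewrite /isum linear_sum. Qed.

Lemma isum_pick (R : pzRingType) (V : lmodType R) (lo m0 : int) len (g : int -> V) :
  lo <= m0 -> m0 < lo + len%:Z ->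
  isum lo len (fun m => (m == m0)%:R *: g m) = g m0.
Proof.
move=> h1 h2; rewrite (isum_cover (lo' := m0) (len' := 1)); try lia.
- by rewrite /isum big_nat1 addr0 eqxx scale1r.
- by move=> m hm; rewrite (_ : _ == _ = false) ?scale0r //; lia.
- by move=> m hm; rewrite (_ : _ == _ = false) ?scale0r //; lia.
Qed.

(** * Bilinear currents in the fermions *)

Section Currents.
Variable K : numFieldType.
Notation F := {poly K}.
Notation psi := (@psi K).
Notation L := (@L K).
Implicit Types (y z : F) (a b c : 'I_4) (n m r s : int).

(* B a b n is the sum over m of psi^a_(n-m-1) psi^b_m. The indices a and b differ, so that no
   normal ordering is needed; B a a n is set to 0. *)
Definition T a b n y m : F := psi a (n - m - 1) (psi b m y).

Definition B_fun a b n y : F :=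
  let M := (size y + `|n|).+1 in (a != b)%:R *: isum (- M%:Z) (M + M) (T a b n y).

Lemma psi_swap a r b s y : psi a r (psi b s y) =
  ((a == b) && (r + s + 1 == 0))%:R *: y - psi b s (psi a r y).
Proof. by rewrite -psiC addrK. Qed.

Lemma T_swap a b n y m : a != b -> T a b n y m = - psi b m (psi a (n - m - 1) y).
Proof. by move=> ab; rewrite /T psi_anti // (negbTE ab). Qed.

Lemma psi_big_int a r y : (size y)%:Z <= r -> psi a r y = 0.
Proof. by case: r => // r h; apply: psi_big; lia. Qed.

Lemma B_isum a b n y (lo : int) len : a != b -> lo <= - ((size y + `|n|).+1)%:Z ->
  ((size y + `|n|).+1)%:Z <= lo + len%:Z ->
  B_fun a b n y = isum lo len (T a b n y).
Proof.
move=> ab h1 h2; rewrite /B_fun ab scale1r; apply/esym; apply: isum_cover => //; try lia.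
- by move=> m hm; rewrite T_swap // [psi a _ y]psi_big_int ?linear0 ?oppr0 //; lia.
- by move=> m hm; rewrite /T [psi b m y]psi_big_int ?linear0 //; lia.
Qed.

Lemma B_lin a b n : linear (B_fun a b n).
Proof.
move=> c u v; have [<-|ab] := eqVneq a b; first by rewrite /B_fun eqxx !scale0r scaler0 addr0.
pose M := (maxn (size (c *: u + v)) (maxn (size u) (size v)) + `|n|).+1.
rewrite !(@B_isum _ _ _ _ (- M%:Z) (M + M)) //; try by rewrite /M; lia.
rewrite /isum scaler_sumr -big_split /=; apply: eq_bigr => i _.
by rewrite /T linearP [psi a _ (_ + _)]linearP.
Qed.

(* Opaque, so that simplification does not unfold it. *)
Fact B_key a b n : {f : {linear F -> F} | f =1 B_fun a b n}.
Proof. by exists (mklin (B_lin a b n)). Qed.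
Definition B a b n : {linear F -> F} := sval (B_key a b n).

Lemma BE a b n y : B a b n y = B_fun a b n y.
Proof. by rewrite /B; case: (B_key a b n). Qed.

Lemma Baa a n y : B a a n y = 0.
Proof. by rewrite BE /B_fun eqxx scale0r. Qed.

Lemma B_ev a b n y : a != b -> ev (fun N => B a b n y = isum (- N%:Z) (N + N) (T a b n y)).
Proof.
move=> ab; exists (size y + `|n|).+1 => N hN.
by rewrite BE (@B_isum _ _ _ _ (- N%:Z) (N + N)) //; lia.
Qed.

Lemma ev_ex P : ev P -> exists N, P N. Proof. by case=> N h; exists N; apply: h. Qed.

(** Moving [psi c r] past both factors leaves two contractions; each is a Kronecker delta in the
    summation index, at m = - r - 1 and at m = n + r, so each sum collapses to one term. *)
Lemma B_psi a b n c r y : a != b ->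
  B a b n (psi c r y) = psi c r (B a b n y)
    + (b == c)%:R *: psi a (n + r) y - (a == c)%:R *: psi b (n + r) y.
Proof.
move=> ab; have [N [[-> ->] hN]] := ev_ex (ev_and (ev_and (B_ev n (psi c r y) ab)
  (B_ev n y ab)) (ev_ge (`|n| + `|r| + 2)%N)).
rewrite (_ : psi a (n + r) y = psi a (n - (- r - 1) - 1) y); last by congr (psi a _ y); lia.
rewrite -isum_lin -(isum_pick (lo := - N%:Z) (len := N + N)
  (fun m => (b == c)%:R *: psi a (n - m - 1) y) (m0 := - r - 1)); try lia.
rewrite -(isum_pick (lo := - N%:Z) (len := N + N)
  (fun m => (a == c)%:R *: psi b m y) (m0 := n + r)); try lia.
rewrite -isumN -!isum_split; apply: eq_isum => m; rewrite /T.
rewrite [psi b m (psi c _ _)]psi_swap linearB linearZ_LR /= [psi a _ (psi c _ _)]psi_swap opprB.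
have e1 : (m + r + 1 == 0) = (m == - r - 1) by lia.
have e2 : (n - m - 1 + r + 1 == 0) = (m == n + r) by lia.
rewrite e1 e2 !scalerA -!natrM !mulnb ![(m == _) && _]andbC; ring.
Qed.

(* W 1 is annihilated by all annihilation operators, hence is a multiple of the vacuum. *)
Lemma schur (W : nat -> F -> F) (e : K) :
  e != 0 -> (forall N, linear (W N)) ->
  (forall a r y, ev (fun N => W N (psi a r y) = e *: psi a r (W N y))) ->
  (exists v, ev (fun N => W N 1 = v)) -> ev (fun N => (W N 1)`_0 = 0) ->
  forall y, ev (fun N => W N y = 0).
Proof.
move=> e0 lW hW [v hv] hc; have W0 N : W N 0 = 0 := linear0 (mklin (lW N)).
apply: fock_ind.
- split=> [|c u w hu hw]; first by exists 0%N.
  by apply: ev_imp (ev_and hu hw) => N [uN wN]; rewrite lW uN wN scaler0 addr0.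
- have v0 : v = 0.
    have c0 : v`_0 = 0 by have [N [<- ->]] := ev_ex (ev_and hv hc).
    suff h : forall a (k : nat), psi a k v = 0 by rewrite (vac_mult h) c0 scale0r.
    move=> a k; have [N [<- hN]] := ev_ex (ev_and hv (hW a k 1)).
    by move: hN; rewrite psi_vac // W0 => /esym/eqP; rewrite scaler_eq0 (negbTE e0) => /eqP.
  by apply: ev_imp hv => N ->.
- move=> a k y hy; apply: ev_imp (ev_and hy (hW a (Negz k) y)) => N [yN ->].
  by rewrite yN linear0 scaler0.
Qed.

(** The tool for operator identities on Fock space: the difference of the two sides commutes with
    every fermion mode, and its vacuum expectation is zero. *)
Lemma schur0 (W : {linear F -> F}) :
  (forall a r y, W (psi a r y) = psi a r (W y)) -> (W 1)`_0 = 0 -> forall y, W y = 0.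
Proof.
move=> hW W0 y; have [|||||N ->//] := ev_ex (@schur (fun=> W) 1 _ _ _ _ _ y).
- exact: oner_neq0.
- by move=> _; apply: linearP.
- by move=> a r z; exists 0%N => N _; rewrite hW scale1r.
- by exists (W 1); exists 0%N.
- by exists 0%N.
Qed.

Lemma B_vac a b n : 0 <= n -> B a b n 1 = 0.
Proof.
move=> hn; have [ab|ab] := eqVneq a b; first by rewrite ab Baa.
have [N ->] := ev_ex (B_ev n 1 ab); apply: isum0 => i _.
set m := _ + _; have [m0|m0] := leP 0 m; first by rewrite /T [psi b m 1]psi_vac ?linear0.
by rewrite T_swap // [psi a _ 1]psi_vac ?linear0 ?oppr0 //; lia.
Qed.

Lemma coef_isum (f : int -> F) lo len k : (isum lo len f)`_k = isum lo len (fun m => (f m)`_k).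
Proof. exact: coef_sum. Qed.

Lemma B_covac a b n y : n <= 0 -> (B a b n y)`_0 = 0.
Proof.
move=> hn; have [ab|ab] := eqVneq a b; first by rewrite ab Baa coef0.
have [N ->] := ev_ex (B_ev n y ab); rewrite coef_isum; apply: isum0 => i _.
set m := _ + _; have [m0|m0] := leP 0 m; first by rewrite /T psi_covac //; lia.
by rewrite T_swap // coefN psi_covac ?oppr0.
Qed.

Lemma B_vev a b n : (B a b n 1)`_0 = 0.
Proof.
by have [h|h] := leP 0 n; [rewrite B_vac // coef0 | rewrite B_covac // ltW].
Qed.

Lemma BC a b n y : B b a n y = - B a b n y.
Proof.
have [->|ab] := eqVneq a b; first by rewrite Baa oppr0.
have lW : linear (fun y => B b a n y + B a b n y).
  by move=> c u v; rewrite [B b a n _]linearP [B a b n _]linearP scalerDr addrACA.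
apply/eqP; rewrite -addr_eq0; apply/eqP; apply: (schur0 (W := mklin lW)).
  move=> c r z /=. rewrite !B_psi //; last by rewrite eq_sym.
  by rewrite linearD /=; ring.
by rewrite /= coefD !B_vev addr0.
Qed.

Lemma L0_lin : linear (fun y => \sum_a L a y).
Proof.
by move=> c u v; rewrite scaler_sumr -big_split; apply: eq_bigr => a _; rewrite linearP.
Qed.

Definition L0 : {linear F -> F} := mklin L0_lin.

Lemma L0E y : L0 y = \sum_a L a y. Proof. by []. Qed.

Lemma L0_psi b r y : L0 (psi b r y) = psi b r (L0 y) - (r%:~R + 1 / 2) *: psi b r y.
Proof.
rewrite !L0E linear_sum /= (eq_bigr _ (fun a _ => L_psi a b r y)) big_split /=; congr (_ + _).
rewrite (bigD1 b) //= eqxx [true%:R * _]mul1r big1 ?addr0 // => a /negbTE ->.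
by rewrite mul0r scale0r oppr0.
Qed.

Lemma L0_B a b n y : L0 (B a b n y) = B a b n (L0 y) - n%:~R *: B a b n y.
Proof.
have [ab|ab] := eqVneq a b.
  by rewrite ab !Baa scaler0 subr0 linear0.
have [N [-> ->]] := ev_ex (ev_and (B_ev n y ab) (B_ev n (L0 y) ab)).
rewrite -isum_lin /isum scaler_sumr -sumrB; apply: eq_bigr => i _.
rewrite /T !L0_psi linearB linearZ_LR /= -addrA -opprD -scalerDl; congr (_ - _ *: _).
by rewrite !intrD !mulrNz; field.
Qed.

End Currents.

Lemma isum_sym (V : zmodType) (lo d : int) len (P : int -> V) v :
  (forall m, P m + P (d - m) = v) -> lo + (lo + len%:Z - 1) = d ->
  isum lo len P *+ 2 = v *+ len.
Proof.
move=> hP hd; rewrite mulr2n /isum {2}big_nat_rev -big_split /=.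
transitivity (\sum_(0 <= i < len) v); last by rewrite sumr_const_nat subn0.
rewrite !big_nat; apply: eq_bigr => i /andP[_ hi]; rewrite -(hP (lo + i%:Z)); congr (_ + P _); lia.
Qed.

Lemma sum_isum (V : zmodType) N (f : int -> V) : \sum_(0 <= i < N) f i%:Z = isum 0 N f.
Proof. by apply: eq_bigr => i _; rewrite add0r. Qed.

Lemma sum1_isum (V : zmodType) N d (f : int -> V) :
  \sum_(1 <= i < N) f (d + i%:Z) = isum (d + 1) N.-1 f.
Proof. by rewrite big_add1; apply: eq_bigr => i _; congr (f _); lia. Qed.

Lemma isum_sum (V : zmodType) (lo : int) N (f : int -> V) :
  isum (lo - N%:Z + 1) (N + N.-1) f
  = \sum_(0 <= i < N) f (lo - i%:Z) + \sum_(1 <= i < N) f (lo + i%:Z).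
Proof.
rewrite isum_cat sum1_isum; congr (_ + isum _ _ _); last by lia.
rewrite /isum big_nat_rev !big_nat; apply: eq_bigr => i /andP[_ hi]; congr (f _); lia.
Qed.

(** * Energy of a pair of fermions *)

Section PairIdentity.
Variable K : numFieldType.
Notation F := {poly K}.
Notation psi := (@psi K).
Notation L := (@L K).
Notation B := (@B K).
Implicit Types (y z : F) (a b c : 'I_4) (n m r s : int).

(** Both sums run over the same products [P j], from j = 0 and from j = r - s + 1. They differ by a
    range that is symmetric under j -> r - s - j, where anticommutation gives half the number of
    terms; for r + s = -1 this half is r + 1, up to the sign that depends on which sum is longer. *)
Lemma same_type_sum b r s y : ev (fun N =>
  \sum_(0 <= k < N) psi b (r - k%:Z) (psi b (s + k%:Z) y) =
  \sum_(1 <= k < N) psi b (s - k%:Z) (psi b (r + k%:Z) y)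
  + ((r + s + 1 == 0)%:R * (r%:~R + 1)) *: y).
Proof.
pose P (j : int) := psi b (r - j) (psi b (s + j) y).
have Pd m : P m + P (r - s - m) = (r + s + 1 == 0)%:R *: y.
  rewrite /P (_ : s + (r - s - m) = r - m); last by lia.
  rewrite (_ : r - (r - s - m) = s + m); last by lia.
  by rewrite psiC eqxx (_ : r - m + (s + m) + 1 = r + s + 1) //; lia.
have tail lo len : (size y)%:Z <= s + lo -> isum lo len P = 0.
  by move=> h; apply: isum0 => i _; rewrite /P [psi b (s + _) y]psi_big_int ?linear0 //; lia.
exists (size y + `|r| + `|s| + 2)%N => N hN.
rewrite (sum_isum N P) (eq_bigr (fun k : nat => P ((r - s) + k%:Z))); last first.
  by move=> k _; rewrite /P; congr (psi b _ (psi b _ y)); lia.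
rewrite sum1_isum; have : exists e : nat, r - s = e%:Z \/ r - s = - (e.+1)%:Z.
  by exists (if 0 <= r - s then `|r - s|%N else `|r - s|.-1); case: ifP; lia.
have two0 : 2%:R != 0 :> K by rewrite pnatr_eq0.
move=> [e [he|he]].
  have -> : N = (e.+1 + (N - e.+1))%N by lia.
  have -> : (e.+1 + (N - e.+1)).-1 = ((N - e.+1) + e)%N by lia.
  rewrite !isum_cat [isum (_ + (N - _)%N%:Z) _ _]tail ?addr0; last by lia.
  rewrite addrC he (_ : 0 + e.+1%:Z = e%:Z + 1); last by lia.
  congr (_ + _).
  have := isum_sym (lo := 0) (len := e.+1) Pd; rewrite he => /(_ _)/[!scaler_nat] h.
  apply: (scalerI two0); rewrite [LHS]scaler_nat h; last by lia.
  case: eqP => hrs; last by rewrite mulr0n mul0r !scale0r mul0rn scaler0.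
  rewrite (_ : true%:R = 1 :> K) // mulr1n mul1r scalerA -scaler_nat; congr (_ *: _).
  have -> : e.+1%:R = (r + r + 2)%:~R :> K by rewrite pmulrn; congr (_%:~R); lia.
  by rewrite !intrD; ring.
have -> : N.-1 = (e + (N - e.+1))%N by lia.
have -> : N = ((N - e.+1) + e.+1)%N by lia.
rewrite !isum_cat [isum _ e.+1 _]tail ?addr0; last by lia.
rewrite -[LHS]add0r -addrA [_ + _ *: y]addrC addrA addnK.
rewrite (_ : r - s + 1 + e%:Z = 0); last by lia.
congr (_ + _); apply: (scalerI two0); rewrite scaler0 scalerDr [_ *: isum _ _ _]scaler_nat (isum_sym Pd); last by lia.
case: eqP => hrs; last by rewrite mul0r !scale0r mul0rn scaler0 addr0.
rewrite (_ : true%:R = 1 :> K) // scale1r mul1r scalerA -scaler_nat -scalerDl.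
have -> : e%:R = (- (r + r + 2))%:~R :> K by rewrite pmulrn; congr (_%:~R); lia.
by rewrite mulrNz !intrD [X in X *: y](_ : _ = 0) ?scale0r //; ring.
Qed.

(** After anticommutation the two half-infinite sums are complementary pieces of the sum that
    defines [B], cut at m = r. *)
Lemma mixed_type_sum a b r s y : a != b -> ev (fun N =>
  B a b (r + s + 1) y + \sum_(0 <= k < N) psi b (r - k%:Z) (psi a (s + k%:Z) y)
  - \sum_(1 <= k < N) psi a (s - k%:Z) (psi b (r + k%:Z) y) = 0).
Proof.
move=> ab; set n := r + s + 1; exists (size y + `|n| + `|r| + `|s| + 2)%N => N hN.
rewrite BE (@B_isum _ _ _ _ _ (r - N%:Z + 1) (N + N.-1)) //; try lia.
have e1 : \sum_(1 <= i < N) T a b n y (r + i%:Z) =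
          \sum_(1 <= k < N) psi a (s - k%:Z) (psi b (r + k%:Z) y).
  by apply: eq_bigr => i _; rewrite /T; congr (psi a _ _); lia.
rewrite isum_sum e1 addrAC addrK; apply/eqP; rewrite addr_eq0 -sumrN; apply/eqP.
apply: eq_bigr => i _; rewrite T_swap //; congr (- psi b _ (psi a _ _)); lia.
Qed.

Section Pair.
Variables (a b : 'I_4).
Hypothesis ab : a != b.

Lemma B_psi_a n r y : B a b n (psi a r y) = psi a r (B a b n y) - psi b (n + r) y.
Proof. by rewrite B_psi // eqxx eq_sym (negbTE ab) scale0r addr0 scale1r. Qed.

Lemma B_psi_b n r y : B a b n (psi b r y) = psi b r (B a b n y) + psi a (n + r) y.
Proof. by rewrite B_psi // eqxx (negbTE ab) scale0r subr0 scale1r. Qed.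

Lemma B_psi_o c n r y : a != c -> b != c -> B a b n (psi c r y) = psi c r (B a b n y).
Proof. by move=> /negbTE ac /negbTE bc; rewrite B_psi // ac bc !scale0r addr0 subr0. Qed.

Lemma psi_antic (c d : 'I_4) r s y : c != d -> psi c r (psi d s y) = - psi d s (psi c r y).
Proof. by move=> /negbTE cd; rewrite psi_anti // cd. Qed.

(* Up to a multiple of psi a r, the commutator of psi a r with the energy Cas: see [Cas_psi]. *)
Definition Zop r N y := psi b r (B a b 0 y)
  + \sum_(1 <= k < N) (B a b (- k%:Z) (psi b (r + k%:Z) y) + psi b (r - k%:Z) (B a b k y))
  + (r%:~R + 1) *: psi a r y.

Lemma Zop_lin r N : linear (Zop r N).
Proof.
apply: lin_add; last by apply: lin_scale; apply: linearP.
apply: lin_add; first by apply: lin_comp; apply: linearP.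
by apply: lin_sum => k; apply: lin_add; apply: lin_comp; apply: linearP.
Qed.

Lemma ZopD r N c s y : Zop r N (psi c s y) + psi c s (Zop r N y) =
  (psi b r (B a b 0 (psi c s y)) + psi c s (psi b r (B a b 0 y)))
  + \sum_(1 <= k < N) (
       (B a b (- k%:Z) (psi b (r + k%:Z) (psi c s y)) + psi c s (B a b (- k%:Z) (psi b (r + k%:Z) y)))
     + (psi b (r - k%:Z) (B a b k (psi c s y)) + psi c s (psi b (r - k%:Z) (B a b k y))))
  + (r%:~R + 1) *: (psi a r (psi c s y) + psi c s (psi a r y)).
Proof.
rewrite [X in _ = _ + X + _](_ : _ =
    \sum_(1 <= k < N) (B a b (- k%:Z) (psi b (r + k%:Z) (psi c s y))
      + psi b (r - k%:Z) (B a b k (psi c s y)))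
    + psi c s (\sum_(1 <= k < N) (B a b (- k%:Z) (psi b (r + k%:Z) y)
      + psi b (r - k%:Z) (B a b k y)))).
  by rewrite /Zop !linearD /= linearZ_LR /=; ring.
by rewrite linear_sum -big_split /=; apply: eq_bigr => k _; rewrite linearD addrACA.
Qed.

Lemma Zop_a r N s y : (0 < N)%N -> Zop r N (psi a s y) + psi a s (Zop r N y) =
  - (\sum_(0 <= k < N) psi b (r - k%:Z) (psi b (s + k%:Z) y))
  + (\sum_(1 <= k < N) psi b (s - k%:Z) (psi b (r + k%:Z) y)
  + ((r + s + 1 == 0)%:R * (r%:~R + 1)) *: y).
Proof.
move=> N0; have ba : b != a by rewrite eq_sym.
rewrite ZopD psiC eqxx andTb scalerA [_ * _%:R]mulrC addrA; congr (_ + _).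
rewrite [X in X + _](_ : _ = - psi b r (psi b s y)); last first.
  by rewrite B_psi_a linearB /= [psi b r (psi a s _)]psi_antic // add0r addrAC addNr add0r.
rewrite [\sum_(0 <= _ < N) _]big_ltn // addr0 subr0 opprD -addrA; congr (_ + _).
rewrite -sumrN -big_split /=; apply: eq_bigr => k _.
rewrite addrC; congr (_ + _).
  rewrite [psi b _ (psi a s _)]psi_antic // linearN B_psi_a opprB subrK.
  by rewrite [- k%:Z + s]addrC.
rewrite B_psi_a linearB /= [psi b _ (psi a s _)]psi_antic //.
by rewrite [k%:Z + s]addrC addrAC addNr add0r.
Qed.

Lemma Zop_o c r N s y : a != c -> b != c ->
  Zop r N (psi c s y) + psi c s (Zop r N y) = 0.
Proof.
move=> ac bc; rewrite ZopD psiC (negbTE ac) andFb scale0r scaler0 addr0.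
rewrite B_psi_o // psi_antic // addNr add0r big1 // => k _.
rewrite [psi b (r + _) (psi c s _)]psi_antic // linearN ![B a b _ (psi c _ _)]B_psi_o // addNr add0r.
by rewrite psi_antic // addNr.
Qed.

Lemma Zop_b r N s y : (`|r| + `|s| + 2 <= N)%N ->
  Zop r N (psi b s y) + psi b s (Zop r N y) =
  B a b (r + s + 1) y + \sum_(0 <= k < N) psi b (r - k%:Z) (psi a (s + k%:Z) y)
  - \sum_(1 <= k < N) psi a (s - k%:Z) (psi b (r + k%:Z) y).
Proof.
move=> hN; rewrite ZopD psiC (negbTE ab) andFb scale0r scaler0 addr0.
pose d (n : int) : F := (r + s + 1 == n)%:R *: B a b n y.
have e k : psi b (r - k) (B a b k (psi b s y)) + psi b s (psi b (r - k) (B a b k y))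
    = d k + psi b (r - k) (psi a (s + k) y).
  rewrite B_psi_b linearD /= addrAC psiC eqxx andTb [k + s]addrC; congr (_%:R *: _ + _).
  by congr nat_of_bool; lia.
have e' k : B a b (- k) (psi b (r + k) (psi b s y)) + psi b s (B a b (- k) (psi b (r + k) y))
    = d (- k) - psi a (s - k) (psi b (r + k) y).
  rewrite [psi b _ (psi b s y)]psi_swap eqxx andTb linearB linearZ_LR /= [B a b _ (psi b s _)]B_psi_b.
  rewrite opprD addrA addrAC subrK [- k + s]addrC; congr (_%:R *: _ - _).
  by congr nat_of_bool; lia.
have := e 0; rewrite subr0 addr0 => ->.
rewrite [X in _ + X](eq_bigr (fun k : nat => (d (- k%:Z) - psi a (s - k%:Z) (psi b (r + k%:Z) y))
  + (d k%:Z + psi b (r - k%:Z) (psi a (s + k%:Z) y)))); last by move=> k _; rewrite e e'.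
rewrite !big_split /= sumrN [\sum_(0 <= _ < N) _]big_ltn; last by lia.
rewrite addr0 subr0.
suff -> : B a b (r + s + 1) y = d 0 + \sum_(1 <= k < N) d (- k%:Z) + \sum_(1 <= k < N) d k%:Z by ring.
transitivity (isum (- N%:Z + 1) (N + N.-1) d).
  by rewrite (eq_isum _ _ (g := fun m => (m == r + s + 1)%:R *: B a b m y)) ?isum_pick //; try lia; move=> m; rewrite /d eq_sym.
rewrite -[- N%:Z]add0r isum_sum [\sum_(0 <= _ < N) _]big_ltn; last by lia.
rewrite subr0; congr (_ + _ + _).
by apply: eq_bigr => k _; rewrite add0r.
Qed.

(** [Zop] is an odd operator, hence [schur] with e = -1. Its anticommutators with the modes of type
    [a], of type [b] and of the other types vanish for large [N] by [same_type_sum], by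
    [mixed_type_sum] and termwise. *)
Lemma Zop0 r y : ev (fun N => Zop r N y = 0).
Proof.
move: y; apply: (schur (e := -1)).
- by rewrite oppr_eq0 oner_eq0.
- exact: Zop_lin.
- move=> c s y; suff: ev (fun N => Zop r N (psi c s y) + psi c s (Zop r N y) = 0).
    by apply: ev_imp => N /eqP; rewrite scaleN1r addr_eq0 => /eqP.
  have [<-|ac] := eqVneq a c; last have [<-|bc] := eqVneq b c.
  + apply: ev_imp (ev_and (ev_ge 1) (same_type_sum b r s y)) => N [N1 hN].
    by rewrite Zop_a // -hN addNr.
  + apply: ev_imp (ev_and (ev_ge (`|r| + `|s| + 2)) (mixed_type_sum r s y ab)) => N [N1 hN].
    by rewrite Zop_b.
  by exists 0%N => N _; apply: Zop_o.
- exists (Zop r (`|r|.+1)%N 1), `|r|.+1 => N hN; rewrite /Zop; congr (_ + _ + _).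
  rewrite (big_cat_nat (n := `|r|.+1)) //= -[RHS]addr0; congr (_ + _).
  rewrite big_nat big1 // => k /andP[hk _].
  by rewrite B_vac // [psi b _ 1]psi_vac ?linear0 ?addr0 //; lia.
exists 0%N => N _; rewrite /Zop B_vac // linear0 add0r coefD coefZ coef_sum.
rewrite [X in X + _]big1_seq ?add0r => [|k _].
  by have [h|h] := leP 0 r; [rewrite psi_vac // coef0 mulr0 | rewrite psi_covac // mulr0].
by rewrite [B a b k 1]B_vac // linear0 addr0 B_covac //; lia.
Qed.

End Pair.

(** Half the normally ordered square of the current, cut off at [N]. [B a b] is 'i times a
    Heisenberg current of norm 1, whence the minus sign in [pair_energy]. *)
Definition Cas a b N y := (1 / 2) *: B a b 0 (B a b 0 y)
  + \sum_(1 <= k < N) B a b (- k%:Z) (B a b k y).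

Lemma Cas_lin a b N : linear (Cas a b N).
Proof.
apply: lin_add; first by apply: lin_scale; apply: lin_comp; apply: linearP.
by apply: lin_sum => k; apply: lin_comp; apply: linearP.
Qed.

Lemma CasC a b N y : Cas a b N y = Cas b a N y.
Proof.
rewrite /Cas (BC a b) (BC a b) [B a b 0 (- _)]linearN opprK; congr (_ + _).
by apply: eq_bigr => k _; rewrite (BC a b) (BC a b) [B a b _ (- _)]linearN opprK.
Qed.

Lemma Cas_psi a b r N y : a != b -> (0 < N)%N ->
  Cas a b N (psi a r y) = psi a r (Cas a b N y) + (r%:~R + 1 / 2) *: psi a r y - Zop a b r N y.
Proof.
move=> ab N0; rewrite /Cas /Zop linearD linearZ_LR linear_sum /=.
rewrite (B_psi_a ab) linearB /= (B_psi_a ab) (B_psi_b ab) !add0r.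
rewrite (eq_bigr (fun k : nat => psi a r (B a b (- k%:Z) (B a b k y)) -
  (B a b (- k%:Z) (psi b (r + k%:Z) y) + psi b (r - k%:Z) (B a b k y)))); last first.
  move=> k _; rewrite (B_psi_a ab) linearB /= (B_psi_a ab) [k%:Z + r]addrC [- k%:Z + r]addrC.
  ring.
rewrite big_split /= sumrN.
set S1 := \sum_(_ <= _ < _) _; set S2 := \sum_(_ <= _ < _) _.
set u := psi a r (B a b 0 _); set v := psi b r _; set w := psi a r y.
rewrite !scalerBr !scalerDr !scalerDl scale1r.
have h (z : F) : z = (1 / 2) *: z + (1 / 2) *: z.
  by rewrite -scalerDl (_ : 1 / 2 + 1 / 2 = 1 :> K) ?scale1r //; field.
clearbody u v w S1 S2; have hv := h v; have hw := h w; rewrite -/(1 / 2).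
move: ((1 / 2) *: v) ((1 / 2) *: w) hv hw => v' w' -> ->; ring.
Qed.

(* The Sugawara energy of the current B a b is the energy of the two fermions it is made of. *)
Lemma pair_energy a b y : a != b -> ev (fun N => Cas a b N y = - (L a y + L b y)).
Proof.
move=> ab; pose S N y := Cas a b N y + (L a y + L b y).
suff: forall y, ev (fun N => S N y = 0).
  by move/(_ y); apply: ev_imp => N /eqP; rewrite addr_eq0 => /eqP.
have Lp c d r z : L c (psi d r z) =
    psi d r (L c z) - (c == d)%:R *: ((r%:~R + 1 / 2) *: psi d r z).
  by rewrite L_psi scalerA.
apply: (schur (e := 1)); first exact: oner_neq0.
- move=> N; apply: lin_add; first exact: Cas_lin.
  by apply: lin_add; apply: linearP.
- move=> c r z; have [->|ac] := eqVneq c a; last have [->|bc] := eqVneq c b.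
  + apply: ev_imp (ev_and (ev_ge 1) (Zop0 ab r z)) => N [N0 hZ].
    rewrite /S Cas_psi // hZ !Lp eqxx [b == a]eq_sym (negbTE ab) !scale1r scale0r !linearD /=; ring.
  + have ba : b != a by rewrite eq_sym.
    apply: ev_imp (ev_and (ev_ge 1) (Zop0 ba r z)) => N [N0 hZ].
    rewrite /S !(CasC a b) Cas_psi // hZ !Lp eqxx (negbTE ab) !scale1r scale0r !linearD /=; ring.
  exists 0%N => N _; rewrite scale1r /S !Lp ![_ == c]eq_sym (negbTE ac) (negbTE bc) !scale0r.
  have ac' : a != c by rewrite eq_sym.
  have bc' : b != c by rewrite eq_sym.
  rewrite /Cas !linearD linear_sum !subr0 /= linearZ_LR /=; congr (_ + _ + _).
    by rewrite !(B_psi_o ab).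
  by apply: eq_bigr => k _; rewrite !(B_psi_o ab).
- exists 0, 0%N => N _.
  have L1 c : L c 1 = 0 by apply/polyP => n; rewrite coef_L coef1 coef0; case: n => [|n]; rewrite ?E2_0 ?mul0r ?mulr0.
  by rewrite /S /Cas !L1 B_vac // linear0 scaler0 !addr0 add0r big1 // => k _; rewrite B_vac // linear0.
exists 0%N => N _; rewrite /S /Cas !coefD coefZ coef_sum !coef_L !E2_0 !mul0r !addr0.
rewrite B_covac // mulr0 add0r big1 // => k _; rewrite B_covac //; lia.
Qed.

End PairIdentity.

(** * Two copies of affine sl2 on Fock space *)

Section MatrixCurrents.
Variable K : numFieldType.
Notation F := {poly K}.
Notation psi := (@psi K).
Notation B := (@B K).
Notation L0 := (@L0 K).
Implicit Types (y z : F) (a b c d : 'I_4) (n m r s : int) (X Y : 'M[K]_4) (u : 'I_4 -> K).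

Definition psv u r y : F := \sum_a u a *: psi a r y.

Lemma psv_lin u r : linear (psv u r).
Proof. by apply: lin_sum => a; apply: lin_scale; apply: linearP. Qed.

(** For antisymmetric [X] the pairs (a, b) and (b, a) contribute equally, hence the factor 1/2. *)
Definition Cur_fun X n y : F := \sum_a \sum_b (X a b / 2) *: B a b n y.

Lemma Cur_lin X n : linear (Cur_fun X n).
Proof. by apply: lin_sum => a; apply: lin_sum => b; apply: lin_scale; apply: linearP. Qed.

Fact Cur_key X n : {f : {linear F -> F} | f =1 Cur_fun X n}.
Proof. by exists (mklin (Cur_lin X n)). Qed.
Definition Cur X n : {linear F -> F} := sval (Cur_key X n).

Lemma CurE X n y : Cur X n y = \sum_a \sum_b (X a b / 2) *: B a b n y.
Proof. by rewrite /Cur; case: (Cur_key X n). Qed.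

Lemma Cur_linX (k : K) X Y n y : Cur (k *: X + Y) n y = k *: Cur X n y + Cur Y n y.
Proof.
rewrite !CurE scaler_sumr -big_split; apply: eq_bigr => a _ /=.
rewrite scaler_sumr -big_split; apply: eq_bigr => b _ /=.
by rewrite !mxE mulrDl scalerDl scalerA mulrA.
Qed.

Lemma Cur0 n y : Cur 0 n y = 0.
Proof. by rewrite CurE big1 // => a _; rewrite big1 // => b _; rewrite mxE mul0r scale0r. Qed.

Lemma CurZ (k : K) X n y : Cur (k *: X) n y = k *: Cur X n y.
Proof. by rewrite -[k *: X]addr0 Cur_linX Cur0 addr0. Qed.

Lemma CurD X Y n y : Cur (X + Y) n y = Cur X n y + Cur Y n y.
Proof. by rewrite -[X]scale1r Cur_linX !scale1r. Qed.

Definition antisym X := forall a b, X a b = - X b a.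

Lemma Cur_psi X n c r y : antisym X ->
  Cur X n (psi c r y) = psi c r (Cur X n y) + psv (X^~ c) (n + r) y.
Proof.
move=> aX; rewrite !CurE linear_sum.
under eq_bigr => a _ do (under eq_bigr => b _ do
  (rewrite (_ : B a b n (psi c r y) = psi c r (B a b n y)
    + (b == c)%:R *: psi a (n + r) y - (a == c)%:R *: psi b (n + r) y);
  last by [have [->|/B_psi->//] := eqVneq a b; rewrite !Baa linear0 add0r subrr])).
rewrite /= -big_split /=.
have step a : \sum_b (X a b / 2) *: (psi c r (B a b n y) + (b == c)%:R *: psi a (n + r) y -
    (a == c)%:R *: psi b (n + r) y) =
  psi c r (\sum_b (X a b / 2) *: B a b n y) + (X a c / 2) *: psi a (n + r) y
   - (a == c)%:R *: \sum_b (X c b / 2) *: psi b (n + r) y.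
  rewrite (eq_bigr (fun b => (X a b / 2) *: psi c r (B a b n y) + (X a b / 2 * (b == c)%:R) *: psi a (n + r) y
     - (X a b / 2 * (a == c)%:R) *: psi b (n + r) y)); last first.
    by move=> b _; rewrite scalerBr scalerDr !scalerA.
  rewrite sumrB big_split /= [psi c r (\sum_(_ < _) _)]linear_sum /=; congr (_ + _ - _).
  - by apply: eq_bigr => b _; rewrite linearZ.
  - rewrite (bigD1 c) //= eqxx mulr1 big1 ?addr0 // => b /negbTE ->.
    by rewrite mulr0 scale0r.
  rewrite scaler_sumr; apply: eq_bigr => b _; rewrite scalerA.
  by case: eqP => [->|]; rewrite ?mul0r ?mulr0 // mul1r mulr1.
rewrite (eq_bigr _ (fun a _ => step a)) sumrB big_split /= -addrA [RHS]big_split /=.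
congr (_ + _).
rewrite [X in _ - X](bigD1 c) //= eqxx scale1r [X in _ - (_ + X)]big1 ?addr0 => [|a /negbTE ->]; last by rewrite scale0r.
rewrite /psv -sumrB; apply: eq_bigr => a _; rewrite -scalerBl; congr (_ *: _).
by rewrite (aX c a); field.
Qed.

Lemma psv_mul u X n r y :
  \sum_c u c *: psv (X^~ c) n y = psv (fun a => \sum_c X a c * u c) n y.
Proof.
rewrite /psv; under eq_bigr do rewrite scaler_sumr.
rewrite exchange_big; apply: eq_bigr => a _; rewrite scaler_suml.
by apply: eq_bigr => c _; rewrite scalerA mulrC.
Qed.

Lemma Cur_psv X n u r y : antisym X -> Cur X n (psv u r y) =
  psv u r (Cur X n y) + psv (fun a => \sum_c X a c * u c) (n + r) y.
Proof.
move=> aX; rewrite -psv_mul // {1}/psv linear_sum -big_split; apply: eq_bigr => c _ /=.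
by rewrite linearZ_LR /= Cur_psi // scalerDr.
Qed.

Lemma Cur_vac X n : 0 <= n -> Cur X n 1 = 0.
Proof.
by move=> hn; rewrite CurE big1 // => a _; rewrite big1 // => b _; rewrite B_vac ?scaler0.
Qed.

Lemma Cur_covac X n y : n <= 0 -> (Cur X n y)`_0 = 0.
Proof.
move=> hn; rewrite CurE coef_sum big1 // => a _; rewrite coef_sum big1 // => b _.
by rewrite coefZ B_covac ?mulr0.
Qed.

Lemma Cur_vev X n : (Cur X n 1)`_0 = 0.
Proof. by have [h|h] := leP 0 n; [rewrite Cur_vac // coef0 | rewrite Cur_covac // ltW]. Qed.

Lemma L0_Cur X n y : L0 (Cur X n y) = Cur X n (L0 y) - n%:~R *: Cur X n y.
Proof.
rewrite !CurE scaler_sumr -sumrB [L0 _]linear_sum; apply: eq_bigr => a _.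
rewrite scaler_sumr -sumrB [L0 _]linear_sum; apply: eq_bigr => b _.
by rewrite [L0 _]linearZ_LR L0_B scalerBr !scalerA [n%:~R * _]mulrC.
Qed.

Lemma antisym_comm X Y : antisym X -> antisym Y -> antisym (X *m Y - Y *m X).
Proof.
move=> aX aY a b; rewrite !mxE opprB; congr (_ - _); apply: eq_bigr => c _.
  by rewrite (aX a c) (aY c b) mulrNN mulrC.
by rewrite (aY a c) (aX c b) mulrNN mulrC.
Qed.

Lemma psi_vev2 a r b s :
  (psi a r (psi b s 1))`_0 = ((a == b) && (r + s + 1 == 0) && (0 <= r))%:R.
Proof.
have [r0|r0] := leP 0 r; last by rewrite psi_covac // andbF.
by rewrite psi_swap psi_vac // linear0 subr0 coefZ coef1 mulr1 andbT.
Qed.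

Lemma psv_vev2 c s u r : (psi c s (psv u r 1))`_0 = u c * ((s + r + 1 == 0) && (0 <= s))%:R.
Proof.
rewrite /psv linear_sum coef_sum (bigD1 c) //= linearZ_LR coefZ psi_vev2 eqxx /=.
rewrite big1 ?addr0 // => a; rewrite eq_sym => /negbTE ac.
by rewrite linearZ_LR coefZ psi_vev2 ac mulr0.
Qed.

Lemma psv_vev2' u r d s : (psv u r (psi d s 1))`_0 = u d * ((r + s + 1 == 0) && (0 <= r))%:R.
Proof.
rewrite /psv coef_sum (bigD1 d) //= coefZ psi_vev2 eqxx /=.
by rewrite big1 ?addr0 // => a /negbTE ad; rewrite coefZ psi_vev2 ad mulr0.
Qed.

Lemma psv0 u r : psv u r 0 = 0. Proof. exact: linear0 (mklin (psv_lin u r)). Qed.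

Lemma Cur_vev_psi2 X m c s d r : antisym X -> 0 <= m ->
  (Cur X m (psi c s (psi d r 1)))`_0 =
  X d c * ((m + (s + r + 1) == 0)%:R * ((r <= -1)%R%:R - (r + m <= -1)%R%:R)).
Proof.
move=> aX m0; rewrite Cur_psi // Cur_psi // Cur_vac // linear0 add0r coefD psv_vev2 psv_vev2'.
rewrite (aX c d) mulNr addrC -mulrBr.
have -> : s + (m + r) + 1 = m + (s + r + 1) by lia.
have -> : m + s + r + 1 = m + (s + r + 1) by lia.
case: eqP => h /=; last by rewrite subr0 mul0r.
rewrite mul1r; congr (_ * (_%:R - _%:R)); lia.
Qed.

(** The number of modes that cross the vacuum level under a shift by [m]: the origin of the central
    term. *)
Lemma count_neg m : 0 <= m -> forall N, (`|m| < N)%N ->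
  isum (- N%:Z) (N + N) (fun r => (r <= -1)%R%:R - (r + m <= -1)%R%:R : K) = m%:~R.
Proof.
case: m => // m _ N hN; rewrite (isum_cover (lo' := - m%:Z) (len' := m)); try lia.
- rewrite /isum (eq_big_nat _ _ (F2 := fun=> 1)) => [|i /andP[_ hi]].
    by rewrite sumr_const_nat subn0 -pmulrn.
  rewrite (_ : (_ <= _) = true); last by lia.
  by rewrite (_ : (_ <= _) = false) ?subr0 //; lia.
- move=> r hr; rewrite (_ : (r <= -1) = true); last by lia.
  by rewrite (_ : (_ <= _) = true) ?subrr //; lia.
- move=> r hr; rewrite (_ : (r <= -1) = false); last by lia.
  by rewrite (_ : (_ <= _) = false) ?subrr //; lia.
Qed.

Lemma Cur_vev2 X m Y n : antisym X -> antisym Y -> 0 <= m ->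
  (Cur X m (Cur Y n 1))`_0 = m%:~R * (m + n == 0)%:R * (\tr (X *m Y) / 2).
Proof.
move=> aX aY m0.
have h c d : (Cur X m ((Y c d / 2) *: B c d n 1))`_0 =
    m%:~R * (m + n == 0)%:R * (X d c * Y c d / 2).
  rewrite linearZ_LR coefZ /=; have [->|cd] := eqVneq c d.
    have -> : Y d d = 0 by have /eqP := aY d d; rewrite -addr_eq0 -mulr2n mulrn_eq0 => /eqP.
    by rewrite !mulr0 !mul0r mulr0.
  have [N [-> hN]] := ev_ex (ev_and (@B_ev K c d n 1 cd) (ev_ge (`|m|.+1)%N)).
  rewrite -isum_lin coef_isum.
  rewrite (eq_isum _ _ (g := fun r => (X d c * (m + n == 0)%:R) *
      ((r <= -1)%R%:R - (r + m <= -1)%R%:R))).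
    rewrite /isum -mulr_sumr; have := count_neg m0 hN; rewrite /isum => ->.
    by ring.
  move=> r; rewrite /T Cur_vev_psi2 // (_ : n - r - 1 + r + 1 = n); last by lia.
  by rewrite mulrA.
rewrite [Cur Y n 1]CurE [Cur X m _]linear_sum coef_sum /mxtrace mulr_suml mulr_sumr.
have -> : \sum_i m%:~R * (m + n == 0)%:R * ((X *m Y) i i / 2) =
  \sum_i \sum_j m%:~R * (m + n == 0)%:R * (X i j * Y j i / 2).
  by apply: eq_bigr => i _; rewrite mxE mulr_suml mulr_sumr.
rewrite exchange_big; apply: eq_bigr => c _; rewrite [Cur X m _]linear_sum coef_sum.
by apply: eq_bigr => d _; apply: h.
Qed.

Lemma Cur_psi2 X Y m n c r z : antisym X -> antisym Y ->
  Cur X m (Cur Y n (psi c r z)) = psi c r (Cur X m (Cur Y n z))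
    + psv (X^~ c) (m + r) (Cur Y n z) + psv (Y^~ c) (n + r) (Cur X m z)
    + psv (fun a => \sum_d X a d * Y d c) (m + (n + r)) z.
Proof.
by move=> aX aY; rewrite Cur_psi // linearD Cur_psi // Cur_psv // !addrA.
Qed.

(** By [schur0]: the commutator with a fermion mode sees only the matrix commutator, and since a
    single current has no vacuum expectation, the central term is the vacuum expectation of the
    commutator. *)
Lemma Cur_br X Y m n y : antisym X -> antisym Y ->
  Cur X m (Cur Y n y) = Cur Y n (Cur X m y) + Cur (X *m Y - Y *m X) (m + n) y
    + (m%:~R * (m + n == 0)%:R * (\tr (X *m Y) / 2)) *: y.
Proof.
move=> aX aY; set Z := X *m Y - _; set k := _ * (_ / _).
have aZ : antisym Z by apply: antisym_comm.
have lW : linear (fun y => Cur X m (Cur Y n y)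
    + (- 1) *: (Cur Y n (Cur X m y) + Cur Z (m + n) y + k *: y)).
  apply: lin_add; first by apply: lin_comp; apply: linearP.
  apply: lin_scale; apply: lin_add; last by apply: lin_scale => ? ? ?.
  by apply: lin_add; [apply: lin_comp; apply: linearP | apply: linearP].
apply/eqP; rewrite -subr_eq0 -scaleN1r; apply/eqP.
apply: (schur0 (W := mklin lW)) => [c r z|] /=.
  rewrite (Cur_psi2 _ _ _ _ _ aX aY) (Cur_psi2 _ _ _ _ _ aY aX) Cur_psi // !scaleN1r.
  rewrite (_ : psv (Z^~ c) (m + n + r) z =
    psv (fun a => \sum_d X a d * Y d c) (m + (n + r)) z
    - psv (fun a => \sum_d Y a d * X d c) (n + (m + r)) z); last first.
    rewrite addrA [n + (m + r)]addrCA addrA /psv -sumrB; apply: eq_bigr => a _.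
    by rewrite !mxE scalerBl.
  rewrite [psi c r (_ - _)]linearB [psi c r (_ + k *: z)]linearD [psi c r (_ + Cur Z _ _)]linearD.
  rewrite [psi c r (k *: z)]linearZ_LR /=.
  move: (psi c r (Cur X m _)) (psi c r (Cur Y n _)) (psi c r (Cur Z _ _)) (k *: _).
  move: (psv _ _ _) (psv _ _ _) (psv _ _ _) (psv _ _ _) => p1 p2 p3 p4 q1 q2 q3 q4; ring.
rewrite scaleN1r coefB !coefD coefZ coef1 Cur_vev mulr1 addr0; apply/eqP; rewrite subr_eq0; apply/eqP.
have [m0|m0] := leP 0 m; first by rewrite Cur_vev2 // [Cur X m 1]Cur_vac // linear0 coef0 add0r.
rewrite Cur_covac ?ltW //; have [n0|n0] := leP 0 n.
  rewrite Cur_vev2 // /k mxtrace_mulC [n + m]addrC; case: eqP => h; last by rewrite !mulr0 !mul0r addr0.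
  have -> : m = - n by lia.
  by rewrite mulrNz; ring.
rewrite Cur_covac ?ltW // add0r /k (_ : _ == _ = false) ?mulr0 ?mul0r //; lia.
Qed.

End MatrixCurrents.

(** * Quaternion matrices and the two commuting copies of sl2 *)

Section Sl2Currents.
Variable K : numClosedFieldType.
Notation F := {poly K}.
Notation psi := (@psi K).
Notation B := (@B K).
Notation L := (@L K).
Notation L0 := (@L0 K).
Implicit Types (y z : F) (a b c d : 'I_4) (n m r : int) (s : bool) (t : sl2b).

Notation q0 := (@Ordinal 4 0 isT).
Notation q1 := (@Ordinal 4 1 isT).
Notation q2 := (@Ordinal 4 2 isT).
Notation q3 := (@Ordinal 4 3 isT).

Lemma sum4 (V : nmodType) (f : 'I_4 -> V) : \sum_a f a = f q0 + f q1 + f q2 + f q3.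
Proof.
rewrite !big_ord_recl big_ord0 addr0 !addrA.
by congr (_ + _ + _ + _); congr f; apply: val_inj.
Qed.

Lemma I4P (P : 'I_4 -> Prop) : P q0 -> P q1 -> P q2 -> P q3 -> forall a, P a.
Proof.
move=> h0 h1 h2 h3 [[|[|[|[|//]]]] ha].
- by rewrite (_ : Ordinal ha = q0) //; apply: val_inj.
- by rewrite (_ : Ordinal ha = q1) //; apply: val_inj.
- by rewrite (_ : Ordinal ha = q2) //; apply: val_inj.
- by rewrite (_ : Ordinal ha = q3) //; apply: val_inj.
Qed.

(** Integer lists turn the quaternion relations into computations. *)
Definition mxz (l : seq (seq int)) : 'M[K]_4 :=
  \matrix_(i, j) (nth 0 (nth [::] l i) j)%:~R.

Definition lmul (l l' : seq (seq int)) : seq (seq int) :=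
  mkseq (fun i => mkseq (fun j => foldr (fun k acc =>
    acc + nth 0 (nth [::] l i) k * nth 0 (nth [::] l' k) j) 0 [:: 3; 2; 1; 0]%N) 4) 4.

Lemma mxzM l l' : mxz l *m mxz l' = mxz (lmul l l').
Proof.
apply/matrixP => i j; rewrite !mxE sum4 !mxE /lmul !nth_mkseq //= add0r.
by rewrite !intrD !intrM.
Qed.

Definition lopp (l : seq (seq int)) : seq (seq int) := map (map -%R) l.

Lemma mxzN l : mxz (lopp l) = - mxz l.
Proof.
apply/matrixP => i j; rewrite !mxE -mulrNz; congr (_%:~R).
have nthN (u : seq int) k : nth 0 (map -%R u) k = - nth 0 u k.
  by elim: u k => [|x u IH] [|k] //=; rewrite ?nth_nil ?oppr0.
rewrite -nthN; congr nth; rewrite /lopp.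
by elim: l (i : nat) => [|x l IH] [|k] //=; rewrite ?nth_nil.
Qed.

(* Left ([s = true]) and minus right multiplication by i, j, k on the quaternions with
   basis 1, i, j, k. *)
Definition qz (k : nat) s : seq (seq int) :=
  let e : int := if s then 1 else -1 in
  nth [::] [:: [:: [:: 0; -e; 0; 0]; [:: e; 0; 0; 0]; [:: 0; 0; 0; -1]; [:: 0; 0; 1; 0]];
    [:: [:: 0; 0; -e; 0]; [:: 0; 0; 0; 1]; [:: e; 0; 0; 0]; [:: 0; -1; 0; 0]];
    [:: [:: 0; 0; 0; -e]; [:: 0; 0; -1; 0]; [:: 0; 1; 0; 0]; [:: e; 0; 0; 0]]] k.

Definition q k s : 'M[K]_4 := mxz (qz k s).

(* sl2 acts through h = - 'i i, e = (j - 'i k) / 2, f = - (j + 'i k) / 2. *)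
Definition qcoef t : K * K * K := match t with
  | Hb => (- 'i, 0, 0)
  | Eb => (0, 2^-1, - 'i / 2)
  | Fb => (0, - 2^-1, - 'i / 2)
  end.

(* Opaque, to keep unification from unfolding matrices. *)
Fact sig_key : {f : bool -> sl2b -> 'M[K]_4 | forall s t,
  f s t = (qcoef t).1.1 *: q 0 s + (qcoef t).1.2 *: q 1 s + (qcoef t).2 *: q 2 s}.
Proof.
by exists (fun s t => (qcoef t).1.1 *: q 0 s + (qcoef t).1.2 *: q 1 s + (qcoef t).2 *: q 2 s).
Qed.
Definition sig : bool -> sl2b -> 'M[K]_4 := sval sig_key.

Lemma sigE s t :
  sig s t = (qcoef t).1.1 *: q 0 s + (qcoef t).1.2 *: q 1 s + (qcoef t).2 *: q 2 s.
Proof. exact: (svalP sig_key). Qed.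

Lemma ii : 'i * 'i = -1 :> K. Proof. by rewrite -expr2 sqrCi. Qed.

Lemma mxz1 : mxz [:: [:: 1; 0; 0; 0]; [:: 0; 1; 0; 0]; [:: 0; 0; 1; 0]; [:: 0; 0; 0; 1]] = 1%:M.
Proof. by apply/matrixP; do 2! apply: I4P; rewrite !mxE. Qed.

Lemma q_sq s : [/\ q 0 s *m q 0 s = - 1%:M, q 1 s *m q 1 s = - 1%:M & q 2 s *m q 2 s = - 1%:M].
Proof.
by split; rewrite /q mxzM -mxz1 -mxzN; congr mxz; case: s; vm_compute.
Qed.

Lemma q_cyc s : [/\ q 0 s *m q 1 s = q 2 s, q 1 s *m q 2 s = q 0 s & q 2 s *m q 0 s = q 1 s].
Proof. by split; rewrite /q mxzM; congr mxz; case: s; vm_compute. Qed.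

Lemma q_anticyc s :
  [/\ q 1 s *m q 0 s = - q 2 s, q 2 s *m q 1 s = - q 0 s & q 0 s *m q 2 s = - q 1 s].
Proof. by split; rewrite /q mxzM -mxzN; congr mxz; case: s; vm_compute. Qed.

Lemma q_comm k k' s : (k < 3)%N -> (k' < 3)%N -> q k s *m q k' (~~ s) = q k' (~~ s) *m q k s.
Proof.
by move=> hk hk'; rewrite /q !mxzM; congr mxz; case: s; case: k hk => [|[|[|]]] // _;
  case: k' hk' => [|[|[|]]] // _; vm_compute.
Qed.

Lemma q_tr k k' s : (k < 3)%N -> (k' < 3)%N -> \tr (q k s *m q k' (~~ s)) = 0.
Proof.
move=> hk hk'; rewrite /q mxzM /mxtrace sum4 !mxE -!intrD.
by case: s; case: k hk => [|[|[|]]] // _; case: k' hk' => [|[|[|]]] // _.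
Qed.

Lemma q_tr1 k s : (k < 3)%N -> \tr (q k s) = 0.
Proof.
move=> hk; rewrite /mxtrace sum4 !mxE -!intrD.
by case: s; case: k hk => [|[|[|]]].
Qed.

Lemma q_antisym k s : (k < 3)%N -> antisym (q k s).
Proof.
move=> hk a b; rewrite !mxE -mulrNz; congr (_%:~R); move: a b; do 2! apply: I4P;
by case: s; case: k hk => [|[|[|]]].
Qed.

Fact addmxE (X Y : 'M[K]_4) i j : (X + Y) i j = X i j + Y i j. Proof. exact: mxE. Qed.
Fact oppmxE (X : 'M[K]_4) i j : (- X) i j = - X i j. Proof. exact: mxE. Qed.
Fact scalemxE (c : K) (X : 'M[K]_4) i j : (c *: X) i j = c * X i j. Proof. exact: mxE. Qed.
Definition linmxE := (addmxE, oppmxE, scalemxE).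

Lemma sig_antisym s t : antisym (sig s t).
Proof.
move=> a b; have h k : (k < 3)%N -> q k s a b = - q k s b a by move=> hk; apply: q_antisym.
by rewrite !sigE !linmxE !h //; ring.
Qed.

Definition qmulE := (@mulmxDl, @mulmxDr, =^~ @scalemxAl, =^~ @scalemxAr).

Lemma sig_br s t s' t' : sig s t *m sig s' t' - sig s' t' *m sig s t =
  if s == s' then (br_c t t')%:~R *: sig s (br_t t t') else 0.
Proof.
have h2 : 2 != 0 :> K by rewrite pnatr_eq0.
case: eqP => [<-|/eqP ss']; last first.
  have -> : s' = ~~ s by case: s s' ss' => [] [].
  apply/eqP; rewrite subr_eq0; apply/eqP; rewrite !sigE !qmulE.
  do !rewrite ![q _ s *m _]q_comm //; apply/matrixP => i j.
  by rewrite !linmxE; ring.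
have [e1 e2 e3] := q_sq s; have [e4 e5 e6] := q_cyc s; have [e7 e8 e9] := q_anticyc s.
rewrite !sigE !qmulE e1 e2 e3 e4 e5 e6 e7 e8 e9.
by apply/matrixP => i j; case: t t' => [] []; rewrite !linmxE /=; field: ii.
Qed.

Lemma sig_tr s t s' t' : \tr (sig s t *m sig s' t') / 2 =
  if s == s' then (br_f t t')%:~R else 0.
Proof.
have h2 : 2 != 0 :> K by rewrite pnatr_eq0.
case: eqP => [<-|/eqP ss']; last first.
  have -> : s' = ~~ s by case: s s' ss' => [] [].
  by rewrite !sigE !qmulE !linearD !linearZ_LR /= !q_tr // !mulr0 !addr0 mul0r.
have [e1 e2 e3] := q_sq s; have [e4 e5 e6] := q_cyc s; have [e7 e8 e9] := q_anticyc s.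
rewrite !sigE !qmulE e1 e2 e3 e4 e5 e6 e7 e8 e9 !linearD !linearZ_LR /= !linearN /=.
rewrite !q_tr1 // mxtrace1 /GRing.scale /=.
by case: t t' => [] []; rewrite /=; field: ii.
Qed.

End Sl2Currents.

(** * The two copies on Fock space and their common energy *)

Section FockRep.
Variable K : numClosedFieldType.
Notation F := {poly K}.
Notation psi := (@psi K).
Notation B := (@B K).
Notation L := (@L K).
Notation L0 := (@L0 K).
Notation Cur := (@Cur K).
Notation sig := (@sig K).
Notation q := (@q K).
Implicit Types (y z : F) (a b c d : 'I_4) (n m r : int) (s : bool) (t : sl2b).

Notation q0 := (@Ordinal 4 0 isT).
Notation q1 := (@Ordinal 4 1 isT).
Notation q2 := (@Ordinal 4 2 isT).
Notation q3 := (@Ordinal 4 3 isT).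

Let two0 : 2 != 0 :> K. Proof. by rewrite pnatr_eq0. Qed.

Definition fop (x : op bool) : {linear F -> F} := Cur (sig x.1.1 x.1.2) x.2.

(** The principal grading on Fock space: -2 [L0] accounts for 2 n, and half the sum of the two
    Cartan elements for [degb]. The constant 1 gives [wvec] the principal degree 1 that the tensor
    square of the highest weight vector has. *)
Lemma fD_lin : linear (fun y => y + (- 2) *: L0 y + 2^-1 *: \sum_s fop (s, Hb, 0) y).
Proof.
apply: lin_add; first by apply: lin_add; [|apply: lin_scale; apply: linearP].
by apply: lin_scale; apply: lin_sum => s; apply: linearP.
Qed.

Fact fD_key : {f : {linear F -> F} |
  forall y, f y = y + (- 2) *: L0 y + 2^-1 *: \sum_s fop (s, Hb, 0) y}.
Proof. by exists (mklin fD_lin). Qed.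
Definition fD : {linear F -> F} := sval fD_key.

Lemma fDE y : fD y = y + (- 2) *: L0 y + 2^-1 *: \sum_s fop (s, Hb, 0) y.
Proof. exact: (svalP fD_key). Qed.

Lemma fop_br s t m s' t' n y :
  fop (s, t, m) (fop (s', t', n) y) = fop (s', t', n) (fop (s, t, m) y)
    + (if s == s' then (br_c t t')%:~R *: fop (s, br_t t t', m + n) y
         + (1 * (m%:~R * (m + n == 0)%:R * (br_f t t')%:~R)) *: y
       else 0).
Proof.
rewrite /fop /= Cur_br; try exact: sig_antisym.
rewrite sig_br sig_tr -addrA; congr (_ + _); case: ifP => _.
  by rewrite CurZ mul1r.
by rewrite Cur0 mulr0 scale0r addr0.
Qed.

Lemma fD_br x y : fD (fop x y) = fop x (fD y) + (deg x)%:~R *: fop x y.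
Proof.
case: x => [[s t] n].
have hH : \sum_s' fop (s', Hb, 0) (fop (s, t, n) y) =
    fop (s, t, n) (\sum_s' fop (s', Hb, 0) y) + (2 * degb t)%:~R *: fop (s, t, n) y.
  rewrite linear_sum (bigD1 s) //= [X in _ = X + _](bigD1 s) //= fop_br eqxx !mul0r !mulr0 scale0r addr0 add0r.
  rewrite -!addrA; congr (_ + _); rewrite addrC; congr (_ + _).
    by apply: eq_bigr => s' ss'; rewrite fop_br (negbTE ss') addr0.
  by case: t => /=; rewrite ?mulr0 ?scale0r.
have hL : L0 (fop (s, t, n) y) = fop (s, t, n) (L0 y) - n%:~R *: fop (s, t, n) y.
  exact: L0_Cur.
move: hH; set S := \sum_s' fop (s', Hb, 0) y => hH.
rewrite !fDE hH -/S hL [fop _ (_ + 2^-1 *: _)]linearD [fop _ (y + _)]linearD.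
rewrite ![fop _ (_ *: _)]linearZ_LR.
apply/polyP => k; rewrite !(coefD, coefN, coefZ) /deg /= !intrD !intrM; by field.
Qed.

Definition fock_rep : rep bool F 1 := Rep fop_br fD_br.

Lemma q_sig s : [/\ q 0 s = 'i *: sig s Hb, q 1 s = sig s Eb - sig s Fb
  & q 2 s = 'i *: (sig s Eb + sig s Fb)].
Proof.
split; apply/matrixP => i j; rewrite !sigE !linmxE /=; by field: (ii K).
Qed.

Definition sgn s : K := if s then 1 else -1.

Lemma Cur_sig0 s n y : Cur (q 0 s) n y = 'i *: fop (s, Hb, n) y.
Proof. by have [-> _ _] := q_sig s; rewrite CurZ. Qed.

Lemma Cur_sig1 s n y : Cur (q 1 s) n y = fop (s, Eb, n) y - fop (s, Fb, n) y.
Proof. by have [_ -> _] := q_sig s; rewrite CurD -[- sig s Fb]scaleN1r CurZ scaleN1r. Qed.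

Lemma Cur_sig2 s n y : Cur (q 2 s) n y = 'i *: (fop (s, Eb, n) y + fop (s, Fb, n) y).
Proof. by have [_ _ ->] := q_sig s; rewrite CurZ CurD. Qed.

(** The copies differ in the sign of the component that contains fermion 0: they are the self-dual
    and anti-self-dual halves of so(4). *)
Lemma Cur_q0 s n y : Cur (q 0 s) n y = sgn s *: B q1 q0 n y + B q3 q2 n y.
Proof.
rewrite CurE !sum4 !mxE /= !Baa (BC q1 q0) (BC q3 q2).
by case: s; apply/polyP => k; rewrite !(coefD, coefZ, coefN, coef0) /sgn /=; field.
Qed.

Lemma Cur_q1 s n y : Cur (q 1 s) n y = sgn s *: B q2 q0 n y + B q1 q3 n y.
Proof.
rewrite CurE !sum4 !mxE /= !Baa (BC q2 q0) (BC q1 q3).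
by case: s; apply/polyP => k; rewrite !(coefD, coefZ, coefN, coef0) /sgn /=; field.
Qed.

Lemma Cur_q2 s n y : Cur (q 2 s) n y = sgn s *: B q3 q0 n y + B q2 q1 n y.
Proof.
rewrite CurE !sum4 !mxE /= !Baa (BC q3 q0) (BC q2 q1).
by case: s; apply/polyP => k; rewrite !(coefD, coefZ, coefN, coef0) /sgn /=; field.
Qed.

Definition CasX X N y := 2^-1 *: Cur X 0 (Cur X 0 y)
  + \sum_(1 <= k < N) Cur X (- k%:Z) (Cur X k y).

(** In the sum over the two copies the mixed products of [B a b] and [B c d] cancel, which leaves
    the energies of two separate pairs of fermions. *)
Lemma CasX_sum (X : bool -> 'M[K]_4) a b c d N y :
  (forall s n z, Cur (X s) n z = sgn s *: B a b n z + B c d n z) ->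
  CasX (X true) N y + CasX (X false) N y = 2 *: (Cas a b N y + Cas c d N y).
Proof.
move=> hX; have h m n : Cur (X true) m (Cur (X true) n y) + Cur (X false) m (Cur (X false) n y)
    = 2 *: (B a b m (B a b n y) + B c d m (B c d n y)).
  rewrite !hX /sgn !scale1r !scaleN1r ![B _ _ m (_ + _)]linearD ![B _ _ m (- _)]linearN /=.
  by apply/polyP => k; rewrite !(coefD, coefN, coefZ); ring.
rewrite /CasX /Cas addrACA -scalerDr -big_split /= h.
rewrite (eq_bigr _ (fun k _ => h (- k%:Z) k)) -scaler_sumr big_split /=.
by apply/polyP => k; rewrite !(coefD, coefZ); field.
Qed.

(** The three imaginary directions correspond to the three ways to split four fermions into two
    pairs, and each splitting accounts for every fermion once. *)
Lemma q_energy k y : (k < 3)%N ->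
  ev (fun N => CasX (q k true) N y + CasX (q k false) N y = (- 2) *: L0 y).
Proof.
move=> hk; have h a b c d : a != b -> c != d -> (forall s n z,
    Cur (q k s) n z = sgn s *: B a b n z + B c d n z) ->
    L a y + L b y + (L c y + L d y) = L0 y ->
    ev (fun N => CasX (q k true) N y + CasX (q k false) N y = (- 2) *: L0 y).
  move=> ab cd hX hL; apply: ev_imp (ev_and (pair_energy y ab) (pair_energy y cd)).
  by move=> N [h1 h2]; rewrite (CasX_sum _ _ hX) h1 h2 -opprD hL scalerN scaleNr.
case: k hk h => [|[|[|//]]] _ h.
- by apply: (h q1 q0 q3 q2) => //; [exact: Cur_q0 | rewrite L0E sum4; ring].
- by apply: (h q2 q0 q1 q3) => //; [exact: Cur_q1 | rewrite L0E sum4; ring].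
- by apply: (h q3 q0 q2 q1) => //; [exact: Cur_q2 | rewrite L0E sum4; ring].
Qed.

Section HwMod.
Variables (W : F -> Prop) (x : F).
Hypothesis sW : subspace W.
Hypothesis W_op : forall o y, W y -> W (fop o y).
Hypothesis x_pos : forall o : op bool, 0 < deg o -> W (fop o x).

Lemma Cur_q_mem k s n y : (k < 3)%N -> (forall t, W (fop (s, t, n) y)) -> W (Cur (q k s) n y).
Proof.
case: k => [|[|[|//]]] _ hy; rewrite ?Cur_sig0 ?Cur_sig1 ?Cur_sig2.
- exact: subspaceZ.
- exact: subspaceB.
- by apply: subspaceZ => //; apply: subspaceD.
Qed.

(** A current of mode j > 0 has degree 2 j + [degb t] > 0 for every [t], so modulo [W] only the zero
    mode remains. *)
Lemma CasX_mod k s N : (k < 3)%N -> W (CasX (q k s) N x - 2^-1 *: Cur (q k s) 0 (Cur (q k s) 0 x)).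
Proof.
move=> hk; rewrite /CasX addrC addKr big_nat; apply: subspace_sum => // j /andP[j1 _].
apply: Cur_q_mem => // t; apply: W_op; apply: Cur_q_mem => // t'.
by apply: x_pos; case: t'; rewrite /deg /=; lia.
Qed.

Lemma q_energy_mod k : (k < 3)%N ->
  W (2^-1 *: (Cur (q k true) 0 (Cur (q k true) 0 x) + Cur (q k false) 0 (Cur (q k false) 0 x))
     + 2 *: L0 x).
Proof.
move=> hk; have [N hN] := ev_ex (q_energy x hk).
have h1 := CasX_mod true N hk; have h2 := CasX_mod false N hk.
have := subspaceN sW (subspaceD sW h1 h2).
rewrite addrACA hN; congr W; apply/polyP => j; rewrite !(coefD, coefZ, coefN); ring.
Qed.

Local Notation H s := (fop (s, Hb, 0)).

Lemma energy_square_mod :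
  W (H true (H true x) + H false (H false x) - 4 *: L0 x).
Proof.
have := @q_energy_mod 0 isT; move/(subspaceZ (-2) sW); congr W.
rewrite !Cur_sig0 ![fop _ ('i *: _)]linearZ_LR !scalerA ii.
by apply/polyP => j; rewrite !(coefD, coefZ, coefN); field.
Qed.

(** The other two directions are e - f and 'i (e + f). Their squares add up to -2 (e f + f e), which
    is -2 h modulo [W] because e maps [x] into [W]. *)
Lemma energy_linear_mod : W (H true x + H false x - 4 *: L0 x).
Proof.
have hs s : W (2^-1 *: (Cur (q 1 s) 0 (Cur (q 1 s) 0 x) + Cur (q 2 s) 0 (Cur (q 2 s) 0 x)) + H s x).
  rewrite !Cur_sig1 !Cur_sig2.
  rewrite ![fop _ ('i *: _)]linearZ_LR ![fop _ (_ - _)]linearB ![fop _ (_ + _)]linearD.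
  have hE : W (fop (s, Eb, 0) x) by apply: x_pos.
  have := fop_br s Eb 0 s Fb 0 x; rewrite eqxx addr0 scale1r !mul0r mulr0 scale0r addr0 => ->.
  move/(subspaceZ (-2) sW): (W_op (s, Fb, 0) hE); congr W.
  by apply/polyP => j; rewrite !(coefD, coefZ, coefN) /=; field: (ii K).
have h1 := @q_energy_mod 1 isT; have h2 := @q_energy_mod 2 isT.
have h3 := subspaceB sW (subspaceD sW (hs true) (hs false)) (subspaceD sW h1 h2).
move: h3; congr W; apply/polyP => j; rewrite !(coefD, coefZ, coefN); ring.
Qed.

End HwMod.
End FockRep.

(** * Irreducibility of the odd part of Fock space *)

Section FockIrreducible.
Variable K : numClosedFieldType.
Notation F := {poly K}.
Notation psi := (@psi K).
Notation B := (@B K).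
Notation L := (@L K).
Notation L0 := (@L0 K).
Notation Cur := (@Cur K).
Notation sig := (@sig K).
Notation fop := (@fop K).
Implicit Types (y z : F) (a b : 'I_4) (n m k : nat) (r : int) (s d e : bool) (t : sl2b).
Local Notation H s := (fop (s, Hb, 0)).

Notation q0 := (@Ordinal 4 0 isT).
Notation q1 := (@Ordinal 4 1 isT).
Notation q2 := (@Ordinal 4 2 isT).
Notation q3 := (@Ordinal 4 3 isT).

Let two0 : 2 != 0 :> K. Proof. by rewrite pnatr_eq0. Qed.
Let i0 : 'i != 0 :> K. Proof. exact: neq0Ci. Qed.

Definition E2tot (n : nat) := (\sum_a E2 a n)%N.

Lemma E2tot_flip (b : 'I_4) (k n : nat) : ~~ bit (4 * k + b) n ->
  E2tot (flip (4 * k + b) n) = (E2tot n + k.*2.+1)%N.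
Proof.
move=> hb; rewrite /E2tot (eq_bigr _ (fun a _ => E2_flip a hb)) big_split /=; congr addn.
by rewrite -big_mkcond /= (big_pred1 b) // => a; rewrite eq_sym.
Qed.

Lemma coef_L0 y (n : nat) : (L0 y)`_n = (E2tot n)%:R / 2 * y`_n.
Proof.
rewrite L0E coef_sum /E2tot natr_sum mulr_suml mulr_suml.
by apply: eq_bigr => a _; rewrite coef_L.
Qed.

(** Every mode contributes an odd number to twice the energy, so this is the parity of the number of
    fermions. *)
Definition Fpar (p : bool) y := forall n : nat, y`_n != 0 -> odd (E2tot n) = p.

Lemma Fpar_subspace p : subspace (Fpar p).
Proof.
split=> [n|c u v hu hv n]; first by rewrite coef0 eqxx.
rewrite coefD coefZ; have [u0|u0] := eqVneq u`_n 0; last by move=> _; apply: hu.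
by rewrite u0 mulr0 add0r; apply: hv.
Qed.

Lemma Fpar_psi p a r y : Fpar p y -> Fpar (~~ p) (psi a r y).
Proof.
move=> hy n; rewrite /psi; case: r => k; rewrite coef_osc; (case: (bit _ _ =P _) => hb;
  last by rewrite mul0r eqxx); rewrite mulf_eq0 negb_or => /andP[_ /hy <-].
  by rewrite E2tot_flip ?hb // oddD /= odd_double addbT negbK.
have {1}<- := flipK (4 * k + a) n.
by rewrite E2tot_flip ?bit_flip ?eqxx ?hb // oddD /= odd_double addbT.
Qed.

Lemma Fpar_op p x y : Fpar p y -> Fpar p (fop x y).
Proof.
move=> hy; have sF := Fpar_subspace p; rewrite /fop CurE.
apply: subspace_sum => // a _; apply: subspace_sum => // b _; apply: (subspaceZ _ sF).
have [->|ab] := eqVneq a b; first by rewrite Baa; case: sF.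
have [N ->] := ev_ex (B_ev x.2 y ab); rewrite /isum; apply: subspace_sum => // i _.
by rewrite -[p]negbK; do 2! apply: Fpar_psi.
Qed.

Lemma Fpar_L0 p y : Fpar p y -> Fpar p (L0 y).
Proof. by move=> hy n; rewrite coef_L0 mulf_eq0 negb_or => /andP[_]; apply: hy. Qed.

(* For each d, the two values of e give eigenvectors of the Cartan elements of both copies of
   sl2, with weights [wt d e s]. *)
Definition uvec d e a : K :=
  if d then (if a == q2 then (if e then 'i else - 'i) else if a == q3 then 1 else 0)
  else (if a == q0 then (if e then 'i else - 'i) else if a == q1 then 1 else 0).

Definition wt d e s : int := if d || s then (if e then 1 else -1) else (if e then -1 else 1).

Lemma sig_uvec d e s a : \sum_c sig s Hb a c * uvec d e c = (wt d e s)%:~R * uvec d e a.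
Proof.
by rewrite sum4; move: a; apply: I4P; case: d e s => [] [] []; rewrite !sigE !mxE /uvec /wt /=; ring: (ii K).
Qed.

Lemma H_uvec d e s r y : H s (psv (uvec d e) r y) =
  psv (uvec d e) r (H s y) + (wt d e s)%:~R *: psv (uvec d e) r y.
Proof.
rewrite /fop Cur_psv; last exact: sig_antisym.
rewrite add0r /psv scaler_sumr; congr (_ + _); apply: eq_bigr => a _.
by rewrite sig_uvec scalerA.
Qed.

Lemma L0_psv u r y : L0 (psv u r y) = psv u r (L0 y) - (r%:~R + 1 / 2) *: psv u r y.
Proof.
rewrite /psv [L0 _]linear_sum scaler_sumr -sumrB; apply: eq_bigr => a _.
by rewrite [L0 _]linearZ_LR L0_psi scalerBr !scalerA [_ * u a]mulrC.
Qed.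

Lemma psvD u r y z : psv u r (y + z) = psv u r y + psv u r z.
Proof. exact: (linearD (mklin (psv_lin u r))). Qed.

Lemma psvZ u r (c : K) y : psv u r (c *: y) = c *: psv u r y.
Proof. exact: (linearZ_LR (mklin (psv_lin u r))). Qed.

(** The creation operators are combined into weight vectors, which shift the eigenvalues of the
    Cartan elements and of the degree by constants; the coordinate fermions are recovered as their
    combinations. *)
Lemma fock_wind (P : F -> Prop) : subspace P -> P 1 ->
  (forall d e k y, P y -> P (psv (uvec d e) (Negz k) y)) -> forall y, P y.
Proof.
move=> sP P1 hP; apply: fock_ind => // a k y Py.
have h d e : P (psv (uvec d e) (Negz k) y) by apply: hP.
have hp (u v : K) d : P (u *: psv (uvec d true) (Negz k) y + v *: psv (uvec d false) (Negz k) y).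
  by apply: subspaceD => //; apply: subspaceZ.
move: a; apply: I4P.
- have := hp (2 * 'i)^-1 (- (2 * 'i)^-1) false; congr P.
  rewrite /psv !sum4 /uvec /=; apply/polyP => j; rewrite !(coefD, coefZ, coefN); by field; rewrite i0.
- have := hp 2^-1 2^-1 false; congr P.
  rewrite /psv !sum4 /uvec /=; apply/polyP => j; rewrite !(coefD, coefZ, coefN); by field.
- have := hp (2 * 'i)^-1 (- (2 * 'i)^-1) true; congr P.
  rewrite /psv !sum4 /uvec /=; apply/polyP => j; rewrite !(coefD, coefZ, coefN); by field; rewrite i0.
- have := hp 2^-1 2^-1 true; congr P.
  rewrite /psv !sum4 /uvec /=; apply/polyP => j; rewrite !(coefD, coefZ, coefN); by field.
Qed.

Lemma L0_vac : L0 1 = 0.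
Proof.
apply/polyP => n; rewrite coef_L0 coef1 coef0; case: n => [|n]; rewrite ?mulr0 //.
by rewrite /E2tot big1 ?mul0r // => a _; rewrite E2_0.
Qed.

Lemma H_vac s : H s 1 = 0. Proof. by apply: Cur_vac. Qed.

Lemma spec_H s y : spec (fun c => exists n : int, c = n%:~R) (H s) y.
Proof.
elim/fock_wind: y => [||d e k y hy]; first exact: spec_subspace.
  by apply: (spec_eigen (c := 0)); [exists 0 | rewrite H_vac scale0r].
apply: (spec_map (f := mklin (psv_lin (uvec d e) (Negz k))) _ _ hy) => [z|_ [n ->]].
  exact: H_uvec.
by exists (n + wt d e s); rewrite intrD.
Qed.

Lemma spec_fD y : spec (below 1) (fD K) y.
Proof.
elim/fock_wind: y => [||d e k y hy]; first exact: spec_subspace.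
  apply: (spec_eigen (c := 1)); first by exists 0%N; rewrite subr0.
  by rewrite fDE L0_vac big1 ?scaler0 ?addr0 ?scale1r // => s _; apply: H_vac.
(* The principal degree of the mode: minus twice its energy k + 1/2, plus half the sum of its two
   weights, which agree for [d = true] and cancel for [d = false]. It is never positive, so the
   degree stays at most that of the vacuum. *)
pose w : int := - (k.*2.+1)%:Z + (if d then (if e then 1 else -1) else 0).
have hw z : fD K (psv (uvec d e) (Negz k) z) =
    psv (uvec d e) (Negz k) (fD K z) + w%:~R *: psv (uvec d e) (Negz k) z.
  rewrite !fDE L0_psv !big_bool /= !H_uvec.
  have -> : psv (uvec d e) (Negz k) (z + -2 *: L0 z + 2^-1 *: (H true z + H false z)) =
    psv (uvec d e) (Negz k) z + -2 *: psv (uvec d e) (Negz k) (L0 z)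
     + 2^-1 *: (psv (uvec d e) (Negz k) (H true z) + psv (uvec d e) (Negz k) (H false z)).
    by rewrite !psvD !psvZ psvD.
  have hodd : (k.*2.+1)%:R = 2 * k%:R + 1 :> K by rewrite -natr1 -muln2 natrM mulrC.
  apply/polyP => j; rewrite !(coefD, coefZ, coefN) /w intrD NegzE !mulrNz -!pmulrn hodd -natr1.
  by rewrite /wt; case: (d) (e) => [] [] /=; field.
apply: (spec_map (f := mklin (psv_lin (uvec d e) (Negz k))) (k := w%:~R) _ _ hy); first exact: hw.
move=> c; apply: below_shift; rewrite /w; case: (d) (e) => [] []; lia.
Qed.

(* The lowest odd state that corresponds to the tensor square of the highest weight vector. *)
Definition wvec : F := psv (uvec true true) (Negz 0) 1.

Record fstable (W : F -> Prop) : Prop := FStable {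
  fstable_sub : subspace W;
  fstable_op : forall x y, W y -> W (fop x y);
  fstable_L0 : forall y, W y -> W (L0 y) }.

Lemma pker_mod (A : {linear F -> F}) (W : F -> Prop) l (c : K) v : subspace W ->
  (forall u, W u -> W (A u)) -> W (A v - c *: v) ->
  W (pker A l v - (\prod_(k <- l) (c - k)) *: v).
Proof.
move=> sW AW hv; elim: l => [|k l IH] /=.
  by rewrite big_nil scale1r subrr; case: sW.
have h1 := AW _ IH; have h2 := subspaceZ k sW IH.
have h3 := subspaceZ (\prod_(k <- l) (c - k)) sW hv.
have := subspaceD sW (subspaceB sW h1 h2) h3.
congr W; rewrite big_cons [A (_ - _)]linearB [A (_ *: v)]linearZ_LR.
apply/polyP => j; rewrite !(coefD, coefN, coefZ); ring.
Qed.

Lemma coef_pker_L0 l y n :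
  (pker L0 l y)`_n = \prod_(c <- l) ((E2tot n)%:R / 2 - c) * y`_n.
Proof.
elim: l => [|c l IH] /=; first by rewrite big_nil mul1r.
by rewrite coefB coefZ coef_L0 IH big_cons; ring.
Qed.

(** Twice the energy being 1 leaves room for a single occupied mode, with k = 0. *)
Lemma energy_half z : (forall n, z`_n != 0 -> E2tot n = 1%N) ->
  exists u, z = psv u (Negz 0) 1.
Proof.
move=> zE; exists (fun a => z`_(flip (4 * 0 + a) 0) * sg K (4 * 0 + a) (flip (4 * 0 + a) 0)).
apply/polyP => n; rewrite /psv coef_sum.
under eq_bigr => a _ do rewrite coefZ coef_osc coef1.
have flip_eq (a : 'I_4) : (flip (4 * 0 + a) n == 0%N) = (n == flip (4 * 0 + a) 0%N).
  by rewrite -(inj_eq (can_inj (flipK (4 * 0 + a)))) flipK.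
have [zn0|zn] := eqVneq z`_n 0.
  rewrite zn0 big1 // => a _; rewrite flip_eq.
  by case: (n =P _) => [<-|_]; rewrite ?zn0 ?mul0r // !mulr0.
have [i hi] : exists i, bit i n.
  apply: contrapT => /forallNP hn; have n0 : n = 0%N.
    by apply: bit_inj => i; rewrite bit0; apply/negP/hn.
  by have := zE _ zn; rewrite n0 /E2tot big1 // => a _; rewrite E2_0.
have bn (j : nat) m : bit j m -> exists k (b : 'I_4), [/\ j = (4 * k + b)%N, m = flip j (flip j m),
    ~~ bit j (flip j m) & E2tot m = (E2tot (flip j m) + k.*2.+1)%N].
  move=> hj; exists (j %/ 4)%N, (inord (j %% 4)).
  have hb : ~~ bit j (flip j m) by rewrite bit_flip eqxx hj.
  have ej : j = (4 * (j %/ 4) + (inord (j %% 4) : 'I_4))%N.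
    by rewrite inordK ?ltn_mod // mulnC -divn_eq.
  split=> //; first by rewrite flipK.
  by have := @E2tot_flip (inord (j %% 4)) (j %/ 4)%N (flip j m); rewrite -ej flipK; apply.
have [k [b [ei en hb hE]]] := bn i n hi.
have k0 : k = 0%N by have := zE _ zn; rewrite hE; lia.
have m0 : flip i n = 0%N.
  apply: bit_inj => j; rewrite bit0; apply/negP => hj.
  have [k' [b' [_ _ _ hE']]] := bn j _ hj.
  by have := zE _ zn; rewrite hE hE'; lia.
rewrite m0 k0 in ei en; rewrite (bigD1 b) //= big1 ?addr0 => [|a ab].
  rewrite -ei -en m0 hi eqxx mulr1 /= -mulrA sgM mulr1 //.
rewrite flip_eq (_ : (n == _) = false) ?mulr0 //; apply/negbTE/eqP.
rewrite {1}en ei => /(congr1 (bit (4 * 0 + b))); rewrite !bit_flip bit0 eqxx /=.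
by move/esym; rewrite mode_eq (negbTE ab).
Qed.

(* A highest weight vector modulo W, of weights n1 and n2 for the two copies, has energy
   (n1^2 + n2^2) / 4 = (n1 + n2) / 4 modulo W. Hence n1, n2 are 0 or 1, and as the energy is
   half an odd number both are 1. *)
Lemma fock_irr (U W : F -> Prop) u : fstable U -> fstable W ->
  (forall y, U y -> Fpar true y) -> U u -> ~ W u ->
  exists z c, [/\ U z, ~ W z & W (z - c *: wvec)].
Proof.
move=> [sU Uop UL] [sW Wop WL] Uodd Uu nWu.
have [x0 [Ux0 nWx0 x0_pos]] : exists v, [/\ U v, ~ W v & forall x, 0 < deg x -> W (fop x v)].
  by apply: (exists_hw_mod (a := fock_rep K) spec_fD _ sW Uu nWu) => x v _; apply: Uop.
pose pos v := forall x : op bool, 0 < deg x -> W (fop x v).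
have spos : subspace pos.
  by apply: subspace_all => x; apply: subspace_all => _; apply: subspace_preim.
pose U1 v := U v /\ pos v.
have sU1 : subspace U1 by apply: subspace_and.
have U1H s v : U1 v -> U1 (H s v).
  move=> [Uv pv]; split; first exact: Uop.
  move=> [[s' t] n] hx; rewrite fop_br addr0.
  apply: subspaceD => //; first by apply: Wop; apply: pv.
  case: eqP => _; last by case: sW.
  apply: subspaceD => //; first by case: t hx => hx /=; rewrite ?scale0r; try (by case: sW);
     apply: subspaceZ => //; apply: pv.
  rewrite [X in X *: _](_ : _ = 0) ?scale0r; first by case: sW.
  case: t hx => hx; [by rewrite /= !mulr0 | by rewrite /= !mulr0 |].
  by case: (n =P 0) => [hn|_]; [move: hx; rewrite hn | rewrite mulr0 mul0r mulr0].
have U1L v : U1 v -> U1 (L0 v).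
  move=> [Uv pv]; split=> [|x hx]; first exact: UL.
  have h : L0 (fop x v) = fop x (L0 v) - x.2%:~R *: fop x v by apply: L0_Cur.
  have -> : fop x (L0 v) = L0 (fop x v) + x.2%:~R *: fop x v by rewrite h subrK.
  by apply: subspaceD => //; [apply: WL; apply: pv | apply: subspaceZ => //; apply: pv].
have UHU s v : U v -> U (H s v) by apply: Uop.
have WHW s v : W v -> W (H s v) by apply: Wop.
have subE (A : {linear F -> F}) (k : K) : subspace (fun v => W (A v - k *: v)).
  split=> [|c v z hv hz]; first by rewrite linear0 scaler0 subrr; case: sW.
  have := subspaceD sW (subspaceZ c sW hv) hz; congr W.
  by rewrite linearP; apply/polyP => j; rewrite !(coefD, coefN, coefZ); ring.
have HC s s' v : H s (H s' v) = H s' (H s v).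
  rewrite fop_br -[RHS]addr0; congr (_ + _); case: ifP => // _.
  by rewrite scale0r add0r (_ : 1 * _ = 0) ?scale0r // !mul0r mulr0.
have HL s v : H s (L0 v) = L0 (H s v).
  have h : L0 (H s v) = H s (L0 v) - 0%:~R *: H s v by apply: L0_Cur.
  by rewrite h scale0r subr0.
(* Three uses of [spec_mod] give an eigenvector modulo [W], for the two Cartan elements and then for
   the energy; each search takes place inside the vectors that already satisfy the earlier
   conditions. *)
have [_ [x1 [_ [[n1 ->] U1x1 nWx1 W1 _]]]] :=
  spec_mod sU1 sW (U1H true) (spec_H true x0) (conj Ux0 x0_pos) nWx0.
pose U2 v := U1 v /\ W (H true v - n1%:~R *: v).
have sU2 : subspace U2 by apply: subspace_and.
have U2H v : U2 v -> U2 (H false v).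
  move=> [U1v hv]; split; first exact: U1H.
  by rewrite HC -linearZ_LR -linearB; apply: WHW.
have U2L v : U2 v -> U2 (L0 v).
  move=> [U1v hv]; split; first exact: U1L.
  by rewrite HL -linearZ_LR -linearB; apply: WL.
have [_ [x2 [_ [[n2 ->] U2x2 nWx2 W2 _]]]] :=
  spec_mod sU2 sW U2H (spec_H false x1) (conj U1x1 W1) nWx1.
pose U3 v := U2 v /\ W (H false v - n2%:~R *: v).
have sU3 : subspace U3 by apply: subspace_and.
have U3L v : U3 v -> U3 (L0 v).
  move=> [U2v hv]; split; first exact: U2L.
  by rewrite HL -linearZ_LR -linearB; apply: WL.
have specL v : Fpar true v -> spec (fun c => exists2 k : nat, c = k%:R / 2 & odd k) L0 v.
  move=> hv; rewrite -[v]coefK poly_def; apply: subspace_sum; first exact: spec_subspace.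
  move=> i _; have [->|vi] := eqVneq v`_i 0.
    by rewrite scale0r; case: (spec_subspace (fun c => exists2 k : nat, c = k%:R / 2 & odd k) L0).
  apply: subspaceZ; first exact: spec_subspace.
  apply: (spec_eigen (c := (E2tot i)%:R / 2)); first by exists (E2tot i) => //; apply: hv.
  apply/polyP => j; rewrite coef_L0 coefZ !coefXn.
  by case: eqP => [->|_]; rewrite ?mulr0.
have [_ [x3 [_ [[e ->] e_odd U3x3 nWx3 W3 _]]]] :=
  spec_mod sU3 sW U3L (specL x2 (Uodd _ (U2x2.1.1))) (conj U2x2 W2) nWx2.
case: U3x3 => [[[Ux3 x3_pos] W1'] W2'].
have notW (k : K) : W (k *: x3) -> k = 0.
  move=> hk; apply/eqP/negPn/negP => k0; apply: nWx3.
  by rewrite -[x3](scalerK k0); apply: subspaceZ.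
have Wsq s (n : int) : W (H s x3 - n%:~R *: x3) -> W (H s (H s x3) - (n * n)%:~R *: x3).
  move=> hn; have := subspaceD sW (WHW s _ hn) (subspaceZ n%:~R sW hn); congr W.
  rewrite [H s (_ - _)]linearB [H s (_ *: x3)]linearZ_LR intrM.
  by apply/polyP => j; rewrite !(coefD, coefN, coefZ); ring.
have eq1 : n1 * n1 + n2 * n2 = 2 * e%:Z.
  have h := energy_square_mod sW Wop x3_pos.
  have := subspaceB sW (subspaceB sW h (subspaceD sW (Wsq _ _ W1') (Wsq _ _ W2'))) (subspaceZ (-4) sW W3).
  rewrite [X in W X](_ : _ = (n1 * n1 + n2 * n2 - 2 * e%:Z)%:~R *: x3); last first.
    rewrite !intrD !mulrNz !intrM -pmulrn.
    by apply/polyP => j; rewrite !(coefD, coefN, coefZ); field.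
  by move/notW/eqP; rewrite intr_eq0 subr_eq0 => /eqP.
have eq2 : n1 + n2 = 2 * e%:Z.
  have h := energy_linear_mod sW Wop x3_pos.
  have := subspaceB sW (subspaceB sW h (subspaceD sW W1' W2')) (subspaceZ (-4) sW W3).
  rewrite [X in W X](_ : _ = (n1 + n2 - 2 * e%:Z)%:~R *: x3); last first.
    rewrite !intrD !mulrNz !intrM -pmulrn.
    by apply/polyP => j; rewrite !(coefD, coefN, coefZ); field.
  by move/notW/eqP; rewrite intr_eq0 subr_eq0 => /eqP.
have [e1 [n11 n21]] : e = 1%N /\ (n1 = 1 /\ n2 = 1).
  have h1 : 0 <= n1 * n1 - n1 by nia.
  have h2 : 0 <= n2 * n2 - n2 by nia.
  have h3 : n1 = 0 \/ n1 = 1 by nia.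
  have h4 : n2 = 0 \/ n2 = 1 by nia.
  by case: h3 h4 eq2 e_odd => -> [] ->; lia.
subst e n1 n2.
(* [x3] has energy 1/2 only modulo [W]. The polynomial in [L0] whose roots are the other energies
   occurring in [x3] produces a vector [z] of true energy 1/2, and modulo [W] it acts on [x3] by the
   nonzero scalar [p]. *)
pose l := [seq (E2tot n)%:R / 2 | n <- iota 0 (size x3) & E2tot n != 1%N] : seq K.
pose z := pker L0 l x3.
have zE n : z`_n != 0 -> E2tot n = 1%N.
  rewrite /z coef_pker_L0; apply: contraNeq => hn; rewrite mulf_eq0.
  have [hs|hs] := ltnP n (size x3); last by rewrite [x3`_n]nth_default ?eqxx ?orbT.
  apply/orP; left; rewrite prodf_seq_eq0; apply/hasP.
  exists ((E2tot n)%:R / 2); last by rewrite subrr eqxx.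
  by apply: map_f; rewrite mem_filter hn mem_iota.
pose p := \prod_(k <- l) (1 / 2 - k).
have p0 : p != 0.
  rewrite /p prodf_seq_neq0; apply/allP => c0 /mapP[n]; rewrite mem_filter => /andP[hn _] ->.
  rewrite -mulrBl mulf_neq0 ?invr_neq0 // subr_eq0 eq_sym.
  by rewrite (eqr_nat _ _ 1).
have Uz : U z.
  by rewrite /z; elim: (l) => //= k l' IH; apply: subspaceB => //; [apply: UL | apply: subspaceZ].
have Wz : W (z - p *: x3) by apply: pker_mod.
have nWz : ~ W z.
  move=> hz; have := subspaceB sW hz Wz; rewrite opprB addrC subrK.
  by move/notW/eqP; rewrite (negbTE p0).
have WHz s : W (H s z - z).
  have h : W (H s x3 - x3) by case: s; [move: W1' | move: W2']; rewrite scale1r.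
  have := subspaceD sW (subspaceB sW (WHW s _ Wz) Wz) (subspaceZ p sW h); congr W.
  rewrite [H s (_ - _)]linearB [H s (_ *: x3)]linearZ_LR.
  by apply/polyP => j; rewrite !(coefD, coefN, coefZ); ring.
have [u0 hu0] := energy_half zE.
(* Modulo [W] both Cartan elements fix [z], so the operator in [h4] multiplies [z] by 4; the scalar
   is a quarter of the coefficient found there. *)
exists z, ((u0 q3 - 'i * u0 q2) / 2); split=> //.
(* (H true + 1) (H false + 1) maps the four states of energy 1/2 to the line of wvec. *)
have h4 : H true (H false z) + H true z + H false z + z =
    (2 * (u0 q3 - 'i * u0 q2)) *: wvec.
  rewrite hu0 /fop !Cur_psv ?Cur_vac ?psv0 ?add0r; try exact: sig_antisym; try by [].
  rewrite !Cur_psv ?Cur_vac ?psv0 ?add0r; try exact: sig_antisym; try by [].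
  rewrite /psv /wvec /psv scaler_sumr -!big_split; apply: eq_bigr => a _ /=.
  rewrite -!scalerDl scalerA; congr (_ *: _).
  rewrite !sum4; move: a; apply: I4P; rewrite !sigE !mxE /uvec /=; ring: (ii K).
have h5 : W (H true (H false z) + H true z + H false z + z - 4 *: z).
  have := subspaceD sW (subspaceD sW (WHW true _ (WHz false)) (subspaceZ 2 sW (WHz true))) (WHz false).
  congr W; rewrite [H true (_ - _)]linearB.
  by apply/polyP => j; rewrite !(coefD, coefN, coefZ); ring.
rewrite h4 in h5; have := subspaceZ (- 4^-1) sW h5; congr W.
have four0 : 4 != 0 :> K by rewrite pnatr_eq0.
by apply/polyP => j; rewrite !(coefD, coefN, coefZ); field.
Qed.

End FockIrreducible.

(** * Highest weight vectors for the diagonal copy *)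

Section DiagonalHw.
Variable K : numClosedFieldType.
Notation F := {poly K}.
Notation psi := (@psi K).
Notation B := (@B K).
Notation L := (@L K).
Notation L0 := (@L0 K).
Notation Cur := (@Cur K).
Notation sig := (@sig K).
Notation fop := (@fop K).
Implicit Types (y z p : F) (a b : 'I_4) (n m k e c : nat) (r : int) (s : bool) (t : sl2b).
Local Notation H s := (fop (s, Hb, 0)).

Notation q0 := (@Ordinal 4 0 isT).
Notation q1 := (@Ordinal 4 1 isT).
Notation q2 := (@Ordinal 4 2 isT).
Notation q3 := (@Ordinal 4 3 isT).

Let two0 : 2 != 0 :> K. Proof. by rewrite pnatr_eq0. Qed.
Let four0 : 4 != 0 :> K. Proof. by rewrite pnatr_eq0. Qed.
Let e8 : 8 != 0 :> K. Proof. by rewrite pnatr_eq0. Qed.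

Definition dop t (r : int) y : F := fop (true, t, r) y + fop (false, t, r) y.

Definition hwF n (E : K) y := [/\ Fpar true y,
  forall t r, 0 < deg (true, t, r) -> dop t r y = 0,
  dop Hb 0 y = n%:R *: y & L0 y = E *: y].

(* Only the fermions of type 0 are excited, and the energy is e/2. *)
Definition F4e e p := forall c, p`_c != 0 ->
  [/\ E2 q1 c = 0%N, E2 q2 c = 0%N, E2 q3 c = 0%N & E2 q0 c = e].

Lemma F4e_psi e p a k : F4e e p -> a != q0 -> psi a k p = 0.
Proof.
move=> hp a0; apply/polyP => c; rewrite coef_osc coef0; case: (bit _ _ =P _) => hb; last by rewrite mul0r.
apply/eqP; rewrite mulf_eq0; apply/orP; right; apply/negPn/negP => /hp[h1 h2 h3 _].
have := E2_flip a (n := c) (k := k) (b := a); rewrite hb eqxx => /(_ isT).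
have : [\/ a = q1, a = q2 | a = q3].
  by clear hb h1 h2 h3; move: a a0; apply: I4P => //; [constructor 1|constructor 2|constructor 3].
by case=> ea; subst a; lia.
Qed.

(** Fermion 0 drops out since commutators with the quaternion 1 vanish: the diagonal currents are
    those of so(3) on the fermions 1, 2, 3. *)
Lemma dop_B r y :
  [/\ 2 *: B q3 q2 r y = 'i *: dop Hb r y, 2 *: B q1 q3 r y = dop Eb r y - dop Fb r y
    & 2 *: B q2 q1 r y = 'i *: (dop Eb r y + dop Fb r y)].
Proof.
split.
- rewrite /dop scalerDr -!Cur_sig0 !Cur_q0 /sgn scale1r scaleN1r.
  by rewrite addrACA subrr add0r scaler_nat mulr2n.
- rewrite /dop opprD addrACA -!Cur_sig1 !Cur_q1 /sgn scale1r scaleN1r.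
  by rewrite addrACA subrr add0r scaler_nat mulr2n.
- rewrite /dop addrACA scalerDr -!Cur_sig2 !Cur_q2 /sgn scale1r scaleN1r.
  by rewrite addrACA subrr add0r scaler_nat mulr2n.
Qed.

Lemma B_dop r y :
  [/\ B q3 q2 r y = ('i / 2) *: dop Hb r y, B q1 q3 r y = 2^-1 *: (dop Eb r y - dop Fb r y)
    & B q2 q1 r y = ('i / 2) *: (dop Eb r y + dop Fb r y)].
Proof.
have [h1 h2 h3] := dop_B r y.
have half (X Y : F) : 2 *: X = Y -> X = 2^-1 *: Y.
  by move=> <-; rewrite scalerA mulVf // scale1r.
by split; rewrite ?(half _ _ h1) ?(half _ _ h2) ?(half _ _ h3) // scalerA mulrC.
Qed.

Lemma fop_EF s s' z : fop (s, Eb, 0) (fop (s', Fb, 0) z) =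
  fop (s', Fb, 0) (fop (s, Eb, 0) z) + (if s == s' then H s z else 0).
Proof.
rewrite fop_br; congr (_ + _); case: ifP => // _.
by rewrite scale1r (_ : 1 * _ = 0) ?scale0r ?addr0 // !mul0r mulr0.
Qed.

Lemma dop_EF y : dop Eb 0 (dop Fb 0 y) = dop Fb 0 (dop Eb 0 y) + dop Hb 0 y.
Proof.
have hE s z : fop (s, Eb, 0) (fop (true, Fb, 0) z + fop (false, Fb, 0) z) =
    fop (s, Eb, 0) (fop (true, Fb, 0) z) + fop (s, Eb, 0) (fop (false, Fb, 0) z).
  exact: linearD.
have hF s z : fop (s, Fb, 0) (fop (true, Eb, 0) z + fop (false, Eb, 0) z) =
    fop (s, Fb, 0) (fop (true, Eb, 0) z) + fop (s, Fb, 0) (fop (false, Eb, 0) z).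
  exact: linearD.
rewrite /dop !hE !hF !fop_EF eqxx !addr0.
move: (fop _ (fop _ _)) (fop _ (fop _ _)) (fop _ (fop _ _)) (fop _ (fop _ _)) => *; ring.
Qed.

Section Classify.
Variables (n : nat) (E : K) (y : F).
Hypothesis hy : hwF n E y.

Lemma cas_hw a b : a != b -> (forall k : nat, (0 < k)%N -> B a b k y = 0) ->
  2^-1 *: B a b 0 (B a b 0 y) = - (L a y + L b y).
Proof.
move=> ab h; have [N <-] := ev_ex (pair_energy y ab).
rewrite /Cas big_nat big1 ?addr0 ?mul1r // => k /andP[k0 _].
by rewrite h // linear0.
Qed.

Lemma hw_B k : (0 < k)%N -> [/\ B q3 q2 k y = 0, B q1 q3 k y = 0 & B q2 q1 k y = 0].
Proof.
case: hy => _ hpos _ _ k0; have [-> -> ->] := B_dop k y.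
by rewrite !hpos ?subrr ?addr0 ?scaler0 //; rewrite /deg /=; lia.
Qed.

Lemma hw_L23 : L q3 y + L q2 y = (n%:R ^+ 2 / 8) *: y.
Proof.
case: hy => _ _ hH _; have := @cas_hw q3 q2 isT; move=> /(_ (fun k hk => let: And3 h _ _ := @hw_B k hk in h)).
have [h _ _] := B_dop 0 y; have [h' _ _] := B_dop 0 (dop Hb 0 y).
rewrite h [B _ _ _ (_ *: _)]linearZ_LR h' hH /=.
have -> : dop Hb 0 (n%:R *: y) = n%:R *: (n%:R *: y).
  by rewrite /dop ![fop _ (_ *: _)]linearZ_LR -scalerDr -/(dop Hb 0 y) hH.
move/eqP; rewrite -eqr_oppLR => /eqP <-; rewrite !scalerA -scaleNr; congr (_ *: _).
by field: (ii K).
Qed.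

(** The squares of the remaining two currents combine to a multiple of e f + f e, which on a highest
    weight vector is h. *)
Lemma hw_L123 : (L q1 y + L q3 y) + (L q2 y + L q1 y) = (n%:R / 4) *: y.
Proof.
case: hy => _ hpos hH _.
have h1 : _ := @cas_hw q1 q3 isT (fun k hk => let: And3 _ h _ := @hw_B k hk in h).
have h2 := @cas_hw q2 q1 isT (fun k hk => let: And3 _ _ h := @hw_B k hk in h).
have [_ b1 b2] := B_dop 0 y.
have hE : dop Eb 0 y = 0 by apply: hpos.
move: b1 b2; rewrite hE sub0r add0r => b1 b2.
have [_ c1 c2] := B_dop 0 (dop Fb 0 y).
have hEF : dop Eb 0 (dop Fb 0 y) = n%:R *: y.
  by rewrite dop_EF hE hH /dop !linear0 !add0r.
apply/eqP; rewrite -[_ + _]opprK opprD -h1 -h2 eqr_oppLR b1 b2.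
rewrite [B _ _ _ (_ *: _)]linearZ_LR [X in _ + _ *: X](_ : _ = ('i / 2) *: B q2 q1 0 (dop Fb 0 y)); last first.
  by rewrite [B _ _ _ (_ *: _)]linearZ_LR.
rewrite linearN c1 c2 hEF; apply/eqP/polyP => j; rewrite !(coefD, coefN, coefZ).
by field: (ii K).
Qed.

Lemma hw_coef c : y`_c != 0 -> (4 * (E2 q2 c + E2 q3 c) = n * n)%N /\
  (8 * E2 q1 c + n * n = 2 * n)%N.
Proof.
move=> yc; have := congr1 (fun p => p`_c) hw_L23; have := congr1 (fun p => p`_c) hw_L123.
rewrite /= !coefD !coefZ !coef_L -!mulrDl => /(mulIf yc) h2 /(mulIf yc) h1.
have e1 : (4 * (E2 q2 c + E2 q3 c) = n * n)%N.
  apply/eqP; rewrite -(eqr_nat K) !natrM !natrD; apply/eqP.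
  rewrite -[RHS](divfK e8) -expr2 -h1; by field.
split=> //; apply/eqP; rewrite -(eqr_nat K) natrD -e1 !natrM !natrD; apply/eqP.
transitivity (8 * (n%:R / 4) : K); [by rewrite -h2; field | by field].
Qed.

(** Since [E2 q1] is nonnegative, n^2 <= 2 n; and n = 1 is excluded because 4 would divide n^2. *)
Lemma hw_cases : y != 0 -> (n == 0%N) || (n == 2).
Proof.
move=> y0; have [c hc] : exists c, y`_c != 0.
  by exists (size y).-1; rewrite -lead_coefE lead_coef_eq0.
have [h1 h2] := hw_coef hc; have h3 : (n <= 2)%N by nia.
by move: h1 h3; case: (n) => [|[|[|]]] //; lia.
Qed.

End Classify.

Lemma E2tot4 c : E2tot c = (E2 q0 c + E2 q1 c + E2 q2 c + E2 q3 c)%N.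
Proof. exact: sum4. Qed.

Lemma E2_bit a k c : bit (4 * k + a) c -> (k.*2.+1 <= E2 a c)%N.
Proof.
move=> hb; have := E2_flip a (n := flip (4 * k + a) c) (k := k) (b := a).
by rewrite flipK bit_flip eqxx hb => /(_ isT) ->; rewrite eqxx leq_addl.
Qed.

Lemma psi_number a k y c :
  (psi a (Negz k) (psi a k y))`_c = if bit (4 * k + a) c then y`_c else 0.
Proof.
rewrite !coef_osc flipK bit_flip eqxx addbT sg_flip ltnn mul1r.
by case: bit => /=; rewrite ?mul0r // mulrA sgM mul1r.
Qed.

Lemma E2_eq1 a c : E2 a c = 1%N -> bit (4 * 0 + a) c.
Proof.
move=> h; have : E2 a c != 0%N by rewrite h.
rewrite bsum_eq0 negb_forall => /existsP[j]; rewrite negb_imply => /andP[hb].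
case: ifP => // /eqP hi _; have := bsum_ge (fun i => if i %% 4 == a :> nat then (i %/ 4).*2.+1 else 0)%N hb.
rewrite -/(E2 a c) h hi eqxx => hk.
have i4 : (j %/ 4 = 0)%N by lia.
by rewrite muln0 add0n -hi; move: hb; rewrite {1}(divn_eq j 4) i4 mul0n add0n.
Qed.

Lemma F4e_L e p : F4e e p -> L0 p = (e%:R / 2) *: p.
Proof.
move=> hp; apply/polyP => c; rewrite coef_L0 coefZ; have [->|pc] := eqVneq p`_c 0.
  by rewrite !mulr0.
by have [h1 h2 h3 h4] := hp c pc; rewrite E2tot4 h1 h2 h3 h4 !addn0.
Qed.

Lemma F4e_par e p : F4e e p -> Fpar (odd e) p.
Proof. by move=> hp c /hp[h1 h2 h3 h4]; rewrite E2tot4 h1 h2 h3 h4 !addn0. Qed.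

Lemma F4e_B e p a b k : F4e e p -> a != q0 -> b != q0 -> B a b k p = 0.
Proof.
move=> hp a0 b0; have [->|ab] := eqVneq a b; first by rewrite Baa.
have [N ->] := ev_ex (B_ev k p ab); apply: isum0 => i _.
set m := _ + _; have [m0|m0] := leP 0 m.
  by rewrite /T; case: m m0 => // m _; rewrite (F4e_psi _ hp) // linear0.
rewrite T_swap //; have : 0 <= k%:Z - m - 1 by lia.
by case: (_ - _ - _) => // m' _; rewrite (F4e_psi _ hp) // linear0 oppr0.
Qed.

Lemma F4e_dop e p t k : F4e e p -> dop t k p = 0.
Proof.
move=> hp; have [h1 h2 h3] := dop_B k p.
rewrite !(F4e_B _ hp) // !scaler0 in h1 h2 h3.
have i0 : 'i != 0 :> K by exact: neq0Ci.
have hi X : 0 = 'i *: X :> F -> X = 0.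
  by move/esym/eqP; rewrite scaler_eq0 (negbTE i0) => /eqP.
move/hi: h1 => h1; move/hi: h3 => h3; case: t => //.
  by apply: (scalerI two0); rewrite scaler0 scaler_nat mulr2n -[RHS]addr0 {1}h2 -h3; ring.
by apply: (scalerI two0); rewrite scaler0 scaler_nat mulr2n -[RHS]subr0 -{1}h3 h2; ring.
Qed.

Lemma hw0_F4e e p : odd e -> F4e e p -> hwF 0 (e%:R / 2) p.
Proof.
move=> he hp; split; [by rewrite -he; apply: F4e_par | | | exact: F4e_L].
  move=> t [k|k] hk; first exact: F4e_dop hp.
  by case: t hk; rewrite /deg /=; lia.
by rewrite (F4e_dop Hb 0 hp) scale0r.
Qed.

Lemma F4e_hw0 e y : hwF 0 (e%:R / 2) y -> F4e e y.
Proof.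
move=> hy c yc; have [h1 h2] := hw_coef hy yc.
have h3 : E2tot c = e.
  case: hy => _ _ _ /(congr1 (fun p => p`_c)); rewrite coef_L0 coefZ => /(mulIf yc) h.
  by apply/eqP; rewrite -(eqr_nat K); apply/eqP; apply: (mulIf (invr_neq0 two0)).
by move: h3; rewrite E2tot4; split; lia.
Qed.

Lemma hw_energy n E y : hwF n E y -> y != 0 -> exists2 e, E = e%:R / 2 & odd e.
Proof.
move=> [hp _ _ hL] y0; have yc : y`_(size y).-1 != 0 by rewrite -lead_coefE lead_coef_eq0.
exists (E2tot (size y).-1); last exact: hp.
by have := congr1 (fun p => p`_(size y).-1) hL; rewrite coef_L0 coefZ => /(mulIf yc) ->.
Qed.

Definition raise p := psv (uvec K true true) (Negz 0) p.

Lemma raiseE p : raise p = 'i *: psi q2 (Negz 0) p + psi q3 (Negz 0) p.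
Proof. by rewrite /raise /psv sum4 /uvec /= !scale0r !add0r scale1r. Qed.

(** A linear left inverse of [raise] on these states; it allows the weight 2 vectors to be counted
    through states of fermion 0. *)
Lemma raiseK e p : F4e e p -> psi q3 0 (raise p) = p.
Proof.
move=> hp; rewrite raiseE [psi _ _ (_ + _)]linearD [psi _ _ (_ *: _)]linearZ_LR.
rewrite [psi q3 _ (psi q2 _ _)]psi_swap [psi q3 _ (psi q3 _ _)]psi_swap.
by rewrite (F4e_psi 0 hp) // !linear0 !addr0 /= scale0r scaler0 add0r scale1r.
Qed.

Lemma fop_psv s t (r' : int) u r p : fop (s, t, r') (psv u r p) =
  psv u r (fop (s, t, r') p) + psv (fun a => \sum_b sig s t a b * u b) (r' + r) p.
Proof. by rewrite /fop Cur_psv //; apply: sig_antisym. Qed.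

(** The diagonal copy kills [p], so only its commutator with the added fermion matters. That fermion
    has weight 1 for both copies; for a positive operator the matrix kills its vector, or the
    resulting mode annihilates [p]. *)
Lemma dop_raise t k e p : F4e e p ->
  dop t k (raise p) = if (0 < deg (true, t, k%:Z)) then 0 else
    if t is Hb then 2 *: raise p else dop t k (raise p).
Proof.
move=> hp; case: ifP => hd.
  rewrite /dop /raise !fop_psv addrACA.
  have -> : psv (uvec K true true) (Negz 0) (fop (true, t, k%:Z) p) +
     psv (uvec K true true) (Negz 0) (fop (false, t, k%:Z) p) = 0.
    by rewrite -psvD -/(dop t k p) (F4e_dop t k hp) psv0.
  rewrite add0r /psv -big_split big1 // => a _ /=; rewrite -scalerDl.
  case: k hd => [|k] hd; last first.
    have [->|a0] := eqVneq a q0; last by rewrite (_ : k.+1%:Z + Negz 0 = k) ?(F4e_psi _ hp) ?scaler0 //; lia.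
    rewrite (_ : _ + _ = 0) ?scale0r //.
    by case: t hd => _; rewrite !sum4 !sigE !mxE /uvec /=; ring: (ii K).
  case: t hd => // _; rewrite (_ : _ + _ = 0) ?scale0r // !sum4 !sigE; move: a.
  by apply: I4P; rewrite !mxE /uvec /=; field: (ii K).
case: t hd => // hd; have k0 : k = 0%N by move: hd; rewrite /deg /=; lia.
subst k; rewrite /dop !H_uvec addrACA -psvD -/(dop Hb 0 p) (F4e_dop Hb 0 hp) psv0 add0r.
by rewrite /wt /= -scalerDl.
Qed.

Lemma hw2_F4e e p : ~~ odd e -> F4e e p -> hwF 2 (e.+1%:R / 2) (raise p).
Proof.
move=> he hp; split.
- rewrite /raise /psv; apply: subspace_sum => [|a _]; first exact: Fpar_subspace.
  apply: (subspaceZ _ (Fpar_subspace _ true)).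
  by apply: (@Fpar_psi _ false); rewrite -(negbTE he); apply: F4e_par.
- move=> t [k|k] hk; first by rewrite (dop_raise _ _ hp) hk.
  by case: t hk; rewrite /deg /=; lia.
- by rewrite (dop_raise Hb 0 hp).
rewrite /raise L0_psv (F4e_L hp) psvZ -scalerBl; congr (_ *: _).
by rewrite -natr1 NegzE mulrNz /=; field.
Qed.

(** Exactly one of the energy 1/2 modes of types 2 and 3 is occupied, so [y] is created from a [y2]
    and a [y3] without them. The weight equation for [B q3 q2 0] then forces [y2] = 'i [y3]. *)
Lemma F4e_hw2 e y : hwF 2 (e.+1%:R / 2) y -> exists2 p, F4e e p & y = raise p.
Proof.
move=> hy.
have hc c : y`_c != 0 -> [/\ E2 q1 c = 0%N, (E2 q2 c + E2 q3 c = 1)%N & E2 q0 c = e].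
  move=> yc; have [h1 h2] := hw_coef hy yc.
  have h3 : E2tot c = e.+1.
    case: hy => _ _ _ /(congr1 (fun p => p`_c)); rewrite coef_L0 coefZ => /(mulIf yc) h.
    by apply/eqP; rewrite -(eqr_nat K); apply/eqP; apply: (mulIf (invr_neq0 two0)).
  by move: h3; rewrite E2tot4; split; lia.
have hF a : a = q2 \/ a = q3 -> F4e e (psi a 0 y).
  move=> ha c; rewrite coef_osc; case: (bit _ _ =P _) => hb; last by rewrite mul0r eqxx.
  rewrite mulf_eq0 negb_or => /andP[_ /hc[h1 h2 h3]].
  have E2f a' := @E2_flip a' a 0 c (introT negPf hb).
  move: h1 h2 h3; rewrite !E2f; case: ha => ->; rewrite /=; split; lia.
have hy23 : y = psi q2 (Negz 0) (psi q2 0 y) + psi q3 (Negz 0) (psi q3 0 y).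
  apply/polyP => c; rewrite coefD !psi_number.
  have [->|yc] := eqVneq y`_c 0; first by rewrite !if_same addr0.
  have [_ h2 _] := hc c yc.
  have hb0 a : E2 a c = 0%N -> bit (4 * 0 + a) c = false.
    by move=> ha; apply/negbTE/negP => /E2_bit; rewrite ha.
  have [h|h] : (E2 q2 c = 1%N /\ E2 q3 c = 0%N) \/ (E2 q2 c = 0%N /\ E2 q3 c = 1%N) by lia.
    by rewrite (E2_eq1 h.1) (hb0 _ h.2) addr0.
  by rewrite (E2_eq1 h.2) (hb0 _ h.1) add0r.
have F2 := hF q2 (or_introl erefl); have F3 := hF q3 (or_intror erefl).
move: hy23; set y2 := psi q2 0 y in F2 *; set y3 := psi q3 0 y in F3 *; move=> hy23.
have h : B q3 q2 0 y = 'i *: y.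
  have [h _ _] := dop_B 0 y; case: hy => _ _ hH _.
  by apply: (scalerI two0); rewrite h hH scalerA [in RHS]scalerA mulrC.
have q32 : q3 != q2 by [].
rewrite [in LHS]hy23 [B _ _ _ (_ + _)]linearD (B_psi_b q32) (B_psi_a q32) in h.
rewrite (F4e_B 0 F2) // (F4e_B 0 F3) // !linear0 !add0r in h.
have ph z : F4e e z -> psi q3 0 (psi q3 (Negz 0) z) = z /\ psi q3 0 (psi q2 (Negz 0) z) = 0.
  move=> hz; rewrite !(psi_swap q3 0) (F4e_psi 0 hz) // !linear0 !addr0.
  by split; [apply: scale1r | apply: scale0r].
have := congr1 (psi q3 0) h; rewrite [in RHS]hy23.
rewrite [psi _ _ (_ - _)]linearB [psi _ _ ('i *: _)]linearZ_LR [psi q3 0 (_ + _)]linearD.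
rewrite (ph _ F2).1 (ph _ F2).2 (ph _ F3).1 (ph _ F3).2 subr0 add0r => y23.
exists y3 => //; rewrite {1}hy23 y23 raiseE; congr (_ + _); exact: linearZ_LR.
Qed.

End DiagonalHw.

(** * Highest weight modules and their tensor square *)

Section Submodule.
Variables (K : fieldType) (V : lmodType K) (P : V -> Prop).

Definition sub_pred (sP : subspace P) : pred V := fun v => `[< P v >].

Lemma sub_pred_closed (sP : subspace P) : submod_closed (sub_pred sP).
Proof.
case: (sP) => P0 PL; split=> [|c u v /asboolP hu /asboolP hv]; apply/asboolP => //.
exact: PL.
Qed.
HB.instance Definition _ (sP : subspace P) :=
  GRing.isSubmodClosed.Build K V (sub_pred sP) (sub_pred_closed sP).

(** A subspace as a module in its own right, so that it can be the target in the universal property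
    of a tensor product. *)
Record submod (sP : subspace P) := SubMod { submod_val :> V; _ : submod_val \in sub_pred sP }.
HB.instance Definition _ (sP : subspace P) := [isSub for @submod_val sP].
HB.instance Definition _ (sP : subspace P) := [Choice of submod sP by <:].
HB.instance Definition _ (sP : subspace P) := [SubChoice_isSubLmodule of submod sP by <:].
End Submodule.

Section GhatModules.
Variable R : realType.
Local Notation C := (complex R).
Implicit Types (M N T : ghat_module R).

Definition sl2_of (t : sl2b) : sl2 R :=
  match t with Eb => sl2_e R | Fb => sl2_f R | Hb => sl2_h R end.

Definition gx t n : ghat R := cur_hat (sl2_of t) n.

Lemma mx2P (A B : 'M[C]_2) : A 0 0 = B 0 0 -> A 0 1 = B 0 1 -> A 1 0 = B 1 0 ->
  A 1 1 = B 1 1 -> A = B.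
Proof.
move=> h00 h01 h10 h11; apply/matrixP => i j.
have e (k : 'I_2) : k = 0 \/ k = 1.
  by case: k => [[|[|//]] hk]; [left | right]; apply: val_inj.
by case: (e i) (e j) => -> [] ->.
Qed.

Lemma sl2_of_br t t' : sl2_bracket (sl2_of t) (sl2_of t') =
  (br_c t t')%:~R *: sl2_of (br_t t t').
Proof.
apply: val_inj; rewrite linearZ /=.
by apply: mx2P; case: t t' => [] []; rewrite /= !mxE !big_ord_recl !big_ord0 /= !mxE
  ?big_ord_recl ?big_ord0 /= ?mxE /= ; ring.
Qed.

Lemma sl2_of_form t t' : sl2_form (sl2_of t) (sl2_of t') = (br_f t t')%:~R.
Proof.
rewrite /sl2_form /mxtrace !big_ord_recl big_ord0 /=.
by case: t t' => [] []; rewrite /= !mxE !big_ord_recl !big_ord0 /= !mxE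
  ?big_ord_recl ?big_ord0 /= ?mxE /= ; ring.
Qed.

Lemma sl2_decomp (x : sl2 R) : x = sl2_mx x 0 1 *: sl2_of Eb + sl2_mx x 1 0 *: sl2_of Fb
  + sl2_mx x 0 0 *: sl2_of Hb.
Proof.
have htr : sl2_mx x 1 1 = - sl2_mx x 0 0.
  case: x => m hm /=; move: hm; rewrite unfold_in /mxtrace !big_ord_recl big_ord0 addr0 /=.
  rewrite (_ : lift ord0 ord0 = 1); last by apply: val_inj.
  by rewrite addrC addr_eq0 => /eqP.
apply: val_inj; rewrite !linearD !linearZ /=.
apply: mx2P; rewrite /= !mxE !big_ord_recl !big_ord0 /= ?mxE /= ?htr; ring.
Qed.

Lemma cur_lin n : linear (fun x : sl2 R => cur_hat x n).
Proof.
move=> c x y; rewrite /cur_hat; congr (_, _, _); rewrite /= ?scaler0 ?addr0 //; try by rewrite /= scaler0.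
apply: val_inj; apply/funext => k.
rewrite -[RHS]/(c *: (cur x n k) + cur y n k) /=.
by case: ifP => _; rewrite ?scaler0 ?addr0.
Qed.

HB.instance Definition _ M x := GRing.isLinear.Build C M M *:%R (@ghat_act R M x)
  (@ghat_act_linearr R M x).

Definition gact M (x : ghat R) : {linear M -> M} := @ghat_act R M x.

Lemma actx M (v : M) : linear (fun x => ghat_act x v).
Proof. exact: ghat_act_linearl. Qed.

Definition actl M (v : M) : {linear ghat R -> M} := mklin (actx v).

Lemma actD M x y (v : M) : ghat_act (x + y) v = ghat_act x v + ghat_act y v.
Proof. exact: (linearD (actl v)). Qed.

Lemma actZ M c x (v : M) : ghat_act (c *: x) v = c *: ghat_act x v.
Proof. exact: (linearZ_LR (actl v)). Qed.

Lemma act0 M (v : M) : ghat_act 0 v = 0.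
Proof. exact: (linear0 (actl v)). Qed.

Lemma ractD M x (u v : M) : ghat_act x (u + v) = ghat_act x u + ghat_act x v.
Proof. exact: (linearD (gact M x)). Qed.

Lemma ractZ M x c (v : M) : ghat_act x (c *: v) = c *: ghat_act x v.
Proof. exact: (linearZ_LR (gact M x)). Qed.

Lemma cur_hatZ c (x : sl2 R) n : cur_hat (c *: x) n = c *: cur_hat x n.
Proof. exact: (linearZ_LR (mklin (cur_lin n))). Qed.

Lemma act_br M x y (v : M) :
  ghat_act x (ghat_act y v) = ghat_act y (ghat_act x v) + ghat_act (bracket x y) v.
Proof. by rewrite ghat_act_bracket addrC subrK. Qed.

Lemma act_gx M t m t' n (v : M) : ghat_act (gx t m) (ghat_act (gx t' n) v) =
  ghat_act (gx t' n) (ghat_act (gx t m) v) + ((br_c t t')%:~R *: ghat_act (gx (br_t t t') (m + n)) v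
   + (m%:~R * (m + n == 0)%:R * (br_f t t')%:~R) *: ghat_act (c_hat R) v).
Proof.
rewrite act_br bracket_cur sl2_of_br sl2_of_form; congr (_ + _).
by rewrite actD cur_hatZ !actZ addr_eq0.
Qed.

(* The principal grading element. *)
Definition Dg : ghat R := 2 *: d_hat R + 2^-1 *: gx Hb 0.

Lemma act_Dg M (v : M) : ghat_act Dg v = 2 *: ghat_act (d_hat R) v + 2^-1 *: ghat_act (gx Hb 0) v.
Proof. by rewrite actD !actZ. Qed.

Lemma Dg_gx M t n (v : M) : ghat_act Dg (ghat_act (gx t n) v) =
  ghat_act (gx t n) (ghat_act Dg v) + (2 * n + degb t)%:~R *: ghat_act (gx t n) v.
Proof.
rewrite !act_Dg act_gx act_br bracket_d mul0r mul0r scale0r addr0 add0r.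
rewrite ractD !ractZ actZ !scalerDr !scalerA addrACA; congr (_ + _).
rewrite intrD intrM scalerDl; congr (_ + _).
by case: t; congr (_ *: _); rewrite /=; field.
Qed.

End GhatModules.

Section IrreducibleModules.
Variable R : realType.
Local Notation C := (complex R).
Implicit Types (M N T : ghat_module R).

Lemma loop_sum_coef (I : Type) (s : seq I) (f : I -> loop R) k :
  (\sum_(i <- s) f i) k = \sum_(i <- s) f i k.
Proof.
elim: s => [|i s IH]; first by rewrite !big_nil.
by rewrite !big_cons -IH.
Qed.

Lemma loop_decomp (l : loop R) : exists s : seq int, l = \sum_(n <- s) cur (l n) n.
Proof.
have /finite_seqP[s hs] := loop_finite l; exists (undup s).
apply: val_inj; apply/funext => k; rewrite [RHS]loop_sum_coef /=.
have [ks|ks] := boolP (k \in undup s).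
  rewrite (bigD1_seq k) ?undup_uniq //= eqxx big1 ?addr0 // => n nk.
  by rewrite eq_sym (negbTE nk).
rewrite big1_seq => [|n /= ns]; last first.
  by case: eqP => // kn; rewrite kn ns in ks.
apply/eqP/negPn/negP => lk; have : fsupp l k by [].
by rewrite hs /= => ks'; rewrite mem_undup ks' in ks.
Qed.

Lemma ghat_ind (U : ghat R -> Prop) : subspace U -> U (c_hat R) -> U (d_hat R) ->
  (forall t n, U (gx R t n)) -> forall x, U x.
Proof.
move=> sU Uc Ud Ux [[l a] b].
have -> : ((l, a, b) : ghat R) = ((l, 0, 0) : ghat R) + (a *: c_hat R + b *: d_hat R).
  have mul1 (d : C) : d *: (1 : C^o) = d by exact: mulr1.
  congr (_, _, _); rewrite /= !scaler0; first by rewrite !addr0.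
    by rewrite mul1 addr0 add0r.
  by rewrite mul1 !add0r.
apply: subspaceD => //; last by apply: subspaceD => //; apply: subspaceZ.
have sl : subspace (fun l : loop R => U (l, 0, 0)).
  case: (sU) => U0 UL; split=> // c x y hx hy.
  have := UL c _ _ hx hy; congr U; apply/eqP; rewrite !xpair_eqE /= eqxx /=.
  by rewrite !scaler0 !addr0 !eqxx.
have [s ->] := loop_decomp l; apply: (@subspace_sum _ _ (fun l : loop R => U (l, 0, 0)) _ s xpredT _ sl) => n _.
rewrite -/(cur_hat _ _) (sl2_decomp (l n)).
set u := mklin (cur_lin (R := R) n); rewrite -[cur_hat _ _]/(u _) !linearD !linearZ_LR.
apply: subspaceD => //; last by apply: subspaceZ => //; apply: (Ux Hb).
by apply: subspaceD => //; apply: subspaceZ => //; [apply: (Ux Eb) | apply: (Ux Fb)].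
Qed.

Lemma submodule_of_gen M (U : M -> Prop) : subspace U ->
  (forall t n v, U v -> U (ghat_act (gx R t n) v)) ->
  (forall v, U v -> U (ghat_act (c_hat R) v)) ->
  (forall v, U v -> U (ghat_act (d_hat R) v)) -> is_submodule U.
Proof.
move=> sU Ux Uc Ud; split; [by case: sU | by case: sU |].
move=> x v Uv; move: x; apply: ghat_ind; [|exact: Uc|exact: Ud|by move=> t n; apply: Ux].
exact: (subspace_preim (actl v) sU).
Qed.

Section ModuleRep.
Variables (M : ghat_module R) (l : C).
Hypothesis hc : forall v : M, ghat_act (c_hat R) v = l *: v.

Lemma mrep_br (s : unit) t m (s' : unit) t' n (v : M) :
  gact M (gx R t m) (gact M (gx R t' n) v) = gact M (gx R t' n) (gact M (gx R t m) v)
  + (if s == s' then (br_c t t')%:~R *: gact M (gx R (br_t t t') (m + n)) v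
       + (l * (m%:~R * (m + n == 0)%:R * (br_f t t')%:~R)) *: v else 0).
Proof. by case: s s' => [] []; rewrite eqxx /gact /= act_gx hc scalerA [l * _]mulrC. Qed.

Definition mrep : rep unit M l :=
  @Rep C unit M l (fun x : op unit => gact M (gx R x.1.2 x.2)) (gact M (Dg R)) mrep_br
   (fun x v => Dg_gx x.1.2 x.2 v).
End ModuleRep.

Section HighestWeight.
Variables (L : weight R) (M : ghat_module R) (v0 : M).
Hypothesis hM : is_V L M.
Hypothesis hv0 : highest_weight_vector L v0.

Let v0_neq0 : v0 <> 0. Proof. by case: hv0. Qed.

Lemma weight_c (v : M) : weight_vector L v -> ghat_act (c_hat R) v = L.1.2 *: v.
Proof.
move=> /(_ (0, 1, 0)); rewrite /weight_eval /= !mulr0 add0r mulr1 addr0 => <-.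
by congr (ghat_act _ v); congr (_, _, _); rewrite /= scale0r.
Qed.

Lemma weight_d (v : M) : weight_vector L v -> ghat_act (d_hat R) v = L.2 *: v.
Proof.
move=> /(_ (0, 0, 1)); rewrite /weight_eval /= !mulr0 !add0r mulr1 => <-.
by congr (ghat_act _ v); congr (_, _, _); rewrite /= scale0r.
Qed.

Lemma weight_h (v : M) : weight_vector L v -> ghat_act (gx R Hb 0) v = L.1.1 *: v.
Proof.
move=> /(_ (1, 0, 0)); rewrite /weight_eval /= !mulr0 !addr0 mulr1 => <-.
by congr (ghat_act _ v); congr (_, _, _); rewrite /= scale1r.
Qed.

Lemma V_submodule (U : M -> Prop) : is_submodule U -> (forall v, U v -> v = 0) \/ (forall v, U v).
Proof.
by move=> hU; case: hM => [[_ /(_ _ hU)[]] h _ _]; [left=> v | right=> v]; rewrite h.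
Qed.

Lemma V_generated (U : M -> Prop) : is_submodule U -> U v0 -> forall v, U v.
Proof. by move=> /V_submodule[h /h|//]. Qed.

(** The eigenspace of the central element is a submodule that contains [v0]. *)
Lemma V_c (v : M) : ghat_act (c_hat R) v = L.1.2 *: v.
Proof.
move: v; apply: V_generated; last by apply: weight_c; case: hv0.
split.
- by rewrite scaler0; apply: (linear0 (gact M (c_hat R))).
- by move=> a u v hu hv; rewrite ractD ractZ hu hv scalerDr !scalerA mulrC.
- by move=> x v hv; rewrite act_br hv ractZ (bracket_c x).1 act0 addr0.
Qed.

Definition Vrep := mrep V_c.

Lemma V_irr (U : M -> Prop) : subspace U -> (forall x u, U u -> U (Vrep x u)) ->
  (forall u, U u -> U (rD Vrep u)) -> (forall u, U u -> u = 0) \/ (forall u, U u).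
Proof.
move=> sU Ux UD; apply: V_submodule; apply: submodule_of_gen => //.
- by move=> t n v; apply: (Ux (tt, t, n)).
- by move=> v; rewrite V_c; apply: subspaceZ.
(* The operators of [Vrep] do not include d, which is recovered from the principal grading element
   and h. *)
move=> v Uv; have -> : ghat_act (d_hat R) v =
    2^-1 *: (rD Vrep v - 2^-1 *: Vrep (tt, Hb, 0) v).
  by rewrite /= /gact act_Dg addrK scalerA mulVf ?scale1r ?pnatr_eq0.
apply: subspaceZ => //; apply: subspaceB => //; first exact: UD.
by apply: subspaceZ => //; apply: Ux.
Qed.

Definition top_degree : C := 2 * L.2 + 2^-1 * L.1.1.

Lemma v0_D : rD Vrep v0 = top_degree *: v0.
Proof.
case: hv0 => _ hw _; rewrite /= /gact act_Dg weight_d // weight_h // !scalerA -scalerDl //.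
Qed.

Lemma gx_nplus t n : 0 < deg (tt, t, n) -> nplus (gx R t n).
Proof.
rewrite /deg /=; move=> hd; split=> //=.
- move=> k k0; case: eqP => // kn; move: hd; rewrite -kn; case: t => /=; lia.
- case: t hd => /= hd; case: eqP => [n0|_]; try by (exists 0; rewrite scale0r).
  + by exists 1; rewrite scale1r.
  + by move: hd; rewrite -n0.
  + by move: hd; rewrite -n0.
Qed.

Lemma v0_pos x : 0 < deg x -> Vrep x v0 = 0.
Proof. by case: x => [[[] t] n] hd; case: hv0 => _ _; apply; apply: gx_nplus. Qed.

Lemma v0_h s : line v0 (Vrep (s, Hb, 0) v0).
Proof. by exists L.1.1; case: hv0 => _ hw _; apply: weight_h. Qed.

Lemma V_hw (u : M) : (forall t n, 0 < deg (tt, t, n) -> ghat_act (gx R t n) u = 0) -> line v0 u.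
Proof.
move=> hu; apply: (irr_hw V_irr v0_neq0 v0_D v0_pos v0_h).
by move=> [[[] t] n] hd; apply: hu.
Qed.

Lemma V_raise (I : finType) (U : (I -> M) -> Prop) (u : I -> M) :
  (forall t n w, U w -> U (fun i => ghat_act (gx R t n) (w i))) ->
  U u -> ~ (forall i, u i = 0) ->
  exists d : I -> C, U (fun i => d i *: v0) /\ ~ (forall i, d i = 0).
Proof.
move=> hU; apply: (irr_raise V_irr v0_neq0 v0_D v0_pos v0_h).
by move=> [[s t] n] w _; apply: hU.
Qed.

Lemma V_top (v : M) : exists d, spec (below (top_degree - 1)) (gact M (Dg R)) (v - d *: v0).
Proof. exact: (irr_top V_irr v0_neq0 v0_D v0_pos v0_h v). Qed.

Lemma V_ind (U : M -> Prop) : subspace U -> U v0 ->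
  (forall t n u, U u -> U (ghat_act (gx R t n) u)) -> forall u, U u.
Proof.
move=> sU U0 Ux u.
elim: (irr_gen V_irr v0_neq0 v0_D v0_pos v0_h u) => [_ [d ->]|d v w _ Uv _ Uw|].
- exact: subspaceZ.
- by case: sU => _; apply.
- by move=> [[s t] n] v _ _; apply: Ux.
Qed.

(** The coefficient of [v0], well defined because no nonzero multiple of [v0] lies in the lower
    generalized eigenspaces. It detects that [tau v0 v0] is nonzero. *)
Lemma top_functional : exists2 f : {linear M -> C^o}, f v0 = 1 &
  forall v, spec (below (top_degree - 1)) (gact M (Dg R)) (v - (f v : C) *: v0).
Proof.
have sB := spec_subspace (below (top_degree - 1)) (gact M (Dg R)).
have /choice[f hf] := V_top.
have uniq (d : C) : spec (below (top_degree - 1)) (gact M (Dg R)) (d *: v0) -> d = 0.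
  move=> hd; have [//|d0] := eqVneq d 0; case: v0_neq0.
  apply: (top_low (a := Vrep) v0_D).
  by have := subspaceZ d^-1 sB hd; rewrite scalerA mulVf // scale1r.
have lf : linear (f : M -> C^o).
  move=> c u v; apply/eqP; rewrite -subr_eq0; apply/eqP; apply: uniq.
  have := subspaceB sB (subspaceD sB (subspaceZ c sB (hf u)) (hf v)) (hf (c *: u + v)).
  congr (spec _ _); rewrite scalerBr scalerA addrACA -opprD -scalerDl opprB.
  by rewrite [LHS]addrC addrA subrK -scalerBl.
exists (mklin lf) => //=; apply/eqP; rewrite -subr_eq0 -oppr_eq0 opprB; apply/eqP; apply: uniq.
by rewrite scalerBl scale1r.
Qed.

End HighestWeight.
End IrreducibleModules.

(** * The tensor square with its two commuting actions *)

Section Tensor.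
Variable R : realType.
Local Notation C := (complex R).
Variables (M T : ghat_module R) (tau : M -> M -> T).
Hypothesis hT : is_tensor tau.

Lemma tensor_Dl u u' v : tau (u + u') v = tau u v + tau u' v.
Proof. by case: hT => [[hl _] _ _]; exact: (linearD (mklin (hl v))). Qed.

Lemma tensor_Dr u v v' : tau u (v + v') = tau u v + tau u v'.
Proof. by case: hT => [[_ hr] _ _]; exact: (linearD (mklin (hr u))). Qed.

Lemma tensor_Zl c u v : tau (c *: u) v = c *: tau u v.
Proof. by case: hT => [[hl _] _ _]; exact: (linearZ_LR (mklin (hl v))). Qed.

Lemma tensor_Zr c u v : tau u (c *: v) = c *: tau u v.
Proof. by case: hT => [[_ hr] _ _]; exact: (linearZ_LR (mklin (hr u))). Qed.

Lemma tensor_0l v : tau 0 v = 0.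
Proof. by rewrite -(scale0r 0) tensor_Zl scale0r. Qed.

Lemma tensor_sumr u (I : Type) (s : seq I) (f : I -> M) :
  tau u (\sum_(i <- s) f i) = \sum_(i <- s) tau u (f i).
Proof. by case: hT => [[_ hr] _ _]; exact: (linear_sum (mklin (hr u))). Qed.

(** [tau] corestricts to the subspace [P]. The induced map followed by the inclusion agrees with the
    identity on all [tau u v], hence everywhere by uniqueness. *)
Lemma tensor_ind (P : T -> Prop) : subspace P -> (forall u v, P (tau u v)) -> forall t, P t.
Proof.
move=> sP Pt t.
have memP u v : tau u v \in sub_pred sP by apply/asboolP.
pose b u v : submod sP := SubMod (memP u v).
have hb : is_bilinear b.
  by split=> w c u v; apply: val_inj; rewrite linearP /= ?tensor_Dl ?tensor_Dr
    ?tensor_Zl ?tensor_Zr.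
have [_ hT2 _] := hT; have [[g hg] _] := hT2 _ b hb.
have [_ hu] := hT2 _ tau (let: And3 h _ _ := hT in h).
have -> : t = val (g t).
  by apply: (hu idfun (val \o g)) => u v /=; rewrite hg.
by have := valP (g t); rewrite unfold_in => /asboolP.
Qed.

Lemma tensor_ext (W : lmodType C) (f g : T -> W) : linear f -> linear g ->
  (forall u v, f (tau u v) = g (tau u v)) -> f =1 g.
Proof.
move=> lf lg; apply: tensor_ind; split=> [|c u v hu hv].
  by have := linear0 (mklin lf); have := linear0 (mklin lg) => /= -> ->.
by rewrite lf lg hu hv.
Qed.

(** [T] comes with the diagonal action only; the universal property supplies the action on a single
    factor. *)
Lemma tensor_map (s : bool) (f : {linear M -> M}) : {F : {linear T -> T} |
  forall u v, F (tau u v) = if s then tau (f u) v else tau u (f v)}.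
Proof.
apply: cid; have [_ hT2 _] := hT.
case: (hT2 T (fun u v => if s then tau (f u) v else tau u (f v))) => //.
by split=> w c u v; case: s; rewrite ?linearP ?tensor_Dl ?tensor_Dr ?tensor_Zl ?tensor_Zr.
Qed.

Definition tact s f := sval (tensor_map s f).

Lemma tactE s f u v : tact s f (tau u v) = if s then tau (f u) v else tau u (f v).
Proof. exact: svalP (tensor_map s f) u v. Qed.

Lemma tensor_act x u v : ghat_act x (tau u v) = tau (ghat_act x u) v + tau u (ghat_act x v).
Proof. by case: hT. Qed.

Variable l : C.
Hypothesis hc : forall v : M, ghat_act (c_hat R) v = l *: v.

Lemma trep_br s t m s' t' n (v : T) :
  tact s (gact M (gx R t m)) (tact s' (gact M (gx R t' n)) v) =
  tact s' (gact M (gx R t' n)) (tact s (gact M (gx R t m)) v)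
  + (if s == s' then (br_c t t')%:~R *: tact s (gact M (gx R (br_t t t') (m + n))) v
       + (l * (m%:~R * (m + n == 0)%:R * (br_f t t')%:~R)) *: v else 0).
Proof.
have [<-|ss'] := eqVneq s s'; last first.
  rewrite addr0; move: v; apply: tensor_ext => [||u v].
  - by apply: lin_comp; apply: linearP.
  - by apply: lin_comp; apply: linearP.
  - by rewrite !tactE; case: s s' ss' => [] [] // _; rewrite !tactE.
move: v; apply: tensor_ext => [||u v].
- by apply: lin_comp; apply: linearP.
- apply: lin_add; first by apply: lin_comp; apply: linearP.
  by apply: lin_add; apply: lin_scale => //; apply: linearP.
case: s; rewrite !tactE /= act_gx hc scalerA [_ * l]mulrC.
  by rewrite !tensor_Dl !tensor_Zl.
by rewrite !tensor_Dr !tensor_Zr.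
Qed.

Lemma trep_D (x : op bool) v : gact T (Dg R) (tact x.1.1 (gact M (gx R x.1.2 x.2)) v) =
  tact x.1.1 (gact M (gx R x.1.2 x.2)) (gact T (Dg R) v)
  + (deg x)%:~R *: tact x.1.1 (gact M (gx R x.1.2 x.2)) v.
Proof.
move: v; apply: tensor_ext => [||u v].
- by apply: lin_comp; apply: linearP.
- apply: lin_add; first by apply: lin_comp; apply: linearP.
  by apply: lin_scale; apply: linearP.
case: x => [[s t] n]; rewrite /gact /= !tensor_act linearD !tactE; case: s => /=.
  by rewrite tensor_act Dg_gx tensor_Dl tensor_Zl addrAC.
by rewrite tensor_act Dg_gx tensor_Dr tensor_Zr addrA.
Qed.

Definition trep : rep bool T l :=
  @Rep C bool T l (fun x : op bool => tact x.1.1 (gact M (gx R x.1.2 x.2))) (gact T (Dg R))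
   trep_br trep_D.

Lemma trepE x u v : trep x (tau u v) =
  if x.1.1 then tau (ghat_act (gx R x.1.2 x.2) u) v else tau u (ghat_act (gx R x.1.2 x.2) v).
Proof. exact: tactE. Qed.

Lemma trep_diag t n (w : T) : ghat_act (gx R t n) w = trep (true, t, n) w + trep (false, t, n) w.
Proof.
move: w; apply: tensor_ext => [||u v].
- exact: linearP.
- by apply: lin_add; apply: linearP.
by rewrite tensor_act !trepE.
Qed.

Lemma tensor_c (w : T) : ghat_act (c_hat R) w = (2 * l) *: w.
Proof.
move: w; apply: tensor_ext => [||u v].
- exact: linearP.
- by apply: lin_scale.
by rewrite tensor_act !hc tensor_Zl tensor_Zr -scalerDl; congr (_ *: _); ring.
Qed.

Lemma tensor_sum t : exists (k : nat) (u v : 'I_k -> M), t = \sum_i tau (u i) (v i).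
Proof.
move: t; apply: tensor_ind => [|u v].
  split; first by exists 0%N, (fun _ => 0), (fun _ => 0); rewrite big_ord0.
  move=> c _ _ [k [u [v ->]]] [k' [u' [v' ->]]]; exists (k + k')%N.
  exists (fun i : 'I_(k + k') => match fintype.split i with inl i => c *: u i | inr i => u' i end).
  exists (fun i : 'I_(k + k') => match fintype.split i with inl i => v i | inr i => v' i end).
  rewrite big_split_ord scaler_sumr; congr (_ + _); apply: eq_bigr => i _.
    by case: split_ordP => j /eqP; rewrite ?eq_lshift ?eq_lrshift // => /eqP ->; rewrite tensor_Zl.
  by case: split_ordP => j /eqP; rewrite ?eq_rshift ?eq_rlshift // => /eqP ->.
by exists 1%N, (fun _ => u), (fun _ => v); rewrite big_ord1.
Qed.

(** A linear relation among the right factors eliminates one summand, so the number of summands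
    decreases until the right factors are independent. *)
Lemma tensor_indep t : exists (k : nat) (u v : 'I_k -> M), t = \sum_i tau (u i) (v i) /\
  forall d : 'I_k -> C, \sum_i d i *: v i = 0 -> forall i, d i = 0.
Proof.
have [k [u [v ->]]] := tensor_sum t; elim: k u v => [|k IH] u v.
  by exists 0%N, u, v; split=> // d _ [].
have [h|] := pselect (forall d : 'I_k.+1 -> C, \sum_i d i *: v i = 0 -> forall i, d i = 0).
  by exists k.+1, u, v.
move=> /existsNP[d /not_implyP[hd /existsNP[j /eqP dj]]].
have vj : v j = \sum_i (- (d j)^-1 * d (lift j i)) *: v (lift j i).
  move: hd; rewrite (bigD1_ord j) //= => /eqP; rewrite addr_eq0 => /eqP hd.
  rewrite -[v j]scale1r -(mulVf dj) -scalerA hd scalerN scaler_sumr -sumrN.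
  by apply: eq_bigr => i _; rewrite scalerA -scaleNr mulNr.
have [k' [u' [v' [e h]]]] := IH
  (fun i => u (lift j i) + (- (d j)^-1 * d (lift j i)) *: u j) (fun i => v (lift j i)).
exists k', u', v'; split=> //; rewrite -e (bigD1_ord j) //= {1}vj tensor_sumr -big_split /=.
by apply: eq_bigr => i _; rewrite tensor_Dl tensor_Zl tensor_Zr addrC.
Qed.

Section Top.
Variables (L : weight R) (v0 : M).
Hypothesis hM : is_V L M.
Hypothesis hv0 : highest_weight_vector L v0.

Lemma tensor_top_generates (P : T -> Prop) : subspace P -> P (tau v0 v0) ->
  (forall x t, P t -> P (trep x t)) -> forall t, P t.
Proof.
move=> sP P0 Px; have [[hl hr] _ _] := hT; apply: tensor_ind => // u v; move: u.
apply: (V_ind hM hv0) => [||t n u Pu].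
- exact: (subspace_preim (mklin (hl v)) sP).
- move: v; apply: (V_ind hM hv0) => [||t n v Pv] //.
    exact: (subspace_preim (mklin (hr v0)) sP).
  by have := Px (false, t, n) _ Pv; rewrite trepE.
by have := Px (true, t, n) _ Pu; rewrite trepE.
Qed.

Lemma tensor_top_neq0 : tau v0 v0 <> 0.
Proof.
have [f f0 _] := top_functional hM hv0; have [_ hT2 _] := hT.
case: (hT2 C^o (fun u v => f u * f v)).
  split=> w c x y; rewrite linearP.
    by rewrite mulrDl -scalerAl.
  by rewrite mulrDr -scalerAr.
move=> [g hg] _ t0; have := hg v0 v0; rewrite t0 linear0 f0 mulr1 => /eqP.
by rewrite eq_sym oner_eq0.
Qed.

(** The left factors are raised together by the first copy, then the right factor by the second. *)
Lemma tensor_top_mem (P : T -> Prop) t : subspace P -> (forall x t, P t -> P (trep x t)) ->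
  P t -> t <> 0 -> P (tau v0 v0).
Proof.
move=> sP Px Pt nt; have [k [u [v [et hv]]]] := tensor_indep t.
have [|||d [Pd nd]] := @V_raise _ _ _ _ hM hv0 _ (fun w => P (\sum_i tau (w i) (v i))) u.
- move=> s n w Pw; have := Px (true, s, n) _ Pw; rewrite linear_sum.
  by congr P; apply: eq_bigr => i _; rewrite trepE.
- by rewrite -et.
- by move=> u0; apply: nt; rewrite et big1 // => i _; rewrite u0 tensor_0l.
(* All left factors are now multiples of [v0], so the tensor is [tau v0 w]; independence of the
   [v i] keeps [w] nonzero. *)
pose w := \sum_i d i *: v i.
have Pw : P (tau v0 w).
  move: Pd; congr P; rewrite /w tensor_sumr; apply: eq_bigr => i _.
  by rewrite tensor_Zl tensor_Zr.
have [|||e [Pe ne]] := @V_raise _ _ _ _ hM hv0 unit (fun w => P (tau v0 (w tt))) (fun _ => w).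
- by move=> s n z Pz; have := Px (false, s, n) _ Pz; rewrite trepE.
- exact: Pw.
- by move=> /(_ tt) w0; apply: nd; apply: hv.
have e0 : e tt != 0 by apply/eqP => e0; apply: ne => - [].
by have := subspaceZ (e tt)^-1 sP Pe; rewrite tensor_Zr scalerA mulVf // scale1r.
Qed.

Lemma tensor_top_D : rD trep (tau v0 v0) = (2 * top_degree L) *: tau v0 v0.
Proof.
rewrite /= /gact /= tensor_act.
have hD : ghat_act (Dg R) v0 = top_degree L *: v0 by have := v0_D hM hv0.
by rewrite hD tensor_Zl tensor_Zr -scalerDl; congr (_ *: _); ring.
Qed.

Lemma tensor_top_pos x : 0 < deg x -> trep x (tau v0 v0) = 0.
Proof.
case: x => [[s t] n] hx; have h : ghat_act (gx R t n) v0 = 0.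
  by have := v0_pos hM hv0 (x := (tt, t, n)) hx.
by rewrite trepE /= h; case: s {hx}; rewrite ?tensor_0l // -(scale0r 0) tensor_Zr scale0r.
Qed.

Lemma tensor_top_h s : trep (s, Hb, 0) (tau v0 v0) = L.1.1 *: tau v0 v0.
Proof.
have h : ghat_act (gx R Hb 0) v0 = L.1.1 *: v0 by apply: weight_h; case: hv0.
by rewrite trepE /= h; case: s; rewrite ?tensor_Zl ?tensor_Zr.
Qed.
End Top.
End Tensor.

(** * The isomorphism with Fock space *)

Section ProductRep.
Variables (K : numFieldType) (S : eqType) (V W : lmodType K) (l : K).
Variables (a : rep S V l) (b : rep S W l).

Lemma prod_lin (f : {linear V -> V}) (g : {linear W -> W}) :
  linear (fun p : V * W => (f p.1, g p.2)).
Proof. by move=> c u v; rewrite !linearP. Qed.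

Lemma pairP (X Y : Type) (p q : X * Y) : p.1 = q.1 -> p.2 = q.2 -> p = q.
Proof. by case: p q => [? ?] [? ?] /= -> ->. Qed.

Lemma prod_br s t m s' t' n (p : V * W) :
  mklin (prod_lin (a (s, t, m)) (b (s, t, m))) (mklin (prod_lin (a (s', t', n)) (b (s', t', n))) p) =
  mklin (prod_lin (a (s', t', n)) (b (s', t', n))) (mklin (prod_lin (a (s, t, m)) (b (s, t, m))) p)
    + (if s == s' then (br_c t t')%:~R *:
         mklin (prod_lin (a (s, br_t t t', m + n)) (b (s, br_t t t', m + n))) p
         + (l * (m%:~R * (m + n == 0)%:R * (br_f t t')%:~R)) *: p
       else 0).
Proof. by apply: pairP; rewrite /= ra_br; case: ifP. Qed.

Lemma prod_D x (p : V * W) :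
  mklin (prod_lin (rD a) (rD b)) (mklin (prod_lin (a x) (b x)) p) =
  mklin (prod_lin (a x) (b x)) (mklin (prod_lin (rD a) (rD b)) p)
    + (deg x)%:~R *: mklin (prod_lin (a x) (b x)) p.
Proof. by apply: pairP; rewrite /= rD_br. Qed.

Definition prod_rep : rep S (V * W)%type l :=
  @Rep K S (V * W)%type l (fun x => mklin (prod_lin (a x) (b x))) (mklin (prod_lin (rD a) (rD b)))
    prod_br prod_D.

Lemma prod_repE x p : prod_rep x p = (a x p.1, b x p.2). Proof. by []. Qed.
End ProductRep.

Section TopVector.
Variable K : numClosedFieldType.
Notation F := {poly K}.
Notation fop := (@fop K).
Notation w := (@wvec K).

Let two0 : 2 != 0 :> K. Proof. by rewrite pnatr_eq0. Qed.

Lemma F4e_vac : F4e 0%N (1 : F).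
Proof. by move=> c; rewrite coef1; case: c => [_|c]; rewrite ?E2_0 ?eqxx. Qed.

Lemma wvec_hw : hwF 2 (1%:R / 2) w.
Proof. by have := hw2_F4e (e := 0%N) isT F4e_vac. Qed.

Lemma wvec_H s : fop (s, Hb, 0) w = w.
Proof. by rewrite /wvec H_uvec H_vac psv0 add0r scale1r. Qed.

Lemma wvec_pos x : 0 < deg x -> fop x w = 0.
Proof.
case: x => [[s t] [n|n]] hx; last by case: t hx; rewrite /deg /=; lia.
rewrite /wvec fop_psv /fop Cur_vac // psv0 add0r /psv big1 // => a _.
case: n hx => [|n] hx; last by rewrite (_ : n.+1%:Z + Negz 0 = n) ?psi_vac ?scaler0 //; lia.
case: t hx => // _; rewrite (_ : \sum_c _ = 0) ?scale0r // sum4; move: a.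
by apply: I4P; case: s; rewrite !sigE !mxE /uvec /=; field: (ii K).
Qed.

Lemma wvec_D : fD K w = 1 *: w.
Proof.
rewrite fDE; have [_ _ _ ->] := wvec_hw.
rewrite (eq_bigr (fun _ => w)) => [|s _]; last exact: wvec_H.
rewrite big_const card_bool /= addr0; apply/polyP => j; rewrite !(coefD, coefZ); by field.
Qed.

Lemma wvec_neq0 : w <> 0.
Proof.
move=> w0; have := raiseK F4e_vac; rewrite /raise -/(wvec K) w0 linear0 => /eqP.
by rewrite eq_sym oner_eq0.
Qed.

Lemma L0_fD (y : F) : L0 K y = 2^-1 *: (y - fD K y + 2^-1 *: \sum_s fop (s, Hb, 0) y).
Proof. by rewrite fDE; apply/polyP => j; rewrite !(coefD, coefN, coefZ); field. Qed.

Lemma fstable_D (U : F -> Prop) : subspace U -> (forall x y, U y -> U (fop x y)) ->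
  (forall y, U y -> U (fD K y)) -> fstable U.
Proof.
move=> sU Uop UD; split=> // y Uy; rewrite L0_fD; apply: subspaceZ => //.
apply: subspaceD => //; first by apply: subspaceB => //; apply: UD.
by apply: subspaceZ => //; apply: subspace_sum => // s _; apply: Uop.
Qed.

Lemma Fpar_stable p : fstable (@Fpar K p).
Proof.
by split; [exact: Fpar_subspace | move=> x y; apply: Fpar_op | move=> y; apply: Fpar_L0].
Qed.

End TopVector.

Section Isomorphism.
Variables (K : numClosedFieldType) (V : lmodType K) (a : rep bool V 1) (t0 : V).
Notation F := {poly K}.
Notation fop := (@fop K).
Notation w := (@wvec K).
Hypothesis t0_neq0 : t0 <> 0.
Hypothesis t0_D : rD a t0 = 1 *: t0.
Hypothesis t0_pos : forall x, 0 < deg x -> a x t0 = 0.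
Hypothesis t0_H : forall s, a (s, Hb, 0) t0 = t0.
Hypothesis t0_gen : forall P : V -> Prop, subspace P -> P t0 ->
  (forall x t, P t -> P (a x t)) -> forall t, P t.
Hypothesis t0_mem : forall (P : V -> Prop) t, subspace P ->
  (forall x t, P t -> P (a x t)) -> P t -> t <> 0 -> P t0.

Local Notation A := (prod_rep a (fock_rep K)).
Local Notation z0 := ((t0, w) : V * F).
Local Notation N := (gen A (line z0)).

Let sN : subspace N. Proof. exact: gen_subspace (line0 z0). Qed.

Let N0 : N z0. Proof. by apply: gen_base; exists 1; rewrite scale1r. Qed.

Lemma graph_op x p : N p -> N (A x p).
Proof.
move: x p; apply: gen_stable; first exact: line0.
move=> x _ hx [c ->]; rewrite linearZ_LR; apply: subspaceZ => //.
have [dx|dx] := eqVneq (deg x) 0.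
  have [s ->] := deg0 dx.
  by rewrite prod_repE /= t0_H; rewrite -/(fop _) wvec_H.
have hx' : 0 < deg x by rewrite lt_neqAle eq_sym dx.
have -> : A x z0 = 0 by apply: pairP; rewrite /= ?t0_pos ?wvec_pos.
by case: sN.
Qed.

Lemma graph_z0_D : rD A z0 = 1 *: z0.
Proof. by apply: pairP; rewrite /= ?t0_D ?wvec_D. Qed.

Lemma graph_D p : N p -> N (rD A p).
Proof.
move: p; apply: gen_D; first exact: line0.
by move=> _ [c ->]; rewrite linearZ_LR graph_z0_D scale1r; apply: subspaceZ.
Qed.

Lemma graph_par p : N p -> Fpar true p.2.
Proof.
elim=> [_ [c ->]|c u v _ hu _ hv|x v _ _ hv].
- apply: (subspaceZ c (Fpar_subspace _ _)); by case: (wvec_hw K).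
- by case: (Fpar_subspace K true) => _; apply.
- exact: Fpar_op.
Qed.

(** The coefficient [d] is common to both components; this is what keeps [(t0, 0)] and [(0, w)] out
    of the graph. *)
Lemma graph_top p : N p -> exists d : K, spec (below 0) (rD a) (p.1 - d *: t0) /\
  spec (below 0) (fD K) (p.2 - d *: w).
Proof.
move=> Np; have [d hd] := gen_top graph_z0_D Np; exists d; rewrite subrr in hd.
have l1 : linear (fst : V * F -> V) by [].
have l2 : linear (snd : V * F -> F) by [].
split.
  apply: (spec_map (f := mklin l1) (A := rD A) (k := 0) _ _ hd) => [v|c]; last by rewrite addr0.
  by rewrite scale0r addr0.
apply: (spec_map (f := mklin l2) (A := rD A) (k := 0) _ _ hd) => [v|c]; last by rewrite addr0.
by rewrite scale0r addr0.
Qed.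

Lemma low_t0 (c : K) : spec (below 0) (rD a) (c *: t0) -> c = 0.
Proof.
move=> h; have [//|c0] := eqVneq c 0; case: t0_neq0; apply: (top_low t0_D).
by have := subspaceZ c^-1 (spec_subspace _ _) h; rewrite scalerA mulVf // scale1r subrr.
Qed.

Lemma low_w (c : K) : spec (below 0) (fD K) (c *: w) -> c = 0.
Proof.
move=> h; have [//|c0] := eqVneq c 0; case: (@wvec_neq0 K).
apply: (top_low (a := fock_rep K) (wvec_D K)).
by have := subspaceZ c^-1 (spec_subspace _ _) h; rewrite scalerA mulVf // scale1r subrr.
Qed.

Lemma graph_inj t : N (t, 0) -> t = 0.
Proof.
move=> Nt; apply: contrapT => nt.
have st : subspace (fun t => N (t, 0)).
  split; first by case: sN.
  move=> c u v hu hv; have := sN.2 c _ _ hu hv; congr N.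
  by apply: pairP; rewrite //= scaler0 addr0.
have Nt0 : N (t0, 0).
  apply: (t0_mem (P := fun t => N (t, 0)) st _ Nt nt) => x u Nu.
  by have := graph_op x Nu; congr N; apply: pairP; rewrite //= linear0.
have [d [/= h1 h2]] := graph_top Nt0.
have d0 : d = 0 by apply/eqP; rewrite -oppr_eq0; apply/eqP/low_w; rewrite scaleNr -sub0r.
move: h1; rewrite d0 scale0r subr0 -[t0]scale1r => /low_t0/eqP.
by rewrite oner_eq0.
Qed.

(** Here [fock_irr] with zero as the smaller subspace plays the part that [t0_mem] plays for
    [graph_inj]. *)
Lemma graph_fun y : N (0, y) -> y = 0.
Proof.
move=> Ny; apply: contrapT => ny.
have sU : subspace (fun y => N (0, y)).
  split; first by case: sN.
  move=> c u v hu hv; have := sN.2 c _ _ hu hv; congr N.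
  by apply: pairP; rewrite //= scaler0 addr0.
have stU : fstable (fun y => N (0, y)).
  apply: fstable_D => // [x u Nu|u Nu].
    by have := graph_op x Nu; congr N; apply: pairP; rewrite //= linear0.
  by have := graph_D Nu; congr N; apply: pairP; rewrite //= linear0.
have st0 : fstable (fun y : F => y = 0).
  by apply: fstable_D => [|x u ->|u ->]; rewrite ?linear0 //; apply: subspace0.
have [|z [c [Nz nz /eqP]]] := fock_irr stU st0 _ Ny ny; first by move=> u /graph_par.
rewrite subr_eq0 => /eqP zw; subst z.
have [c0|c0] := eqVneq c 0; first by apply: nz; rewrite c0 scale0r.
have Nw : N (0, w).
  by have := subspaceZ c^-1 sU Nz; rewrite scalerA mulVf // scale1r.
have [d [/= h1 h2]] := graph_top Nw.
have d0 : d = 0 by apply/eqP; rewrite -oppr_eq0; apply/eqP/low_t0; rewrite scaleNr -sub0r.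
move: h2; rewrite d0 scale0r subr0 -[w]scale1r => /low_w/eqP.
by rewrite oner_eq0.
Qed.

Lemma graph_total t : exists y, N (t, y).
Proof.
move: t; apply: t0_gen; first split.
- by exists 0; case: sN.
- by move=> c u v [y hy] [z hz]; exists (c *: y + z); have := sN.2 c _ _ hy hz.
- by exists w.
- by move=> x t [y hy]; exists (fop x y); have := graph_op x hy.
Qed.

(** [fock_irr] is applied to the whole odd part and the image: a vector outside the image would
    yield one that is a multiple of [w] modulo the image, yet [w] is in the image. *)
Lemma graph_onto y : Fpar true y -> exists t, N (t, y).
Proof.
move=> hy; apply: contrapT => ny.
have sW : subspace (fun y => exists t, N (t, y)).
  split; first by exists 0; case: sN.
  by move=> c u v [s hs] [t ht]; exists (c *: s + t); have := sN.2 c _ _ hs ht.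
have stW : fstable (fun y => exists t, N (t, y)).
  apply: fstable_D => // [x u [t ht]|u [t ht]].
    by exists (a x t); have := graph_op x ht.
  by exists (rD a t); have := graph_D ht.
have [//|z [c [_ nz hz]]] := fock_irr (Fpar_stable K true) stW _ hy ny.
have Ww : exists t, N (t, w) by exists t0.
by apply: nz; have := subspaceD sW hz (subspaceZ c sW Ww); rewrite subrK.
Qed.

Lemma fock_iso : exists f : {linear V -> F},
  [/\ injective f, forall x t, f (a x t) = fop x (f t), forall t, f (rD a t) = fD K (f t),
      forall t, Fpar true (f t) & forall y, Fpar true y -> exists t, f t = y].
Proof.
have /choice[f hf] := graph_total.
have uniq t y y' : N (t, y) -> N (t, y') -> y = y'.
  move=> h h'; apply/eqP; rewrite -subr_eq0; apply/eqP/graph_fun.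
  by have := subspaceB sN h h'; congr N; apply: pairP; rewrite //= subrr.
have lf : linear f.
  by move=> c u v; apply: uniq (hf _) _; have := sN.2 c _ _ (hf u) (hf v).
exists (mklin lf); split=> [s t /= st|x t|t|t|y hy].
- apply/eqP; rewrite -subr_eq0; apply/eqP/graph_inj.
  have := subspaceB sN (hf s) (hf t); congr N.
  by apply: pairP; rewrite //= st subrr.
- by apply: uniq (hf _) _; have := graph_op x (hf t).
- by apply: uniq (hf _) _; have := graph_D (hf t).
- exact: graph_par (hf t).
- by have [t ht] := graph_onto hy; exists t; apply: uniq (hf _) _.
Qed.

End Isomorphism.

(** * Finite sets and partitions *)

Section Counting.
Local Open Scope nat_scope.

(** A cardinality relation for subsets of types that need not be finite, such as [seq nat]. *)
Definition counts (T : eqType) (P : pred T) (n : nat) :=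
  exists s : seq T, [/\ uniq s, s =i P & size s = n].

Lemma counts_uniq (T : eqType) (P : pred T) n n' : counts P n -> counts P n' -> n = n'.
Proof.
move=> [s [us sP <-]] [s' [us' sP' <-]]; apply: perm_size; apply: uniq_perm => // x.
by rewrite sP sP'.
Qed.

Lemma counts_ext (T : eqType) (P Q : pred T) n : P =1 Q -> counts P n -> counts Q n.
Proof. by move=> PQ [s [us sP <-]]; exists s; split=> // x; rewrite sP; apply: PQ. Qed.

Lemma counts0 (T : eqType) (P : pred T) : (forall x, ~~ P x) -> counts P 0.
Proof. by move=> P0; exists [::]; split=> // x; apply/esym/negbTE/P0. Qed.

Lemma counts_map (T T' : eqType) (P : pred T) (Q : pred T') (f : T -> T') n :
  {in P &, injective f} -> (forall x, P x -> Q (f x)) ->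
  (forall y, Q y -> exists2 x, P x & y = f x) -> counts P n -> counts Q n.
Proof.
move=> fI PQ QP [s [us sP <-]]; exists (map f s); split; last by rewrite size_map.
  rewrite map_inj_in_uniq // => x y; rewrite !sP => xP yP; exact: fI.
move=> y; apply/mapP/idP => [[x]|/QP[x Px ->]]; last by exists x => //; rewrite sP.
by rewrite sP => /PQ Qx ->.
Qed.

Lemma countsU (T : eqType) (P Q : pred T) n m : (forall x, P x -> ~~ Q x) ->
  counts P n -> counts Q m -> counts [pred x | P x || Q x] (n + m).
Proof.
move=> PQ [s [us sP <-]] [s' [us' sQ <-]]; exists (s ++ s'); split.
- rewrite cat_uniq us us' andbT /=; apply/hasPn => x; rewrite sQ sP => xQ.
  by apply/negP => /PQ; rewrite -[Q x]/(x \in Q) xQ.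
- by move=> x; rewrite mem_cat sP sQ.
- by rewrite size_cat.
Qed.

Lemma counts_sum (T : eqType) (P : nat -> pred T) (f : nat -> nat) N :
  (forall l l' x, P l x -> P l' x -> l = l') ->
  (forall l, counts (P l) (f l)) ->
  counts [pred x | has (fun l => P l x) (iota 0 N)] (\sum_(0 <= l < N) f l).
Proof.
move=> hP hf; elim: N => [|N IH]; first by rewrite big_geq //; apply: counts0.
rewrite big_nat_recr //; apply: counts_ext (countsU _ IH (hf N)) => x.
  by rewrite -[in RHS](addn1 N) /mem /= iotaD has_cat /= orbF.
move=> /hasP[l hl Pl]; apply/negP => /(hP _ _ _ Pl) lN.
by move: hl; rewrite lN mem_iota add0n ltnn andbF.
Qed.

Definition is_part k n : pred (seq nat) := fun p =>
  [&& sorted geq p, all (fun i => 0 < i <= k) p & sumn p == n].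

(* Sets of m natural numbers of sum n, given by their increasing enumerations. *)
Definition is_set m n : pred (seq nat) := fun l =>
  [&& sorted ltn l, size l == m & sumn l == n].

Lemma size_le_sumn p : all (fun i => 0 < i) p -> size p <= sumn p.
Proof. by elim: p => //= i p IH /andP[i0 /IH]; lia. Qed.

Lemma sumn_map_succ l : sumn (map succn l) = sumn l + size l.
Proof. by elim: l => //= i l ->; lia. Qed.

Lemma counts_rho k n : counts (is_part k n) (rho k n).
Proof.
pose P := [pred p : n.-bseq 'I_k.+1 | [&& sorted geq (map val p),
  all (fun i => 0 < i)%N (map val p) & sumn (map val p) == n]].
have h : counts P (rho k n) by exists (enum P); split; [apply: enum_uniq | move=> x; rewrite mem_enum | rewrite -cardE].
apply: (counts_map (f := fun p : n.-bseq 'I_k.+1 => map val p) _ _ _ h) => [p q _ _|p|l].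
- by move=> /(inj_map val_inj)/val_inj.
- move=> /and3P[h1 h2 h3]; apply/and3P; split=> //; apply/allP => i hi.
  by rewrite (allP h2 i hi); move/mapP: hi => [j _ ->]; rewrite -ltnS ltn_ord.
move=> /and3P[h1 h2 h3].
have h4 : all (fun i => 0 < i) l by apply: sub_all h2 => i /andP[].
have hs : size (map (inord : nat -> 'I_k.+1) l) <= n.
  by rewrite size_map -(eqP h3) size_le_sumn.
have hl : map val (map (inord : nat -> 'I_k.+1) l) = l.
  rewrite -map_comp -[RHS]map_id; apply/eq_in_map => i hi /=.
  by rewrite inordK // ltnS; case/andP: (allP h2 i hi).
by exists (Bseq hs); rewrite /= hl // h1 h4 h3.
Qed.

Lemma pos_map_succ l : 0 \notin l -> l = map succn (map predn l).
Proof.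
elim: l => //= i l IH; rewrite inE negb_or => /andP[i0 /IH <-].
by case: i i0.
Qed.

Lemma sorted_map_succ l : sorted ltn (map succn l) = sorted ltn l.
Proof. by rewrite sorted_map. Qed.

Lemma set_cases m n l : is_set m.+1 n l ->
  if 0 \in l then exists2 l', is_set m (n - m) l' & l = 0 :: map succn l'
  else exists2 l', is_set m.+1 (n - m.+1) l' & l = map succn l'.
Proof.
move=> /and3P[sl hm hn]; case: ifP => hl; last first.
  have e := pos_map_succ (negbT hl); exists (map predn l) => //.
  have hz : size (map predn l) = m.+1 by rewrite size_map; apply/eqP.
  move: (map predn l) e hz sl hn => l' -> hz.
  rewrite sorted_map_succ sumn_map_succ hz => sl hn.
  by rewrite /is_set sl hz eqxx /=; lia.
case: l sl hm hn hl => // i l /= sl hm hn hl.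
have hmin := order_path_min ltn_trans sl.
have i0 : i = 0.
  by move: hl; rewrite inE => /orP[/eqP //|/(allP hmin)].
subst i; have s' := path_sorted sl; have l0 : 0 \notin l by apply/negP => /(allP hmin).
have e := pos_map_succ l0; exists (map predn l); last by rewrite {1}e.
have hz : size (map predn l) = m by rewrite size_map; apply/eqP.
move: (map predn l) e hz s' hn => l' -> hz.
rewrite sorted_map_succ sumn_map_succ hz => s' hn.
by rewrite /is_set s' hz eqxx /=; lia.
Qed.

Lemma is_set_min m n l : is_set m n l -> 'C(m, 2) <= n.
Proof.
elim: (m + n) {-2}m {-2}n (leqnn (m + n)) l => {m n} [|N IH] m n hN l hl.
  by have -> : m = 0 by lia.
case: m hN hl => [|m] hN hl; first by rewrite bin0n.
case/and3P: (hl) => _ _ h3.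
have := set_cases hl; case: ifP => _ [l' hl' el]; case/and3P: (hl') => _ /eqP h4 _.
  have e3 : sumn l' + m = n by move: h3; rewrite el /= sumn_map_succ h4 add0n => /eqP.
  by rewrite binS bin1; have := IH m (n - m) ltac:(lia) _ hl'; lia.
have e3 : sumn l' + m.+1 = n by move: h3; rewrite el sumn_map_succ h4 => /eqP.
by have := IH m.+1 (n - m.+1) ltac:(lia) _ hl'; lia.
Qed.

Lemma set_succ m n l : is_set m n (map succn l) = (m <= n) && is_set m (n - m) l.
Proof.
rewrite /is_set sorted_map_succ size_map sumn_map_succ.
by case: (size l =P m) => [->|_]; rewrite ?andbF // !andTb; case: sorted => //=; lia.
Qed.

Lemma set_zero m n l : is_set m.+1 n (0 :: map succn l) = (m <= n) && is_set m (n - m) l.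
Proof.
rewrite -set_succ /is_set /= add0n path_min_sorted ?eqSS //.
by rewrite all_map; apply/allP.
Qed.

Lemma counts_nil (T : eqType) (P : pred (seq T)) : P [::] -> (forall i l, ~~ P (i :: l)) ->
  counts P 1.
Proof.
move=> P0 P1; exists [:: [::]]; split=> // - [|i l]; rewrite inE ?eqxx; apply/esym => //.
exact/negbTE/P1.
Qed.

(** Both counts obey one recursion, which leads directly to partitions with bounded parts. A
    partition with largest part k + 1 loses that part, as a set without 0 is shifted down by 1; the
    other partitions have parts at most k, as a set with 0 loses it and is then shifted. *)
Lemma counts_part_set k n : exists r, counts (is_part k n) r /\ counts (is_set k (n + 'C(k, 2))) r.
Proof.
elim: (k + n) {-2}k {-2}n (leqnn (k + n)) => {k n} [|N IH] k n hN.
  have -> : k = 0 by lia.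
  have -> : n = 0 by lia.
  exists 1; split; apply: counts_nil => // i l; rewrite /is_part /is_set /= ?andbF //.
  by apply/negP => /and3P[_ /andP[]]; lia.
case: k hN => [|k] hN.
  have [->|n0] := eqVneq n 0; last first.
    exists 0; split; apply: counts0 => - [|i l]; rewrite /is_part /is_set /=.
    - by rewrite eq_sym.
    - by apply/negP => /and3P[_ /andP[]]; lia.
    - by rewrite bin0n addn0 eq_sym.
    - by rewrite andbF.
  exists 1; split; apply: counts_nil => // i l; rewrite /is_part /is_set /= ?andbF //.
  by apply/negP => /and3P[_ /andP[]]; lia.
have [r1 [p1 s1]] := IH k n ltac:(lia).
have [r2 [p2 s2]] : exists r, counts [pred p | is_part k.+1 n p & head 0 p == k.+1] r /\
    counts [pred l | is_set k.+1 (n + 'C(k.+1, 2)) l & 0 \notin l] r.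
  (* For n <= k a part k + 1 does not fit, and a set without 0 would shift to one whose sum is below
     the staircase. *)
  have [nk|nk] := ltnP n k.+1.
    exists 0; split; apply: counts0 => l; apply/negP => /=.
      case/andP; case: l => [|i l] //= /and3P[_ _ /= hn] /eqP ik; lia.
    case/andP => hl /negbTE l0; have := set_cases hl; rewrite l0 => - [l' hl' el].
    move: (hl); rewrite el set_succ => /andP[h1 /is_set_min]; lia.
  have [r2 [p2 s2]] := IH k.+1 (n - k.+1) ltac:(lia).
  exists r2; split.
    apply: (counts_map (f := cons k.+1)) p2 => [l l' _ _ [] //|l|[|i l]] /=.
    - move=> /and3P[h1 h2 /eqP h3]; rewrite eqxx andbT /is_part /= leqnn h2 /= h3.
      rewrite path_min_sorted ?h1 ?subnKC ?eqxx //.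
      by apply: sub_all h2 => i /andP[].
    - by case/andP.
    - move=> /andP[/and3P[/= h1 /andP[_ h2] /eqP h3] /eqP ik]; subst i; exists l => //.
      by rewrite /is_part (path_sorted h1) h2 -h3 addKn eqxx.
  apply: (counts_map (f := map succn)) s2 => [l l' _ _ /(inj_map succn_inj) //|l hl|l /andP[hl l0]] /=.
    rewrite set_succ -addnBAC // hl andbT (leq_trans nk) ?leq_addr //=.
    by apply/mapP => - [].
  have := set_cases hl; rewrite (negbTE l0) => - [l' hl' el].
  by exists l' => //; rewrite addnBAC.
exists (r1 + r2); split.
  apply: counts_ext (countsU _ p1 p2) => [l|l].
    rewrite /=; apply/idP/idP.
      case/orP => [/and3P[h1 h2 h3]|/andP[]//].
      by apply/and3P; split=> //; apply: sub_all h2 => i; lia.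
    case/and3P => h1 h2 h3; have [hk|hk] := eqVneq (head 0 l) k.+1.
      by rewrite /is_part h1 h2 h3 orbT.
    rewrite andbF orbF /is_part h1 h3 /= andbT.
    case: l h1 h2 h3 hk => //= i l hp /andP[hi hl] _ hk; apply/andP; split; first lia.
    have := order_path_min (fun a b c => (fun h1 h2 => leq_trans h2 h1)) hp => hm.
    apply/allP => j jl; have := allP hl j jl; have := allP hm j jl; rewrite /geq /=; lia.
  case/and3P => h1 h2 h3 /=; rewrite negb_and; apply/orP; right.
  by case: l h1 h2 h3 => //= i l _ /andP[hi _] _; lia.
have s1' : counts [pred l | is_set k.+1 (n + 'C(k.+1, 2)) l & 0 \in l] r1; last first.
  apply: counts_ext (countsU _ s1' s2) => [l|l /andP[_ /= ->]]; last by rewrite andbF.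
  by rewrite /= -andb_orr orbN andbT.
apply: (counts_map (f := fun l => 0 :: map succn l)) s1 => [l l' _ _ [] /(inj_map succn_inj) //|l hl|l /andP[hl l0]] /=.
  rewrite set_zero inE eqxx andbT binS bin1 (_ : n + _ - k = n + 'C(k, 2)) ?hl ?andbT; lia.
have := set_cases hl; rewrite l0 => - [l' hl' el]; exists l' => //.
by move: hl'; rewrite binS bin1 (_ : n + _ - k = n + 'C(k, 2)) //; lia.
Qed.

Lemma counts_set k n : counts (is_set k (n + 'C(k, 2))) (rho k n).
Proof.
have [r [h1 h2]] := counts_part_set k n.
by rewrite (counts_uniq (counts_rho k n) h1).
Qed.

End Counting.

(** * States of fermion 0 as finite sets of naturals *)

Section Codes.
Local Open Scope nat_scope.
Notation q0 := (@Ordinal 4 0 isT).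
Notation q1 := (@Ordinal 4 1 isT).
Notation q2 := (@Ordinal 4 2 isT).
Notation q3 := (@Ordinal 4 3 isT).

Definition good e : pred nat := fun c =>
  [&& E2 q1 c == 0, E2 q2 c == 0, E2 q3 c == 0 & E2 q0 c == e].

Definition code := foldr (fun k c => flip (4 * k + q0) c) 0.

Lemma bit_code (l : seq nat) k (b : 'I_4) : uniq l -> bit (4 * k + b) (code l) = (b == q0) && (k \in l).
Proof.
elim: l => [|i l IH] /=; first by rewrite bit0 andbF.
move=> /andP[il ul]; rewrite bit_flip IH // inE.
have -> : (4 * i + 0 == 4 * k + b) = (b == q0) && (k == i).
  by rewrite -val_eqE /=; have := ltn_ord b; lia.
case: (b == q0) => //=; case: (k =P i) => [->|_]; last by rewrite addbF.
by rewrite (negbTE il).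
Qed.

Lemma E2_code a (l : seq nat) : uniq l -> E2 a (code l) = if a == q0 then 2 * sumn l + size l else 0.
Proof.
elim: l => [|i l IH] /=; first by rewrite E2_0 if_same.
move=> /andP[il ul]; have hb : ~~ bit (4 * i + q0) (code l) by rewrite bit_code.
have := E2_flip a hb; rewrite /= IH // => ->; rewrite [q0 == a]eq_sym.
by case: (a =P q0) => // _; lia.
Qed.

Lemma counts_good e n :
  counts [pred l : seq nat | sorted ltn l & 2 * sumn l + size l == e] n -> counts (good e) n.
Proof.
have us l : sorted ltn l -> uniq l by apply: sorted_uniq; [exact: ltn_trans | exact: ltnn].
apply: (counts_map (f := code)) => [l l' /andP[sl _] /andP[sl' _] ll'|l /andP[sl hl]|c].
- apply: (irr_sorted_eq ltn_trans ltnn) => // k.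
  by have := bit_code k q0 (us _ sl); rewrite ll' bit_code ?us.
- by rewrite /good !E2_code ?us.
case/and4P => h1 h2 h3 h0; pose l := [seq k <- iota 0 c | bit (4 * k + q0) c].
have sl : sorted ltn l by apply: sorted_filter; [exact: ltn_trans | exact: iota_ltn_sorted].
have hc : c = code l.
  apply: bit_inj => i; have [k [b ->]] : exists k (b : 'I_4), i = 4 * k + b.
    have hi : i %% 4 < 4 by rewrite ltn_mod.
    by exists (i %/ 4), (Ordinal hi); rewrite /= mulnC -divn_eq.
  rewrite bit_code ?us // mem_filter mem_iota add0n /=.
  have [->|b0] := eqVneq b q0.
    by case hb: bit => //=; apply/esym; have := bit_lt hb; rewrite /=; lia.
  apply/negP => /E2_bit; have : [\/ b = q1, b = q2 | b = q3].
    by move: b b0; apply: I4P => //; [constructor 1|constructor 2|constructor 3].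
  by case=> ->; rewrite ?(eqP h1) ?(eqP h2) ?(eqP h3).
exists l => //; rewrite /= sl.
have := E2_code q0 (us _ sl); rewrite -hc (eqP h0) /= => <-; apply: eqxx.
Qed.

Lemma bin2_odd_even j l : j <= 1 -> 'C(2 * l + j, 2) + l = 2 * (l * l) + 2 * (j * l).
Proof.
move=> hj; have e : 'C(2 * l + j, 2) * 2 = (2 * l + j) * (2 * l + j).-1.
  by rewrite bin2 muln2 halfK; case: odd (oddM (2 * l + j) (2 * l + j).-1); case: (2 * l + j) => // n; rewrite /= ?andNb ?subn0.
move: ('C(_, 2)) e => b; case: j hj => [|[]] // _.
  case: l => [|l]; first by rewrite /=; lia.
  by rewrite (_ : (2 * l.+1 + 0).-1 = 2 * l + 1); nia.
by rewrite (_ : (2 * l + 1).-1 = 2 * l); nia.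
Qed.

(** A set of size 2 l + j with doubled energy 2 s + j has sum s - l. The staircase takes away the
    binomial coefficient of 2 l + j over 2, which leaves s - 2 l^2 - 2 j l. *)
Lemma counts_level s j l : j <= 1 ->
  counts [pred x : seq nat | [&& sorted ltn x, size x == 2 * l + j & 2 * sumn x + size x == 2 * s + j]]
    (rho (2 * l + j) (s%:Z - 2 * l%:Z ^+ 2 - 2 * j%:Z * l%:Z)%R).
Proof.
move=> hj; have hb := bin2_odd_even l hj.
have [hs|hs] := leqP (2 * (l * l) + 2 * (j * l)) s.
  have -> : (s%:Z - 2 * l%:Z ^+ 2 - 2 * j%:Z * l%:Z = (s - (2 * (l * l) + 2 * (j * l)))%N :> int)%R.
    by rewrite -subzn // PoszD !PoszM expr2; ring.
  apply: counts_ext (counts_set _ _) => x; rewrite /is_set /=.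
  case: (sorted ltn x) => //=; case: (size x =P 2 * l + j) => //= ->.
  by apply/eqP/eqP; lia.
(* For a negative argument [rho] is 0 by definition, and [is_set_min] excludes every set because its
   sum would be below the staircase. *)
have [n ->] : exists n, (s%:Z - 2 * l%:Z ^+ 2 - 2 * j%:Z * l%:Z = Negz n)%R.
  exists (2 * (l * l) + 2 * (j * l) - s).-1.
  rewrite NegzE prednK ?subn_gt0 // -subzn ?(ltnW hs) // PoszD !PoszM expr2; ring.
apply: counts0 => x; apply/negP => /and3P[sx /eqP hx /eqP h].
have : is_set (2 * l + j) (s - l) x by rewrite /is_set sx hx eqxx; lia.
by move=> /is_set_min; lia.
Qed.

Lemma counts_good_levels s j B : j <= 1 ->
  (forall l, B < l -> s < 2 * (l * l) + 2 * (j * l)) ->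
  counts (good (2 * s + j))
    (\sum_(0 <= l < B.+1) rho (2 * l + j) (s%:Z - 2 * l%:Z ^+ 2 - 2 * j%:Z * l%:Z)%R).
Proof.
move=> hj hB; apply: counts_good.
apply: counts_ext (counts_sum _ _ (fun l => counts_level s l hj)) => [x|l l' x]; last first.
  by move=> /= /and3P[_ /eqP h _] /and3P[_ /eqP h' _]; lia.
apply/hasP/andP => [[l _ /and3P[-> _ ->]]|[sx hx]]; first by [].
(* The size has the parity of its doubled energy 2 s + j, so only sizes 2 l + j occur. *)
have [l hl] : exists l, size x = 2 * l + j.
  by exists (size x %/ 2); move/eqP: hx => hx; move: (size x) hx => n hx; lia.
exists l; last by rewrite /= sx hl eqxx /= -hl.
rewrite mem_iota leq0n add0n ltnS leqNgt; apply/negP => /hB hs.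
move/eqP: hx; rewrite hl => hx.
have : is_set (2 * l + j) (s - l) x by rewrite /is_set sx hl eqxx /=; apply/eqP; lia.
by move=> /is_set_min; have := bin2_odd_even l hj; lia.
Qed.
End Codes.

(** * Multiplicities *)

Section CoefficientSupport.
Variable K : fieldType.

(** The coefficient matrix of the family has independent rows, and spanning gives it a left inverse;
    so it is square. *)
Lemma basis_size (m : nat) (p : 'I_m -> {poly K}) (cs : seq nat) : uniq cs ->
  (forall i c, (p i)`_c != 0 -> c \in cs) ->
  (forall d : 'I_m -> K, \sum_i d i *: p i = 0 -> forall i, d i = 0) ->
  (forall c, c \in cs -> exists d : 'I_m -> K, 'X^c = \sum_i d i *: p i) -> m = size cs.
Proof.
move=> ucs hp ind span; pose n := size cs.
pose A : 'M[K]_(m, n) := \matrix_(i < m, j < n) (p i)`_(nth 0%N cs j).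
apply/eqP; rewrite eqn_leq; apply/andP; split.
  have fA : row_free A.
    apply: inj_row_free => v hv; apply/rowP => i; rewrite mxE; move: i; apply: ind.
    apply/polyP => c; rewrite coef0 coef_sum; under eq_bigr => i _ do rewrite coefZ.
    have [ccs|ccs] := boolP (c \in cs); last first.
      apply: big1 => i _; have [->|/hp] := eqVneq (p i)`_c 0; first by rewrite mulr0.
      by rewrite (negbTE ccs).
    have hc : (index c cs < n)%N by rewrite index_mem.
    have := congr1 (fun B : 'rV_n => B 0 (Ordinal hc)) hv; rewrite !mxE => h; rewrite -[RHS]h.
    by apply: eq_bigr => i _; rewrite mxE /= nth_index.
  by move/eqP: fA => <-; apply: rank_leq_col.
have /choice[d hd] : forall j : 'I_n, exists d : 'I_m -> K, 'X^(nth 0%N cs j) = \sum_i d i *: p i.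
  by move=> j; apply: span; rewrite mem_nth.
have h : (\matrix_(j < n, i < m) d j i) *m A = 1%:M.
  apply/matrixP => j k; rewrite !mxE; have := congr1 (fun q : {poly K} => q`_(nth 0%N cs k)) (hd j).
  rewrite coefXn coef_sum nth_uniq // -val_eqE eq_sym => ->.
  by apply: eq_bigr => i _; rewrite coefZ !mxE.
have := mxrankM_maxr (\matrix_(j < n, i < m) d j i) A; rewrite h mxrank1 => hn.
exact: leq_trans hn (rank_leq_row A).
Qed.
End CoefficientSupport.

(** * Multiplicities as dimensions of spaces of highest weight vectors *)

Section Multiplicity.
Variable R : realType.
Local Notation C := (complex R).
Implicit Types (M N T : ghat_module R) (L Phi : weight R).

Lemma weight_vectorP M L (v : M) : weight_vector L v <->
  [/\ ghat_act (gx R Hb 0) v = L.1.1 *: v, ghat_act (c_hat R) v = L.1.2 *: v &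
      ghat_act (d_hat R) v = L.2 *: v].
Proof.
split=> [h|[h1 h2 h3] H]; first by split; [exact: weight_h|exact: weight_c|exact: weight_d].
have -> : hhat_ghat H = H.1.1 *: gx R Hb 0 + H.1.2 *: c_hat R + H.2 *: d_hat R.
  have mul1 (d : C) : d *: (1 : C^o) = d by exact: mulr1.
  congr (_, _, _); rewrite /= ?scaler0 ?mul1 ?addr0 ?add0r //.
rewrite !actD !actZ h1 h2 h3 /weight_eval !scalerDl !scalerA.
by rewrite ![_ * H.1.1]mulrC ![_ * H.1.2]mulrC ![_ * H.2]mulrC.
Qed.

Lemma weight_inj M L L' (v : M) : v <> 0 -> weight_vector L v -> weight_vector L' v -> L = L'.
Proof.
move=> v0 /weight_vectorP[h1 h2 h3] /weight_vectorP[h1' h2' h3'].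
have inj (c d : C) : c *: v = d *: v -> c = d.
  move/eqP; rewrite -subr_eq0 -scalerBl scaler_eq0 subr_eq0 => /orP[/eqP //|/eqP //].
move: L L' h1 h2 h3 h1' h2' h3' => [[a b] c] [[a' b'] c'] /= -> -> -> /inj -> /inj -> /inj -> //.
Qed.

Definition is_hw Phi T (t : T) := weight_vector Phi t /\
  forall b n, 0 < deg (tt, b, n) -> ghat_act (gx R b n) t = 0.

Lemma highest_weight_is_hw M L (v : M) : highest_weight_vector L v -> is_hw L v.
Proof. by move=> [_ hw hn]; split=> // b n hb; apply: hn; apply: gx_nplus. Qed.

Lemma is_hw_subspace Phi T : subspace (@is_hw Phi T).
Proof.
split.
  split=> [H|b n _]; last exact: (linear0 (gact T (gx R b n))).
  by rewrite scaler0; exact: (linear0 (gact T (hhat_ghat H))).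
move=> c u v [hu pu] [hv pv]; split=> [H|b n hb]; rewrite ractD ractZ.
  by rewrite hu hv scalerDr !scalerA mulrC.
by rewrite pu // pv // scaler0 addr0.
Qed.

Lemma hom_is_hw M N (g : M -> N) Phi v : module_hom g -> is_hw Phi v -> is_hw Phi (g v).
Proof.
move=> [lg hg] [hw hp]; have gZ c u : g (c *: u) = c *: g u by exact: (linearZ_LR (mklin lg)).
split=> [H|b n hb]; first by rewrite -hg hw gZ.
by rewrite -hg hp // -(scale0r 0) gZ scale0r.
Qed.

Section Basis.
Variables (V : weight R -> ghat_module R) (T : ghat_module R) (m : weight R -> nat).
Hypothesis hV : forall L, dominant L -> is_V L (V L).
Hypothesis hm : decomposition V T m.

(* The highest weight vectors of weight Phi in T are spanned by those of the
   m Phi copies of V Phi, which are unique up to scalars. *)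
Lemma mult_basis Phi : dominant Phi -> exists b : 'I_(m Phi) -> T,
  [/\ forall i, is_hw Phi (b i),
      forall d : 'I_(m Phi) -> C, \sum_i d i *: b i = 0 -> forall i, d i = 0 &
      forall t, is_hw Phi t -> exists d : 'I_(m Phi) -> C, t = \sum_i d i *: b i].
Proof.
move=> domPhi; have [m0 [iota [hom [span ind]]]] := hm.
have ex_v : forall L, exists v : V L, dominant L -> highest_weight_vector L v.
  move=> L; have [/hV[_ _ [v hv]]|nL] := pselect (dominant L); first by exists v.
  by exists 0.
pose v L := sval (cid (ex_v L)); have hv L : dominant L -> highest_weight_vector L (v L) := svalP (cid (ex_v L)).
have dom (k : {L : weight R & 'I_(m L)}) : dominant (tag k).
  case: k => L i /=; apply: contrapT => nL; have mL := m0 _ nL.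
  by case: i; rewrite mL.
have iZ k c u : iota k (c *: u) = c *: iota k u.
  by case: (hom k) => lk _; exact: (linearZ_LR (mklin lk)).
have iB k u w : iota k (u - w) = iota k u - iota k w.
  by case: (hom k) => lk _; exact: (linearB (mklin lk)).
have i0 k : iota k 0 = 0 by rewrite -(subrr 0) iB subrr.
pose tg (i : 'I_(m Phi)) : {L : weight R & 'I_(m L)} := Tagged (fun L => 'I_(m L)) i.
have tgI : injective tg by move=> i j /eqP; rewrite eq_Tagged => /eqP.
exists (fun i => iota (tg i) (v Phi)); split.
- move=> i; apply: (hom_is_hw (hom (tg i))).
  by apply: highest_weight_is_hw; apply: hv.
- move=> d hd i.
  (* A family over all indices is required; the sum picks [d i] at [tg i] and is empty at indices of
     another weight, which avoids a cast between the modules. *)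
  pose x (k : {L : weight R & 'I_(m L)}) : V (tag k) := (\sum_(i | tg i == k) d i) *: v (tag k).
  have := ind [seq tg i | i <- enum 'I_(m Phi)] x; rewrite map_inj_uniq ?enum_uniq //.
  have xE j : x (tg j) = d j *: v Phi.
    by rewrite /x (big_pred1 j) // => k; rewrite /= (inj_eq tgI).
  rewrite big_map big_enum /= => /(_ isT) h; have /h : \sum_i iota (tg i) (x (tg i)) = 0.
    by rewrite -[RHS]hd; apply: eq_bigr => j _; rewrite xE iZ.
  move=> /(_ (tg i)); rewrite map_f ?mem_enum // xE => /(_ isT) /eqP.
  rewrite scaler_eq0 => /orP[/eqP //|/eqP v0].
  by case: (hv Phi domPhi).
(* The given list may repeat indices, while [ind] requires distinct ones; repeated summands are
   collected with their multiplicity. *)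
move=> t [tw tp]; have [s0 [x0 et0]] := span t.
pose s := undup s0; pose x k := x0 k *+ count_mem k s0.
have us : uniq s := undup_uniq s0.
have et : t = \sum_(k <- s) iota k (x k).
  rewrite et0 -big_undup_iterop_count; apply: eq_bigr => k _.
  have iMn n : iota k (x0 k *+ n) = iota k (x0 k) *+ n.
    by rewrite -scaler_nat iZ scaler_nat.
  by rewrite /x iMn; case: (count_mem k s0).
have sumB y : \sum_(k <- s) iota k (y k) = 0 -> forall k, k \in s -> y k = 0 by apply: ind.
have actx g : ghat_act g t = \sum_(k <- s) iota k (ghat_act g (x k)).
  rewrite {1}et; rewrite (linear_sum (gact T g)); apply: eq_bigr => k _ /=.
  by case: (hom k) => _ ->.
have xhw k : k \in s -> is_hw Phi (x k).
  move=> ks; split=> [H|b n hb]; last first.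
    by apply: (sumB (fun k => ghat_act (gx R b n) (x k))) => //; rewrite -actx tp.
  apply/eqP; rewrite -subr_eq0; apply/eqP.
  apply: (sumB (fun k => ghat_act (hhat_ghat H) (x k) - weight_eval Phi H *: x k)) => //.
  under eq_bigr => k' _ do rewrite iB iZ.
  by rewrite sumrB -actx -scaler_sumr -et tw subrr.
have /choice[c hc] : forall k, exists c : C, k \in s -> x k = c *: v (tag k).
  move=> k; have [ks|_] := boolP (k \in s); last by exists 0.
  have [c hc] := V_hw (hV (dom k)) (hv _ (dom k)) (xhw k ks).2.
  by exists c.
have xtag k : k \in s -> tag k != Phi -> x k = 0.
  move=> ks nk; apply: contrapT => xk; move/eqP: nk; apply.
  apply: (weight_inj xk _ (xhw k ks).1); rewrite (hc k ks).
  have [hw _] := highest_weight_is_hw (hv _ (dom k)).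
  by move=> H; rewrite ractZ hw !scalerA mulrC.
exists (fun i => if tg i \in s then c (tg i) else 0).
rewrite et (bigID (fun k => tag k == Phi)) /= [X in _ + X]big1_seq ?addr0; last first.
  by move=> k /andP[nk ks]; rewrite xtag.
rewrite (bigID (fun i => tg i \in s)) /= [X in _ = _ + X]big1 ?addr0; last first.
  by move=> i /negbTE ->; rewrite scale0r.
rewrite -big_filter -[RHS]big_filter.
have -> : \sum_(i <- [seq i <- index_enum _ | tg i \in s])
   (if tg i \in s then c (tg i) else 0) *: iota (tg i) (v Phi) =
   \sum_(k <- map tg [seq i <- index_enum _ | tg i \in s]) iota k (x k).
  rewrite big_map [LHS]big_filter [RHS]big_filter; apply: eq_bigr => i si.
  by rewrite si hc // iZ.
apply: perm_big; apply: uniq_perm.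
- exact: filter_uniq.
- by rewrite map_inj_uniq // filter_uniq // index_enum_uniq.
move=> k; rewrite mem_filter; apply/andP/mapP => [[/eqP tk ks]|[i hi ->]].
  case: k tk ks => L i /= tk; subst L => ks; exists i => //.
  by rewrite mem_filter mem_index_enum andbT.
by move: hi; rewrite mem_filter => /andP[-> _].
Qed.
End Basis.
End Multiplicity.

Section Lambda1Square.
Variable R : realType.
Local Notation C := (complex R).
Local Notation F := {poly C}.
Variables (M T : ghat_module R) (tau : M -> M -> T).
Hypothesis hM : is_V (@Lambda1 R) M.
Hypothesis hT : is_tensor tau.

Lemma Lambda1E : @Lambda1 R = ((1, 1, 0) : weight R).
Proof. by congr (_, _, _); rewrite /= ?addr0 ?add0r. Qed.

Lemma Lambda1_c (v : M) : ghat_act (c_hat R) v = 1 *: v.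
Proof. by have [_ _ [v0 hv0]] := hM; rewrite (V_c hM hv0) Lambda1E. Qed.

Lemma square_fock : exists f : {linear T -> F},
  [/\ injective f, forall t n x, f (ghat_act (gx R t n) x) = dop t n (f x),
      forall x, f (ghat_act (Dg R) x) = fD _ (f x),
      forall x, Fpar true (f x) & forall y, Fpar true y -> exists x, f x = y].
Proof.
have [_ _ [v0 hv0]] := hM.
have [||||||f [f1 f2 f3 f4 f5]] := @fock_iso C T (trep hT Lambda1_c) (tau v0 v0).
- exact (tensor_top_neq0 hT hM hv0).
- rewrite (tensor_top_D hT Lambda1_c hM hv0) /top_degree Lambda1E /=; congr (_ *: _).
  by rewrite mulr0 add0r mulr1 divff // pnatr_eq0.
- exact: tensor_top_pos hM hv0.
- by move=> s; rewrite (tensor_top_h hT Lambda1_c hv0) Lambda1E scale1r.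
- exact: tensor_top_generates hM hv0.
- exact: tensor_top_mem hM hv0.
exists f; split=> // t n x.
by rewrite (trep_diag hT Lambda1_c) linearD !f2.
Qed.

Lemma square_c (x : T) : ghat_act (c_hat R) x = 2 *: x.
Proof. by rewrite (tensor_c hT Lambda1_c) mulr1. Qed.

(** The principal grading is 2 d + h / 2 on [T] and 1 - 2 [L0] + h / 2 on Fock space, so [L0]
    corresponds to 1/2 - d. *)
Lemma square_hw (f : {linear T -> F}) (Phi : weight R) (n : nat) x :
  injective f -> (forall t n x, f (ghat_act (gx R t n) x) = dop t n (f x)) ->
  (forall x, f (ghat_act (Dg R) x) = fD _ (f x)) -> (forall x, Fpar true (f x)) ->
  Phi.1.1 = n%:R -> Phi.1.2 = 2 ->
  is_hw Phi x <-> hwF n (1 / 2 - Phi.2) (f x).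
Proof.
move=> fI fg fd fp hn hc; have two0 : 2 != 0 :> C by rewrite pnatr_eq0.
have fH : dop Hb 0 (f x) = f (ghat_act (gx R Hb 0) x) by rewrite fg.
have fD' u v : f (u + v) = f u + f v by exact: linearD.
have fZ c u : f (c *: u) = c *: f u by exact: linearZ_LR.
have fL : L0 C (f x) = 2^-1 *: (f x - f (ghat_act (Dg R) x) + 2^-1 *: dop Hb 0 (f x)).
  by rewrite L0_fD fd big_bool.
split=> [[/weight_vectorP[h1 h2 h3] hp]|[_ hp hH hE]].
  have fH' : dop Hb 0 (f x) = n%:R *: f x by rewrite fH h1 hn fZ.
  split=> // [t k hk|]; first by rewrite -fg hp ?linear0.
  rewrite fL fH' act_Dg h1 h3 hn fD' !fZ.
  by apply/polyP => j; rewrite !(coefD, coefN, coefZ); field.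
have eH : ghat_act (gx R Hb 0) x = n%:R *: x by apply: fI; rewrite -fH hH fZ.
split=> [|t k hk]; last by apply: fI; rewrite fg hp ?linear0.
apply/weight_vectorP; split; rewrite ?hn ?hc //; first exact: square_c.
apply: fI; have := fL; rewrite hE hH act_Dg eH fD' !fZ => h.
apply/polyP => j; have := congr1 (fun p : F => p`_j) h.
rewrite !(coefD, coefN, coefZ) => {}h.
have -> : (f (ghat_act (d_hat R) x))`_j = (1 / 2) * (f x)`_j - (1 / 2 - Phi.2) * (f x)`_j.
  by rewrite h; field.
by field.
Qed.

End Lambda1Square.

Section MultiplicityCount.
Variable R : realType.
Local Notation C := (complex R).
Local Notation F := {poly C}.
Variables (V : weight R -> ghat_module R) (T : ghat_module R) (m : weight R -> nat).
Hypothesis hV : forall L, dominant L -> is_V L (V L).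
Hypothesis hm : decomposition V T m.

(** [h] is left open because the two weights call for different maps: the isomorphism itself for
    weight 0, and the isomorphism followed by removal of the added fermion for weight 2. The latter
    is injective on highest weight vectors. *)
Lemma mult_counts Phi (h : {linear T -> F}) e n : dominant Phi ->
  (forall t, is_hw Phi t -> F4e e (h t)) ->
  (forall t, is_hw Phi t -> h t = 0 -> t = 0) ->
  (forall p, F4e e p -> exists2 t, is_hw Phi t & h t = p) ->
  counts (good e) n -> m Phi = n.
Proof.
move=> domPhi hF hI hS [cs [ucs csP <-]].
have [b [hb ind span]] := mult_basis hV hm domPhi.
have hsum (d : 'I_(m Phi) -> C) : h (\sum_i d i *: b i) = \sum_i d i *: h (b i).
  by rewrite linear_sum; apply: eq_bigr => i _; rewrite linearZ_LR.
apply: (basis_size (p := fun i => h (b i)) ucs) => [i c /(hF _ (hb i))[h1 h2 h3 h0]|d hd|c].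
- by rewrite csP; apply/and4P; rewrite h1 h2 h3 h0.
- apply: ind; apply: hI; last by rewrite hsum.
  by apply: subspace_sum => [|i _]; [|apply: subspaceZ => //]; apply: is_hw_subspace.
rewrite csP => /and4P[/eqP h1 /eqP h2 /eqP h3 /eqP h0].
have [|t ht <-] := hS 'X^c.
  by move=> c'; rewrite coefXn; case: (c' =P c) => [->|_]; rewrite ?eqxx.
by have [d ->] := span t ht; exists d.
Qed.

End MultiplicityCount.

Lemma LambdaE (R : realType) (j : 'I_2) (s : nat) :
  Lambda (rev_ord j) *+ 2 - delta *+ s =
  (((if j == 0 then 2%N else 0%N)%:R, 2, - s%:R) : weight R).
Proof.
have -> : @delta R *+ s = ((0, 0, s%:R) : weight R).
  elim: s => [|s IH]; first by rewrite mulr0n.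
  by rewrite mulrS IH; congr (_, _, _); rewrite /= ?addr0 // -natr1 addrC.
have -> : Lambda (rev_ord j) = (((if j == 0 then 1%N else 0%N)%:R, 1, 0) : weight R).
  by case: j => [[|[|//]] ?]; congr (_, _, _); rewrite /= ?addr0 ?add0r.
rewrite mulr2n; congr (_, _, _); rewrite /= ?subr0 ?addr0 ?sub0r //.
by rewrite -natrD; case: eqP.
Qed.

(** Beyond the bound, 2 l + j exceeds the square root of 2 s + j. On squaring, j^2 = j cancels and s
    < 2 l^2 + 2 j l remains. *)
Lemma sum_bound_lt (R : realType) (s j l : nat) : (j <= 1)%N ->
  (Num.truncn (sum_bound R j s) < l)%N -> (s < 2 * (l * l) + 2 * (j * l))%N.
Proof.
move=> hj hl.
have hL : sum_bound R j s < l%:R.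
  apply: lt_le_trans (truncnS_gt _) _.
  by rewrite ler_nat.
rewrite /sum_bound ltr_pdivrMr ?ltr0n // addrC ltrBlDr -natrM -natrD -natrM -natrD in hL.
have := hL; rewrite -[X in _ < X]ger0_norm ?ler0n // -sqrtr_sqr ltr_sqrt; last first.
  by rewrite -natrX ltr0n expn_gt0; lia.
by rewrite -natrX ltr_nat; nia.
Qed.

Theorem corollary2p6p3 (R : realType)
    (V : weight R -> ghat_module R)
    (hV : forall L : weight R, dominant L -> is_V L (V L))
    (T : ghat_module R) (tau : V Lambda1 -> V Lambda1 -> T)
    (hT : is_tensor tau)
    (m : weight R -> nat) (hm : decomposition V T m)
    (Phi : weight R) (hPhi : dominant Phi) :
  (m Phi <> 0%N ->
     exists (j : 'I_2) (s : nat), Phi = Lambda (rev_ord j) *+ 2 - delta *+ s)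
  /\
  (forall (j : 'I_2) (s : nat), Phi = Lambda (rev_ord j) *+ 2 - delta *+ s ->
     m Phi =
     (\sum_(0 <= l < (Num.truncn (sum_bound R j s)).+1)
        rho (2 * l + j)
          (s%:Z - 2 * l%:Z ^+ 2 - 2 * j%:Z * l%:Z)%R)%N).
Proof.
have hM : is_V Lambda1 (V Lambda1).
  apply: hV; split; [exists 0%N | exists 1%N]; rewrite Lambda1E /weight_eval /=; ring.
have [f [fI fg fd fp fS]] := square_fock hM hT.
have two0 : 2 != 0 :> complex R by rewrite pnatr_eq0.
split=> [mPhi|j s ePhi].
  have [b [hb ind _]] := mult_basis hV hm hPhi.
  have m0 : (0 < m Phi)%N by rewrite lt0n; apply/eqP.
  pose x := b (Ordinal m0).
  have x0 : x <> 0.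
    move=> x0; have := ind (fun i => (i == Ordinal m0)%:R) _ (Ordinal m0).
    rewrite eqxx => h; have /h/eqP : \sum_i (i == Ordinal m0)%:R *: b i = 0.
      rewrite (bigD1 (Ordinal m0)) //= -/x x0 scaler0 add0r big1 // => i /negbTE ->.
      by rewrite scale0r.
    by rewrite oner_eq0.
  have hx : is_hw Phi x := hb _.
  have hc : Phi.1.2 = 2.
    have [/weight_vectorP[_ h _] _] := hx; move: h; rewrite (square_c hM hT) => /eqP.
    by rewrite -subr_eq0 -scalerBl scaler_eq0 subr_eq0 => /orP[/eqP ->|/eqP].
  have [n hn] : exists n : nat, Phi.1.1 = n%:R.
    by have [_ [n hn]] := hPhi; exists n; rewrite -hn /weight_eval /= !mulr0 !addr0 mulr1.
  have hF := (square_hw hM hT x fI fg fd fp hn hc).1 hx.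
  have fx0 : f x != 0 by apply/eqP => fx0; apply: x0; apply: fI; rewrite fx0 linear0.
  have [e he oe] := hw_energy hF fx0.
  (* The energy e / 2 equals 1/2 - [Phi.2] and [e] is odd, so [s] is (e - 1) / 2. *)
  have hd : Phi.2 = - (e./2)%:R.
    have -> : Phi.2 = 1 / 2 - (1 / 2 - Phi.2) by ring.
    by rewrite he -{1}(odd_double_half e) oe natrD -muln2 natrM /=; field.
  (* Weight 2 belongs to 2 [Lambda1], where j = 0, and weight 0 to 2 [Lambda0], where j = 1. *)
  have hj : n = if (if n == 0%N then 1 else 0 : 'I_2) == 0 then 2%N else 0%N.
    by have /orP[/eqP ->|/eqP ->] := hw_cases hF fx0.
  exists (if n == 0%N then 1 else 0), e./2; rewrite LambdaE -hj -hd -hc -hn.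
  by case: Phi {hPhi mPhi b hb ind m0 x x0 hx hc hn hF fx0 he hd} => [[]].
have hc : Phi.1.2 = 2 by rewrite ePhi LambdaE.
have hj1 : (j <= 1)%N by have := ltn_ord j; lia.
have hn : Phi.1.1 = (if j == 0 then 2%N else 0%N)%:R by rewrite ePhi LambdaE.
have hE : 1 / 2 - Phi.2 = (2 * s)%N.+1%:R / 2.
  by rewrite ePhi LambdaE /= -[(2 * s)%N.+1%:R]natr1 natrM; field.
have hw x := square_hw hM hT x fI fg fd fp hn hc; rewrite hE in hw.
have cnt := counts_good_levels hj1 (fun l => @sum_bound_lt R s j l hj1).
case: (eqVneq j 0) => [j0|j1]; last first.
  have jE : j = 1%N :> nat by case: j j1 {ePhi hj1 hn hw cnt} => [[|[]]].
  (* For j = 1 fermion 0 carries the whole energy (2 s + 1) / 2. *)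
  rewrite (negbTE j1) in hw; rewrite jE addn1 in cnt *.
  apply: (mult_counts hV hm (h := f) hPhi _ _ _ cnt) => [t|t _ ft|p hp].
  - by move=> /hw/F4e_hw0.
  - by apply: fI; rewrite ft linear0.
  have hp0 : hwF 0 ((2 * s)%N.+1%:R / 2) p by apply: hw0_F4e => //=; rewrite mul2n odd_double.
  have [t ft] : exists t, f t = p by apply: fS; case: hp0.
  by exists t => //; apply/hw; rewrite ft.
have jE : j = 0%N :> nat by rewrite j0.
(* For j = 0 the added fermion carries energy 1/2, which leaves doubled energy 2 s for fermion 0. *)
rewrite j0 eqxx in hw; rewrite jE addn0 in cnt *.
pose q3 := @Ordinal 4 3 isT.
have rK p : F4e (2 * s) p -> psi (complex R) q3 0 (raise p) = p by move=> hp; apply: (raiseK hp).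
have lh : linear (fun t => psi (complex R) q3 0 (f t)) by apply: lin_comp; apply: linearP.
apply: (mult_counts hV hm (h := mklin lh) hPhi _ _ _ cnt) => [t|t|p hp].
- rewrite -[mklin lh t]/(psi (complex R) q3 0 (f t)).
  by move=> /hw/F4e_hw2[p hp ->]; rewrite (rK _ hp).
- rewrite -[mklin lh t]/(psi (complex R) q3 0 (f t)).
  move=> /hw/F4e_hw2[p hp et]; rewrite et (rK _ hp) => p0; apply: fI.
  by rewrite et p0 linear0 raiseE !linear0 ?scaler0 ?addr0.
have hp0 : hwF 2 ((2 * s)%N.+1%:R / 2) (raise p) by apply: hw2_F4e => //; rewrite mul2n odd_double.
have [t ft] : exists t, f t = raise p by apply: fS; case: hp0.
exists t; first by apply/hw; rewrite ft.
by rewrite -[mklin lh t]/(psi (complex R) q3 0 (f t)) ft (rK _ hp).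
Qed.
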